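(* If $A$ is a $C^*$-algebra and $T$ is a left centralizer of $K(A)$, then there is a direct sum decomposition $A=A_0\oplus A_1$ such that $A_1$ is a dual $C^*$-algebra and $T_{|K(A_0)}$ is locally bounded.
   Context: $K(A)$ denotes the Pedersen ideal of $A$, i.e. the smallest dense two-sided ideal of $A$. If $A=A_0\oplus A_1$ then $K(A)=K(A_0)\oplus K(A_1)$, and a left centralizer of $K(A)$ restricts to a left centralizer of $K(A_0)$. A left centralizer of an algebra $B$ is a linear transformation $T:B\to B$ (not assumed bounded) such that $T(xb)=(Tx)b$ for all $x,b\in B$. A left centralizer $T$ of $K(A)$ is locally bounded if there is a family $\{I_j\}$ of closed two-sided ideals of $A$ such that $A$ is the norm closure of $\sum_j I_j$ and $T_{|K(A)\cap I_j}$ is bounded for each $j$ (for $T_{|K(A_0)}$ this is applied with $A_0$ in place of $A$). An elementary $C^*$-algebra is one isomorphic to the algebra $\mathcal K(H)$ of compact operators on a Hilbert space $H$; a dual $C^*$-algebra is a $c_0$ direct sum of elementary $C^*$-algebras. In direct sum decompositions the summands are closed two-sided ideals and are allowed to be $\{0\}$. *)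

(* Defs.v *)
From HB Require Import structures.
From mathcomp Require Import all_boot all_order all_algebra.
From mathcomp Require Import all_classical all_reals all_analysis.
From mathcomp Require Import complex.

Set Implicit Arguments.
Unset Strict Implicit.
Unset Printing Implicit Defensive.

Import Order.TTheory GRing.Theory Num.Theory.
Import numFieldNormedType.Exports.

Local Open Scope classical_set_scope.
Local Open Scope ring_scope.
Local Open Scope complex_scope.

(* The scalars are R[i], and norms take their (real, nonnegative) values in
   R[i], as is the convention for normed modules.  C*-algebras need not have a
   unit, hence the multiplication cannot come from the ring hierarchy. *)
HB.mixin Record CompleteNormedModule_isCStarAlgebra (R : realType) A
    of CompleteNormedModule R[i] A := {
  cmul : A -> A -> A ;
  star : A -> A ;
  cmulA : associative cmul ;
  cmulDl : left_distributive cmul +%R ;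
  cmulDr : right_distributive cmul +%R ;
  cscalerAl : forall (a : R[i]) (x y : A), a *: cmul x y = cmul (a *: x) y ;
  cscalerAr : forall (a : R[i]) (x y : A), a *: cmul x y = cmul x (a *: y) ;
  starK : involutive star ;
  starD : {morph star : x y / x + y} ;
  starZ : forall (a : R[i]) (x : A), star (a *: x) = (a^*)%C *: star x ;
  starM : forall x y : A, star (cmul x y) = cmul (star y) (star x) ;
  cnormM : forall x y : A, `|cmul x y| <= `|x| * `|y| ;
  cnorm_star : forall x : A, `|cmul (star x) x| = `|x| ^+ 2
}.

#[short(type="cstarAlgType")]
HB.structure Definition CStarAlgebra (R : realType) :=
  {A of CompleteNormedModule R[i] A & CompleteNormedModule_isCStarAlgebra R A}.

Notation "x ** y" := (cmul x y) (at level 40, left associativity) : ring_scope.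

HB.mixin Record CompleteNormedModule_isHilbert (R : realType) H
    of CompleteNormedModule R[i] H := {
  inner : H -> H -> R[i] ;
  innerPl : forall (a : R[i]) (u v w : H),
    inner (a *: u + v) w = a * inner u w + inner v w ;
  inner_conj : forall u v : H, inner u v = ((inner v u)^*)%C ;
  inner_norm : forall u : H, inner u u = `|u| ^+ 2
}.

#[short(type="hilbertType")]
HB.structure Definition Hilbert (R : realType) :=
  {H of CompleteNormedModule R[i] H & CompleteNormedModule_isHilbert R H}.

(* Ideals of A are treated as subsets of A, and every notion below is relative
   to a closed ideal B of A, itself regarded as a C*-algebra; the whole algebra
   is B = setT. *)
Section Ideals.
Context {R : realType} {A : cstarAlgType R}.
Implicit Types B I K S : set A.

Definition linear_subspace I : Prop :=
  I 0 /\ forall (a : R[i]) (x y : A), I x -> I y -> I (a *: x + y).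

Definition ideal_of B I : Prop :=
  [/\ I `<=` B, linear_subspace I
    & forall b x, B b -> I x -> I (b ** x) /\ I (x ** b)].

Definition closed_ideal_of B I : Prop := ideal_of B I /\ closed I.

Definition dense_ideal_of B I : Prop := ideal_of B I /\ B `<=` closure I.

(* The smallest dense two-sided ideal, as the intersection of all of them; that
   this intersection is again dense is a theorem of Pedersen. *)
Definition pedersen_ideal B : set A := \bigcap_(I in dense_ideal_of B) I.

(* A map K -> K is represented by a map A -> A whose values outside K are
   irrelevant; restricting it to a smaller set leaves it unchanged. *)
Definition left_centralizer K (T : A -> A) : Prop :=
  [/\ forall x, K x -> K (T x),
      forall (a : R[i]) (x y : A), K x -> K y -> T (a *: x + y) = a *: T x + T y
    & forall x b, K x -> K b -> T (x ** b) = T x ** b].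

Definition bounded_on S (T : A -> A) : Prop :=
  exists M : R[i], forall x, S x -> `|T x| <= M * `|x|.

Definition ideal_sum (J : Type) (I : J -> set A) : set A :=
  [set x | exists s : seq J, exists2 a : J -> A,
     (forall j, I j (a j)) & x = \sum_(j <- s) a j].

(* T restricted to pedersen_ideal B is a locally bounded left centralizer. *)
Definition locally_bounded B (T : A -> A) : Prop :=
  left_centralizer (pedersen_ideal B) T /\
  exists (J : Type) (I : J -> set A),
    [/\ forall j, closed_ideal_of B (I j),
        B = closure (ideal_sum I)
      & forall j, bounded_on (pedersen_ideal B `&` I j) T].

Definition direct_sum_decomposition (A0 A1 : set A) : Prop :=
  [/\ closed_ideal_of [set: A] A0,
      closed_ideal_of [set: A] A1,
      A0 `&` A1 = [set 0]
    & forall x, exists x0 x1, [/\ A0 x0, A1 x1 & x = x0 + x1]].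

End Ideals.

Section Dual.
Context {R : realType}.

Definition compact_operator (H : hilbertType R) (k : H -> H) : Prop :=
  linear k /\ precompact (k @` [set u | `|u| <= 1]).

(* phi is a *-isomorphism of E onto the algebra of compact operators of H. *)
Definition elementary_cstar (E : cstarAlgType R) : Prop :=
  exists (H : hilbertType R) (phi : E -> H -> H),
    [/\ forall (a : R[i]) (x y : E) (u : H),
          phi (a *: x + y) u = a *: phi x u + phi y u,
        forall (x y : E) (u : H), phi (x ** y) u = phi x (phi y u),
        forall (x : E) (u v : H), inner (phi (star x) u) v = inner u (phi x v),
        injective phi
      & range phi = [set k | compact_operator k]].

Definition c0_sum (J : Type) (E : J -> cstarAlgType R) : set (forall j, E j) :=
  [set f | forall e : R[i], 0 < e -> finite_set [set j | e <= `|f j|]].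

(* phi restricts to a *-isomorphism of the closed ideal B onto the c_0 direct
   sum of the E j, whose operations are pointwise. *)
Definition dual_cstar (A : cstarAlgType R) (B : set A) : Prop :=
  exists (J : Type) (E : J -> cstarAlgType R) (phi : A -> forall j, E j),
    (forall j, elementary_cstar (E j)) /\
    [/\ forall (a : R[i]) (x y : A) j, B x -> B y ->
          phi (a *: x + y) j = a *: phi x j + phi y j,
        forall (x y : A) j, B x -> B y -> phi (x ** y) j = phi x j ** phi y j,
        forall (x : A) j, B x -> phi (star x) j = star (phi x j),
        {in B &, injective phi}
      & phi @` B = @c0_sum J E].

End Dual.

(* Main.v *)
(* Let N be the ideal of those d in K(A) for which x |-> T (x d) is bounded on
   A.  If c_n is an orthogonal sequence with a common unit g (c_n g = c_n), then
   c_n^2 lies in N for some n: otherwise a gliding hump y = sum x_k c_k, which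
   belongs to K(A) because y g = y, makes T y infinite.

   Let A_1 be the closed ideal generated by the minimal projections p that are
   not in N, and A_0 its annihilator.  If a g = a, a maximal orthogonal family
   of such p with p g = p is finite; with q its sum, a q is in A_1, and
   a - a q is in A_0, for otherwise some p v (a - a q) is a multiple of a
   partial isometry which transports p below g and off q.  Such a are dense, so
   A = A_0 + A_1.  A_1 is a c_0 sum of elementary blocks, the block of p acting
   on the Hilbert space A p as the compact operators.

   Local boundedness on A_0 needs b^2 in N for b with a unit g in A_0.  The
   elements d of N with g d = d are uniformly bounded, so if b^2 is not in N
   their annihilator inside {c | g c = c g = c} is nonzero.  It meets N in 0,
   hence has no infinite orthogonal sequence of nonzero elements and contains a
   minimal projection not in N; but A_0 has none.

   The functional calculus rests on |p(h)| <= sup_[-1, 1] |p| for real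
   polynomials p and self-adjoint h with |h| <= 1: h = (U + V) / 2 for mutually
   inverse isometries U, V = h +- i sqrt (1 - h^2), so a bound on Fourier
   coefficients gives the estimate up to a factor linear in the degree, and
   applying it to the powers p^(2^n) removes the factor. *)

(* The absence of a unit and of spectral projections shapes the proof. Both are replaced by cuts:
   elements f(h) with f vanishing near 0, for which a lower cut is a unit of a higher one. Since
   K(A) is an intersection of ideals, its elements are hard to describe; the test used is that e g =
   e forces e into K(A), which is why a common unit g accompanies every construction. An estimate
   known only on part of the algebra is transferred by one device: z is bounded below by |z| / 2 on
   the range of the top cut w of z* z, so a smaller upper bound for z on some w y forces w y = 0.
   This gives either a contradiction with w <> 0 or a nonzero element of an annihilator. The price
   is a factor 2, harmless because only boundedness and convergence are at stake. The relation T(x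
   d) = T(x) d moves right factors out of T, so what kills y on the right also kills T(y). Local
   boundedness is therefore proved on second annihilators: if y belongs to that of f and f A w = 0,
   then y A w = 0 and T(y) w w = 0. *)
Require Import Defs.
From HB Require Import structures.
From mathcomp Require Import all_boot all_order all_algebra.
From mathcomp Require Import all_classical all_reals all_analysis.
From mathcomp Require Import cyclic separable cyclotomic complex.
From mathcomp Require Import ring lra zify.

Set Implicit Arguments.
Unset Strict Implicit.
Unset Printing Implicit Defensive.

Import Order.TTheory GRing.Theory Num.Theory.
Import numFieldNormedType.Exports.

Local Open Scope classical_set_scope.
Local Open Scope ring_scope.
Local Open Scope complex_scope.

(* Equalities in an abelian group, which [ring] does not decide. *)
Inductive zexp := ZVar of nat | ZAdd of zexp & zexp | ZOpp of zexp | ZZero.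

Fixpoint zeval (V : zmodType) (env : seq V) e : V :=
  match e with
  | ZVar n => nth 0 env n
  | ZAdd a b => zeval env a + zeval env b
  | ZOpp a => - zeval env a
  | ZZero => 0
  end.

Fixpoint zcoef (i : nat) e : int :=
  match e with
  | ZVar n => if i == n then 1 else 0
  | ZAdd a b => zcoef i a + zcoef i b
  | ZOpp a => - zcoef i a
  | ZZero => 0
  end.

Lemma zevalE (V : zmodType) (env : seq V) e :
  zeval env e = \sum_(i < size env) nth 0 env i *~ zcoef i e.
Proof.
elim: e => [n|a iha b ihb|a iha|] /=; rewrite ?iha ?ihb.
- have [ns|ns] := ltnP n (size env).
    rewrite (bigD1 (Ordinal ns)) //= eqxx mulr1z big1 ?addr0 // => i.
    by rewrite -val_eqE /= => /negPf ->; rewrite mulr0z.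
  rewrite nth_default // big1 // => i _.
  by rewrite ltn_eqF ?mulr0z // (leq_trans (ltn_ord i)).
- by rewrite -big_split; apply: eq_bigr => i _ /=; rewrite mulrzDr.
- by rewrite -sumrN; apply: eq_bigr => i _; rewrite mulrNz.
- by rewrite big1 // => i _; rewrite mulr0z.
Qed.

(** The test compares integer coefficients atom by atom and runs by computation, so [zmod] passes
    [isT] as its proof. *)
Lemma zeval_eq (V : zmodType) (env : seq V) e1 e2 :
  all (fun i => zcoef i e1 == zcoef i e2) (iota 0 (size env)) ->
  zeval env e1 = zeval env e2.
Proof.
move=> /allP h; rewrite !zevalE; apply: eq_bigr => i _; congr (_ *~ _).
by apply/eqP/h; rewrite mem_iota /=.
Qed.

(* Scalings may carry syntactically different (but convertible) structures. *)
Ltac zsame x y :=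
  first
  [ constr_eq x y
  | lazymatch x with
    | @GRing.scale _ _ ?a ?u =>
      lazymatch y with @GRing.scale _ _ ?b ?v => unify a b; zsame u v end
    | @cmul _ _ ?u ?u' =>
      lazymatch y with @cmul _ _ ?v ?v' => zsame u v; zsame u' v' end
    | @star _ _ ?u =>
      lazymatch y with @star _ _ ?v => zsame u v end
    | ?f ?u =>
      lazymatch y with ?g ?v => constr_eq f g; zsame u v end
    end ].

Ltac zindex x env :=
  lazymatch env with
  | ?y :: ?env' =>
    match goal with
    | _ => let _ := match goal with _ => zsame x y end in constr:(O)
    | _ => let n := zindex x env' in constr:(S n)
    end
  end.

Ltac zatoms t env :=
  lazymatch t with
  | @Algebra.add _ ?a ?b => let env' := zatoms a env in zatoms b env'
  | @Algebra.opp _ ?a => zatoms a env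
  | @Algebra.zero _ => env
  | _ => match goal with
         | _ => let _ := zindex t env in env
         | _ => constr:(t :: env)
         end
  end.

Ltac zreify t env :=
  lazymatch t with
  | @Algebra.add _ ?a ?b =>
    let a' := zreify a env in let b' := zreify b env in constr:(ZAdd a' b')
  | @Algebra.opp _ ?a => let a' := zreify a env in constr:(ZOpp a')
  | @Algebra.zero _ => constr:(ZZero)
  | _ => let n := zindex t env in constr:(ZVar n)
  end.

Ltac zmod :=
  lazymatch goal with
  | |- @eq ?T ?a ?b =>
    let env0 := constr:(@nil T) in
    let env1 := zatoms a env0 in
    let env := zatoms b env1 in
    let a' := zreify a env in
    let b' := zreify b env in
    exact: (@zeval_eq _ env a' b' isT)
  end.

(** * Real-valued norms *)

Section RealNorm.
Context {R : realType} {V : normedModType R[i]}.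
Implicit Types x y : V.

(** The norm of the hierarchy lies in [R[i]]; its real part carries the same information and puts
    every estimate in a real field, where [lra] applies. *)
Definition nrm x : R := complex.Re `|x|.

Lemma nrmE x : `|x| = (nrm x)%:C.
Proof. by rewrite /nrm RRe_real // ger0_real. Qed.

Lemma nrm_ge0 x : 0 <= nrm x.
Proof. by rewrite -ler0c -nrmE. Qed.

Lemma ler_nrmE x (r : R) : (`|x| <= r%:C) = (nrm x <= r).
Proof. by rewrite nrmE lecR. Qed.

Lemma nrm0 : nrm (0 : V) = 0.
Proof. by rewrite /nrm normr0. Qed.

Lemma nrm0_eq0 x : nrm x = 0 -> x = 0.
Proof. by move=> x0; apply: normr0_eq0; rewrite nrmE x0. Qed.

Lemma nrm_gt0 x : x <> 0 -> 0 < nrm x.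
Proof.
by move=> x0; rewrite lt_neqAle nrm_ge0 andbT eq_sym; apply/eqP => /nrm0_eq0.
Qed.

Lemma ler_nrmD x y : nrm (x + y) <= nrm x + nrm y.
Proof. by rewrite -lecR rmorphD /= -!nrmE ler_normD. Qed.

Lemma nrmN x : nrm (- x) = nrm x.
Proof. by rewrite /nrm normrN. Qed.

Lemma nrmC x y : nrm (x - y) = nrm (y - x).
Proof. by rewrite -nrmN opprB. Qed.

Lemma ler_nrmB x y : nrm (x - y) <= nrm x + nrm y.
Proof. by rewrite -(nrmN y) ler_nrmD. Qed.

Lemma ler_nrm_add x y : nrm x <= nrm y + nrm (x - y).
Proof. by rewrite -{1}(subrK y x) addrC ler_nrmD. Qed.

Lemma nrmZ (a : R[i]) x : nrm (a *: x) = complex.Re `|a| * nrm x.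
Proof.
by rewrite /nrm normrZ (nrmE x) -(RRe_real (ger0_real (normr_ge0 a))) -rmorphM.
Qed.

Lemma nrmZr (r : R) x : nrm (r%:C *: x) = `|r| * nrm x.
Proof.
by rewrite nrmZ; congr (_ * _); rewrite normc_def /= expr0n addr0 sqrtr_sqr.
Qed.

Lemma ler_nrm_sum (I : Type) (s : seq I) (P : pred I) (F : I -> V) :
  nrm (\sum_(i <- s | P i) F i) <= \sum_(i <- s | P i) nrm (F i).
Proof.
elim/big_ind2: _ => [|x1 x2 y1 y2 h1 h2|//]; first by rewrite nrm0.
exact: le_trans (ler_nrmD _ _) (lerD h1 h2).
Qed.

Lemma le_epsilon (a b : R) : (forall e, 0 < e -> a <= b + e) -> a <= b.
Proof. by move=> h; apply/ler_addgt0Pr => e e0; exact: h. Qed.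

Lemma nrm_le0 x : nrm x <= 0 -> x = 0.
Proof. by move=> h; apply: nrm0_eq0; apply/eqP; rewrite eq_le h nrm_ge0. Qed.

Lemma nrm_eq0_eps x : (forall e, 0 < e -> nrm x <= e) -> x = 0.
Proof. by move=> h; apply: nrm_le0; apply: le_epsilon => e /h; rewrite add0r. Qed.

Lemma posC (e : R[i]) : 0 < e -> exists2 r : R, 0 < r & e = r%:C.
Proof.
move=> e0; have er : e = (complex.Re e)%:C by rewrite RRe_real // gtr0_real.
by exists (complex.Re e) => //; rewrite -ltcR -er.
Qed.

Lemma nbhs_nrmP x (P : set V) :
  nbhs x P <-> exists2 e : R, 0 < e & forall y, nrm (x - y) < e -> P y.
Proof.
split.
  move=> /nbhs_normP[e /= /posC[r r0 ->] h]; exists r => // y xy.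
  by apply: h; rewrite /ball_ /= nrmE ltcR.
move=> [e e0 h]; apply/nbhs_normP; exists e%:C; first by rewrite /= ltcR.
by move=> y; rewrite /ball_ /= nrmE ltcR => /h.
Qed.

Lemma closure_nrmP (S : set V) x :
  closure S x <-> forall e : R, 0 < e -> exists2 y, S y & nrm (x - y) <= e.
Proof.
split=> [cx e e0 | h P /nbhs_nrmP[e e0 hP]].
  have /cx[y [Sy /ltW xy]] : nbhs x [set y | nrm (x - y) < e].
    by apply/nbhs_nrmP; exists e.
  by exists y.
have [y Sy xy] := h (e / 2) (divr_gt0 e0 (ltr0Sn _ 1)).
exists y; split=> //; apply: hP; apply: le_lt_trans xy _; lra.
Qed.

Lemma closed_nrmP (S : set V) :
  closed S <-> forall x,
    (forall e : R, 0 < e -> exists2 y, S y & nrm (x - y) <= e) -> S x.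
Proof.
split=> [cS x /closure_nrmP|h]; first by rewrite -(closure_id S).1.
by rewrite closure_id eqEsubset; split=> [|x /closure_nrmP/h//];
  exact: subset_closure.
Qed.

End RealNorm.

(** The steps are bounded by differences of [rho], so their sums telescope: the sequence is Cauchy
    and its limit comes with the explicit rate [rho]. *)
Lemma lim_telescope (R : realType) (V : completeNormedModType R[i])
    (s : nat -> V) (rho : nat -> R) :
  (forall n, nrm (s n.+1 - s n) <= rho n - rho n.+1) ->
  (forall n, 0 <= rho n) ->
  (forall e, 0 < e -> exists n, rho n <= e) ->
  exists l, forall n, nrm (l - s n) <= rho n.
Proof.
move=> hs r0 rlim.
have hnm n k : nrm (s (n + k)%N - s n) <= rho n - rho (n + k)%N.
  elim: k => [|k ih]; first by rewrite addn0 !subrr nrm0.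
  rewrite addnS -(subrKA (s (n + k)%N)).
  have := ler_nrmD (s (n + k).+1 - s (n + k)%N) (s (n + k)%N - s n).
  have := hs (n + k)%N; lra.
have hle n m : (n <= m)%N -> nrm (s m - s n) <= rho n.
  by move=> /subnKC <-; have := hnm n (m - n)%N; have := r0 (n + (m - n))%N; lra.
have /cvg_ex[l sl] : cvg (s @ \oo).
  apply/cauchy_cvgP; apply/cauchyP => e /posC[r rp ->].
  have [n rn] := rlim (r / 2) (divr_gt0 rp (ltr0Sn _ 1)).
  exists (s n); exists n => // m /= /hle h.
  rewrite -ball_normE /ball_ /= nrmE ltcR nrmC.
  apply: le_lt_trans h _; lra.
exists l => n; apply: le_epsilon => e e0.
have e0' : 0 < e%:C by rewrite ltcR.
move: sl => /cvgrPdist_le /(_ _ e0')[N _ hN].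
have := hN (maxn N n) (leq_maxl _ _); rewrite /= ler_nrmE => h1.
have h2 := hle n (maxn N n) (leq_maxr _ _).
rewrite -(subrKA (s (maxn N n))).
apply: le_trans (ler_nrmD _ _) _; lra.
Qed.

(** * Arithmetic of the product and the involution *)

Section Arithmetic.
Context {R : realType} {A : cstarAlgType R}.
Implicit Types x y z : A.

Lemma cmul0l x : 0 ** x = 0.
Proof. by apply: (addrI (0 ** x)); rewrite -cmulDl !addr0. Qed.

Lemma cmul0r x : x ** 0 = 0.
Proof. by apply: (addrI (x ** 0)); rewrite -cmulDr !addr0. Qed.

Lemma cmulNl x y : (- x) ** y = - (x ** y).
Proof. by apply: (addrI (x ** y)); rewrite -cmulDl !subrr cmul0l. Qed.

Lemma cmulNr x y : x ** (- y) = - (x ** y).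
Proof. by apply: (addrI (x ** y)); rewrite -cmulDr !subrr cmul0r. Qed.

Lemma cmulBl x y z : (x - y) ** z = x ** z - y ** z.
Proof. by rewrite cmulDl cmulNl. Qed.

Lemma cmulBr x y z : x ** (y - z) = x ** y - x ** z.
Proof. by rewrite cmulDr cmulNr. Qed.

Lemma cmul_suml (I : Type) (s : seq I) (P : pred I) (F : I -> A) x :
  (\sum_(i <- s | P i) F i) ** x = \sum_(i <- s | P i) F i ** x.
Proof.
elim/big_rec2: _ => [|i y1 y2 _ <-]; [exact: cmul0l|exact: cmulDl].
Qed.

Lemma cscalel (a : R[i]) x y : (a *: x) ** y = a *: (x ** y).
Proof. by rewrite cscalerAl. Qed.

Lemma cscaler (a : R[i]) x y : x ** (a *: y) = a *: (x ** y).
Proof. by rewrite cscalerAr. Qed.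

Lemma star0 : star (0 : A) = 0.
Proof. by apply: (addrI (star 0)); rewrite -starD !addr0. Qed.

Lemma starN x : star (- x) = - star x.
Proof. by apply: (addrI (star x)); rewrite -starD !subrr star0. Qed.

Lemma starB x y : star (x - y) = star x - star y.
Proof. by rewrite starD starN. Qed.

Lemma starZr (r : R) x : star (r%:C *: x) = r%:C *: star x.
Proof. by rewrite starZ conjc_real. Qed.

Lemma nrmM x y : nrm (x ** y) <= nrm x * nrm y.
Proof. by rewrite -lecR rmorphM /= -!nrmE cnormM. Qed.

Lemma nrm_star_mul x : nrm (star x ** x) = nrm x ^+ 2.
Proof. by apply/complexI; rewrite rmorphXn /= -!nrmE cnorm_star. Qed.

Lemma nrm_star x : nrm (star x) = nrm x.
Proof.
suff h y : nrm y <= nrm (star y).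
  by apply/eqP; rewrite eq_le h -{2}(starK x) h.
have [/nrm0_eq0 ->|y0] := eqVneq (nrm y) 0; first by rewrite star0.
have yp : 0 < nrm y by rewrite lt_neqAle eq_sym y0 nrm_ge0.
by have := nrmM (star y) y; rewrite nrm_star_mul expr2 ler_pM2r.
Qed.

Lemma nrm_mul_star x : nrm (x ** star x) = nrm x ^+ 2.
Proof. by rewrite -{1}(starK x) nrm_star_mul nrm_star. Qed.

Lemma nrm_sa x : star x = x -> nrm (x ** x) = nrm x ^+ 2.
Proof. by move=> sx; rewrite -nrm_star_mul sx. Qed.

Lemma star_mul_eq0 x : star x ** x = 0 -> x = 0.
Proof.
move=> h; apply: nrm0_eq0; apply/eqP.
by rewrite -sqrf_eq0 -nrm_star_mul h nrm0.
Qed.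

Lemma sa_sqr_eq0 x : star x = x -> x ** x = 0 -> x = 0.
Proof. by move=> sx h; apply: star_mul_eq0; rewrite sx. Qed.

Lemma mul_star_sa x : star (star x ** x) = star x ** x.
Proof. by rewrite starM starK. Qed.

(** Testing on star (x - y) suffices, by the C*-identity. Identities between left multiplication
    operators thus become identities between elements. *)
Lemma cmul_inj x y : (forall z, x ** z = y ** z) -> x = y.
Proof.
move=> h; apply/eqP; rewrite -subr_eq0; apply/eqP.
rewrite -[LHS]starK; set w := star (x - y).
suff -> : w = 0 by rewrite star0.
by apply: star_mul_eq0; rewrite /w starK cmulBl h subrr.
Qed.

End Arithmetic.

(** * Functional calculus of a self-adjoint element *)

Section PolyAction.
Context {K : comNzRingType} {V : lmodType K}.
Variable u : V -> V.
Hypothesis ulin : linear u.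
Implicit Types p q : {poly K}.

(** p(u) x for an operator u: constants act as scalars, so the algebra needs no unit. It serves both
    left multiplication by h and the isometry U. *)
Definition pact p x := \sum_(k < size p) p`_k *: iter k u x.

Lemma lin0 : u 0 = 0.
Proof.
by have := ulin (-1) 0 0; rewrite scaler0 addr0 scaleN1r addNr.
Qed.

Lemma linD x y : u (x + y) = u x + u y.
Proof. by have := ulin 1 x y; rewrite !scale1r. Qed.

Lemma linZ a x : u (a *: x) = a *: u x.
Proof. by have := ulin a x 0; rewrite lin0 !addr0. Qed.

Lemma linN x : u (- x) = - u x.
Proof. by rewrite -scaleN1r linZ scaleN1r. Qed.

Lemma linB x y : u (x - y) = u x - u y.
Proof. by rewrite linD linN. Qed.

Lemma lin_sum (I : Type) (s : seq I) (P : pred I) (F : I -> V) :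
  u (\sum_(i <- s | P i) F i) = \sum_(i <- s | P i) u (F i).
Proof.
by elim/big_rec2: _ => [|i y1 y2 _ <-]; [exact: lin0|exact: linD].
Qed.

Lemma pact_widen n p x : (size p <= n)%N ->
  pact p x = \sum_(k < n) p`_k *: iter k u x.
Proof.
move=> pn; rewrite /pact (big_ord_widen n (fun k => p`_k *: iter k u x) pn).
rewrite big_mkcond /=; apply: eq_bigr => k _; case: ltnP => // h.
by rewrite nth_default // scale0r.
Qed.

Lemma pact0 x : pact 0 x = 0.
Proof. by rewrite /pact size_poly0 big_ord0. Qed.

Lemma pactD p q x : pact (p + q) x = pact p x + pact q x.
Proof.
rewrite (pact_widen _ (size_polyD p q)) (pact_widen _ (leq_maxl _ (size q))).
rewrite (pact_widen _ (leq_maxr (size p) _)) -big_split /=.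
by apply: eq_bigr => k _; rewrite coefD scalerDl.
Qed.

Lemma pactC c x : pact c%:P x = c *: x.
Proof.
by rewrite (pact_widen _ (size_polyC_leq1 c)) big_ord1 coefC.
Qed.

Lemma pact1 x : pact 1 x = x.
Proof. by rewrite -polyC1 pactC scale1r. Qed.

Lemma pactMX p x : pact (p * 'X) x = u (pact p x).
Proof.
rewrite (@pact_widen (size p).+1) ?(leq_trans (size_polyMleq _ _)) ?size_polyX ?addn2 //.
rewrite big_ord_recl coefMX scale0r add0r /pact lin_sum.
by apply: eq_bigr => k _; rewrite coefMX linZ.
Qed.

Lemma pactMXaddC p c x : pact (p * 'X + c%:P) x = u (pact p x) + c *: x.
Proof. by rewrite pactD pactMX pactC. Qed.

Lemma pactZ c p x : pact (c *: p) x = c *: pact p x.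
Proof.
elim/poly_ind: p => [|p a ih]; first by rewrite scaler0 pact0 scaler0.
have -> : c *: (p * 'X + a%:P) = (c *: p) * 'X + (c * a)%:P.
  by rewrite scalerDr scalerAl polyCM mul_polyC.
by rewrite !pactMXaddC ih linZ scalerDr scalerA.
Qed.

Lemma pactN p x : pact (- p) x = - pact p x.
Proof. by rewrite -[- p]scaleN1r pactZ scaleN1r. Qed.

Lemma pactB p q x : pact (p - q) x = pact p x - pact q x.
Proof. by rewrite pactD pactN. Qed.

Lemma pactM p q x : pact (p * q) x = pact p (pact q x).
Proof.
elim/poly_ind: p => [|p c ih]; first by rewrite mul0r !pact0.
by rewrite mulrDl mulrAC mul_polyC pactD pactMX pactZ ih pactMXaddC.
Qed.

Lemma pact_lin p : linear (pact p).
Proof.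
move=> a x y; elim/poly_ind: p => [|p c ih]; first by rewrite !pact0 scaler0 addr0.
rewrite !pactMXaddC ih ulin scalerDr scalerDr !scalerA (mulrC c).
by rewrite addrACA.
Qed.

Lemma pactX x : pact 'X x = u x.
Proof. by rewrite -[X in pact X _]mul1r pactMX pactC scale1r. Qed.

Lemma pactXn n x : pact 'X^n x = iter n u x.
Proof.
elim: n => [|n ih]; first by rewrite expr0 pactC scale1r.
by rewrite exprSr pactMX ih.
Qed.

Lemma pact_sum (I : Type) (s : seq I) (P : pred I) (F : I -> {poly K}) x :
  pact (\sum_(i <- s | P i) F i) x = \sum_(i <- s | P i) pact (F i) x.
Proof.
by elim/big_rec2: _ => [|i y1 y2 _ <-]; [exact: pact0|exact: pactD].
Qed.

End PolyAction.

Section UnitarySqrt.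
Context {R : realType} {A : cstarAlgType R}.
Variable h : A.
Hypotheses (hsa : star h = h) (h1 : nrm h <= 1).

(** d - d^2 / 2 increases on [0, 1], and at d = 2 / m its value times m + 1 is 2 - 2 / m^2. This
    gives the 1 / n decay of both square root iterations below. *)
Lemma visser_rate (n : nat) (d : R) : 0 <= d <= 2 / n.+2%:R ->
  0 <= d - d ^+ 2 / 2 <= 2 / n.+3%:R.
Proof.
move=> /andP[d0 dn].
have n2 : (0 : R) < n.+2%:R by rewrite ltr0n.
have n3 : (0 : R) < n.+3%:R by rewrite ltr0n.
have e3 : n.+3%:R = n.+2%:R + 1 :> R by rewrite -natr1.
have n22 : (2 : R) <= n.+2%:R by rewrite ler_nat.
have t1 : 2 / n.+2%:R <= (1 : R) by rewrite ler_pdivrMr // mul1r.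
have d1 : d <= 1 := le_trans dn t1.
apply/andP; split.
  have : 0 <= d * (2 - d) by rewrite mulr_ge0 //; lra.
  rewrite mulrBr -expr2; lra.
rewrite e3; move: n.+2%:R n2 n22 dn t1 => m n2 n22 dn t1.
have mono : d - d ^+ 2 / 2 <= 2 / m - (2 / m) ^+ 2 / 2.
  move: (2 / m) dn t1 => c dn t1.
  have : 0 <= (c - d) * (2 - c - d) by rewrite mulr_ge0 //; lra.
  rewrite !expr2; lra.
apply: le_trans mono _.
rewrite ler_pdivlMr; last lra.
have -> : (2 / m - (2 / m) ^+ 2 / 2) * (m + 1) = 2 - 2 / m ^+ 2.
  by field; lra.
have : 0 < m ^+ 2 by nra.
by rewrite -invr_gt0; lra.
Qed.

(* Visser's iteration for [1 - sqrt (1 - h^2)]. *)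
Lemma one_minus_sqrt : exists y : A,
  [/\ star y = y, h ** y = y ** h & h ** h + y ** y = y + y].
Proof.
pose s := fix s n := if n is n.+1 then (2^-1 : R)%:C *: (h ** h + s n ** s n) else 0.
(* 1 - [d n] is the same iteration run on the scalar 1 in place of h, since (1 + (1 - d)^2) / 2 = 1
   - (d - d^2 / 2). It majorizes |s n|, and its increments majorize those of s. *)
pose d := fix d n := if n is n.+1 then d n - d n ^+ 2 / 2 else 1 : R.
have dP n : 0 <= d n <= 2 / n.+2%:R.
  elim: n => [|n ih]; first by rewrite /= ler01 divff ?lexx ?pnatr_eq0.
  exact: visser_rate ih.
have d0 n : 0 <= d n by case/andP: (dP n).
have sn n : nrm (s n) <= 1 - d n.
  elim: n => [|n ih]; first by rewrite /= nrm0 subrr.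
  rewrite /= nrmZr ger0_norm ?invr_ge0 //.
  have := ler_nrmD (h ** h) (s n ** s n).
  have := nrmM h h; have := nrmM (s n) (s n).
  have := ler_pM (nrm_ge0 (s n)) (nrm_ge0 (s n)) ih ih.
  have := ler_pM (nrm_ge0 h) (nrm_ge0 h) h1 h1.
  rewrite expr2; lra.
have ds n : nrm (s n.+1 - s n) <= d n - d n.+1.
  elim: n => [|n ih].
    rewrite /= subr0 nrmZr cmul0l addr0 ger0_norm ?invr_ge0 //.
    have := nrmM h h; have := ler_pM (nrm_ge0 h) (nrm_ge0 h) h1 h1.
    rewrite expr2; lra.
  have -> : s n.+2 - s n.+1 =
      (2^-1 : R)%:C *: (s n.+1 ** (s n.+1 - s n) + (s n.+1 - s n) ** s n).
    rewrite {1}/s -/s [X in _ - X]/s -/s -scalerBr; congr (_ *: _).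
    rewrite cmulBr cmulBl (subrKA (s n.+1 ** s n)).
    by rewrite opprD addrACA subrr add0r.
  rewrite nrmZr ger0_norm ?invr_ge0 //.
  set D := s n.+1 - s n in ih *.
  have t1 := ler_nrmD (s n.+1 ** D) (D ** s n).
  have t2 := nrmM (s n.+1) D; have t3 := nrmM D (s n).
  have t4 := nrm_ge0 D; have t5 := sn n; have t6 := sn n.+1.
  have t7 : d n.+1 = d n - d n ^+ 2 / 2 by [].
  have t8 : d n.+2 = d n.+1 - d n.+1 ^+ 2 / 2 by [].
  have t9 := d0 n; have t10 := d0 n.+1.
  have t11 : nrm (s n.+1) * nrm D <= (1 - d n.+1) * nrm D by rewrite ler_wpM2r.
  have t12 : nrm D * nrm (s n) <= nrm D * (1 - d n) by rewrite ler_wpM2l.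
  have t13 : 0 <= 2 - d n - d n.+1.
    by have := nrm_ge0 (s n); have := nrm_ge0 (s n.+1); lra.
  have t14 : nrm D * (2 - d n - d n.+1) <= (d n - d n.+1) * (2 - d n - d n.+1).
    by rewrite ler_wpM2r.
  rewrite t8; nra.
have dlim e : 0 < e -> exists n, d n <= e.
  move=> e0; have [n hn] : exists n : nat, 2 / e <= n%:R.
    by exists (Num.bound (2 / e)); apply/ltW/archi_boundP; rewrite divr_ge0 // ltW.
  exists n; case/andP: (dP n) => _ /le_trans; apply.
  rewrite ler_pdivrMr ?ltr0n //.
  move: hn; rewrite ler_pdivrMr // mulrC => /le_trans; apply.
  by rewrite ler_wpM2l ?(ltW e0) // ler_nat; lia.
have [y hy] := lim_telescope ds d0 dlim.
have sstar n : star (s n) = s n.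
  elim: n => [|n ih]; first by rewrite /= star0.
  by rewrite /= starZr starD !starM ih hsa.
have scom n : h ** s n = s n ** h.
  elim: n => [|n ih]; first by rewrite /= cmul0l cmul0r.
  by rewrite /= cscaler cscalel cmulDr cmulDl -!cmulA -ih !cmulA ih.
have srec n : h ** h + s n ** s n = s n.+1 + s n.+1.
  rewrite /= -scalerDl -rmorphD /=.
  by rewrite (_ : 2^-1 + 2^-1 = 1 :> R) ?scale1r //; lra.
have ny : nrm y <= 2.
  have := ler_nrm_add y (s 0%N); have := hy 0%N; rewrite /= nrm0 subr0; lra.
exists y; split.
- apply/eqP; rewrite -subr_eq0; apply/eqP; apply: nrm_eq0_eps => e e0.
  have [n hn] := dlim (e / 2) (divr_gt0 e0 (ltr0Sn _ 1)).
  rewrite -(subrKA (s n)); apply: le_trans (ler_nrmD _ _) _.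
  rewrite -{1}(sstar n) -starB nrm_star (nrmC (s n)); have := hy n; lra.
- apply/eqP; rewrite -subr_eq0; apply/eqP; apply: nrm_eq0_eps => e e0.
  have [n hn] := dlim (e / 2) (divr_gt0 e0 (ltr0Sn _ 1)).
  have -> : h ** y - y ** h = h ** (y - s n) - (y - s n) ** h.
    by rewrite cmulBr cmulBl scom opprB addrA subrK.
  apply: le_trans (ler_nrmB _ _) _.
  have := nrmM h (y - s n); have := nrmM (y - s n) h; have := hy n.
  have : nrm h * nrm (y - s n) <= 1 * nrm (y - s n) by rewrite ler_wpM2r // nrm_ge0.
  lra.
- apply/eqP; rewrite -subr_eq0; apply/eqP; apply: nrm_eq0_eps => e e0.
  have [n hn] := dlim (e / 8) (divr_gt0 e0 (ltr0Sn _ 7)).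
  have -> : h ** h + y ** y - (y + y) =
     (y ** (y - s n) + (y - s n) ** s n) - ((y - s n.+1) + (y - s n.+1)).
    rewrite cmulBr cmulBl (subrKA (y ** s n)).
    have /(canRL (addrK _)) -> := srec n.
    zmod.
  have t1 := hy n; have t2 := hy n.+1.
  have t3 : d n.+1 <= d n by rewrite /=; have := d0 n; nra.
  apply: le_trans (ler_nrmB _ _) _.
  have t4 := ler_nrmD (y ** (y - s n)) ((y - s n) ** s n).
  have t5 := ler_nrmD (y - s n.+1) (y - s n.+1).
  have t6 := nrmM y (y - s n); have t7 := nrmM (y - s n) (s n).
  have t8 : nrm y * nrm (y - s n) <= 2 * nrm (y - s n).
    by rewrite ler_wpM2r // nrm_ge0.
  have t9 : nrm (y - s n) * nrm (s n) <= nrm (y - s n) * 1.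
    by rewrite ler_wpM2l ?nrm_ge0 //; have := sn n; have := d0 n; lra.
  lra.
Qed.

(** With y = 1 - sqrt (1 - h^2), the map g is multiplication by the square root, and h^2 + g^2 = 1
    is a rewriting of h^2 + y^2 = 2 y. V is the adjoint of U, so V U = 1 makes U isometric by the
    C*-identity. *)
Lemma half_sum_isometries : exists U V : A -> A,
  [/\ linear U, linear V,
      forall x, U (V x) = x /\ V (U x) = x,
      forall x, nrm (U x) = nrm x
    & forall x, U x + V x = h ** x + h ** x].
Proof.
have [y [ysa hy h2]] := one_minus_sqrt.
pose g x := x - y ** x.
pose U x := h ** x + 'i%C *: g x.
pose V x := h ** x - 'i%C *: g x.
have glin : linear g.
  move=> a x z; rewrite /g cmulDr cscaler scalerBr opprD addrACA //.
have hlin : linear (cmul h) by move=> a x z; rewrite cmulDr cscaler.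
have Ulin : linear U.
  move=> a x z; rewrite /U hlin glin !scalerDr !scalerA (mulrC a) addrACA //.
have Vlin : linear V.
  move=> a x z; rewrite /V hlin glin !(scalerDr, scalerN) !scalerA (mulrC a).
  by rewrite opprD addrACA.
have gh x : g (h ** x) = h ** g x by rewrite /g cmulBr !cmulA hy.
have gg x : h ** (h ** x) + g (g x) = x.
  rewrite /g !cmulBr !cmulA; have /(canRL (addrK _)) -> := h2.
  by rewrite cmulBl cmulDl; zmod.
have ii (z : A) : 'i%C *: ('i%C *: z) = - z.
  by rewrite scalerA -expr2 sqr_i scaleN1r.
have UV x : U (V x) = x.
  rewrite /U /V (linB hlin) (linZ hlin) (linB glin) (linZ glin) gh.
  by rewrite scalerBr ii -[RHS](gg x); zmod.
have VU x : V (U x) = x.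
  rewrite /U /V (linD hlin) (linZ hlin) (linD glin) (linZ glin) gh.
  by rewrite scalerDr ii -[RHS](gg x); zmod.
have adj x z : star (U x) ** z = star x ** V z.
  rewrite /U /V /g starD starM starZ starB starM hsa ysa cmulDl cmulBr.
  rewrite -cmulA; congr (_ + _).
  rewrite cscalel cscaler cmulBl cmulBr !cmulA -scaleNr; congr (_ *: _).
  by apply/eqP; rewrite eq_complex /= oppr0 !eqxx.
exists U, V; split=> //.
- move=> x; apply/eqP; rewrite -(@eqrXn2 _ 2) ?nrm_ge0 //.
  by rewrite -!nrm_star_mul adj VU.
- by move=> x; rewrite /U /V addrACA subrr addr0.
Qed.

End UnitarySqrt.

Section FourierBound.
Context {R : realType}.

Lemma primitive_root_exists (n : nat) : (0 < n)%N ->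
  exists z : R[i], n.-primitive_root z.
Proof.
move=> n0; pose p : {poly R[i]} := 'X^n - 1.
have [r pr] := closed_field_poly_normal p.
have lp : lead_coef p = 1.
  by rewrite /p -polyC1 lead_coefXnsubC.
rewrite lp scale1r in pr.
have rootr z : (z \in r) = root p z by rewrite pr root_prod_XsubC.
have ur : uniq r.
  rewrite -separable_prod_XsubC -pr separable_Xn_sub_1 // pnatr_eq0 -lt0n //.
have sr : (n <= size r)%N.
  by rewrite -ltnS -(size_prod_XsubC _ id) -pr /p -polyC1 size_XnsubC.
have hr : all n.-unity_root r.
  by apply/allP => z; rewrite rootr /root /p !hornerE ?hornerXn subr_eq0 unity_rootE.
have /hasP[z _ hz] := has_prim_root n0 hr ur sr.
by exists z.
Qed.

Lemma unity_root_norm1 (n : nat) (z : R[i]) : (0 < n)%N -> z ^+ n = 1 ->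
  `|z| = 1.
Proof.
move=> n0 zn; apply/eqP; rewrite -(pexpr_eq1 n0) ?normr_ge0 //.
by rewrite -normrX zn normr1.
Qed.

(** Discrete Fourier inversion: averaging Q(z) z^(-k) over the n-th roots of unity isolates the k-th
    coefficient. The exponent n - k stands for - k. *)
Lemma coef_bound_unit_circle (n : nat) (Q : {poly R[i]}) (m : R) (k : nat) :
  (size Q <= n)%N -> (k < n)%N ->
  (forall z : R[i], `|z| = 1 -> `|Q.[z]| <= m%:C) -> `|Q`_k| <= m%:C.
Proof.
move=> Qn kn hQ; have n0 : (0 < n)%N := leq_ltn_trans (leq0n k) kn.
have [w wp] := primitive_root_exists n0.
have w1 : `|w| = 1 := unity_root_norm1 n0 (prim_expr_order wp).
have key : n%:R * Q`_k = \sum_(l < n) (w ^+ l) ^+ (n - k) * Q.[w ^+ l].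
  under eq_bigr do rewrite (horner_coef_wide _ Qn) mulr_sumr.
  rewrite exchange_big /= (bigD1 (Ordinal kn)) //= [X in _ + X]big1.
    rewrite addr0; under eq_bigr => l _.
      rewrite mulrCA -exprD subnK ?(ltnW kn) // -exprM mulnC exprM.
      rewrite (prim_expr_order wp) expr1n mulr1.
    over.
    by rewrite sumr_const card_ord mulr_natl.
  move=> i ik; under eq_bigr do rewrite mulrCA -exprD -exprM mulnC exprM.
  rewrite -mulr_sumr; set v := w ^+ _.
  have v1 : v != 1.
    rewrite /v -(prim_order_dvd wp); apply: contraNN ik => dv.
    rewrite -val_eqE /=; apply/eqP.
    have : (n - k + i == 0 %[mod n])%N by rewrite mod0n.
    rewrite -(eqn_modDr k) add0n addnAC subnK ?(ltnW kn) // modnDl.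
    by rewrite !modn_small // => /eqP.
  suff -> : \sum_(l < n) v ^+ l = 0 by rewrite mulr0.
  have : (v - 1) * (\sum_(l < n) v ^+ l) = 0.
    by rewrite -subrX1 /v exprAC (prim_expr_order wp) expr1n subrr.
  by move/eqP; rewrite mulf_eq0 subr_eq0 (negPf v1) => /eqP.
have : `|n%:R * Q`_k| <= n%:R * m%:C.
  rewrite key; apply: le_trans (ler_norm_sum _ _ _) _.
  rewrite mulr_natl -[n in _ *+ n]card_ord -sumr_const; apply: ler_sum => l _.
  rewrite normrM !normrX w1 !expr1n mul1r; apply: hQ.
  by rewrite normrX w1 expr1n.
by rewrite normrM normr_nat ler_pM2l // ltr0n.
Qed.

End FourierBound.

Section SupBound.
Context {R : realType} {A : cstarAlgType R}.
Implicit Types (p q : {poly R}) (x y : A).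
Variable h : A.
Hypotheses (hsa : star h = h) (h1 : nrm h <= 1).

(** Real coefficients make p(h) self-adjoint, which [hact_adj] expresses without forming an element
    p(h). *)
Definition hact (q : {poly R}) (x : A) : A :=
  pact (cmul h) (map_poly (real_complex R) q) x.

Lemma cmul_linear (a : A) : linear (cmul a).
Proof. by move=> c x y; rewrite cmulDr cscaler. Qed.

Let hlin := cmul_linear h.

Lemma hact_widen n q x : (size q <= n)%N ->
  hact q x = \sum_(j < n) (q`_j)%:C *: iter j (cmul h) x.
Proof.
move=> qn; rewrite /hact (@pact_widen _ _ _ n) ?(leq_trans (size_poly _ _)) //.
by apply: eq_bigr => j _; rewrite coef_map.
Qed.

Lemma hactM p q x : hact (p * q) x = hact p (hact q x).
Proof. by rewrite /hact rmorphM pactM. Qed.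

Lemma hactD p q x : hact (p + q) x = hact p x + hact q x.
Proof. by rewrite /hact rmorphD pactD. Qed.

Lemma hactB p q x : hact (p - q) x = hact p x - hact q x.
Proof. by rewrite /hact rmorphB /= pactB. Qed.

Lemma hactC c x : hact c%:P x = c%:C *: x.
Proof. by rewrite /hact map_polyC pactC. Qed.

Lemma hactX x : hact 'X x = h ** x.
Proof. by rewrite /hact map_polyX pactX. Qed.

Lemma hact_lin p : linear (hact p).
Proof. exact: pact_lin. Qed.

Lemma hact0 x : hact 0 x = 0.
Proof. by rewrite /hact rmorph0 pact0. Qed.

Lemma hactMXaddC p c x : hact (p * 'X + c%:P) x = h ** hact p x + c%:C *: x.
Proof. by rewrite hactD mulrC hactM hactX hactC. Qed.

Lemma hact_comm p x : hact p (h ** x) = h ** hact p x.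
Proof. by rewrite -!hactX -!hactM mulrC. Qed.

Lemma hact_mulr p x y : hact p (x ** y) = hact p x ** y.
Proof.
elim/poly_ind: p => [|p c ih]; first by rewrite !hact0 cmul0l.
by rewrite !hactMXaddC ih cmulDl cscalel cmulA.
Qed.

Lemma hact_adj p x y : star (hact p x) ** y = star x ** hact p y.
Proof.
elim/poly_ind: p x y => [|p c ih] x y; first by rewrite !hact0 star0 cmul0l cmul0r.
rewrite !hactMXaddC starD starM starZr hsa cmulDl cmulDr -cmulA ih hact_comm.
by rewrite cscalel cscaler.
Qed.

(** Multiplying q(h) by the isometry U^D clears V from h = (U + V) / 2 and leaves a polynomial in U
    of degree at most 2 D. Each of its 2 D + 1 coefficients is at most m, and the powers of U are
    isometric. *)
Lemma hact_bound_crude (D : nat) (q : {poly R}) (m : R) x :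
  (size q <= D.+1)%N -> (forall t, `|t| <= 1 -> `|q.[t]| <= m) ->
  nrm (hact q x) <= (D.*2.+1)%:R * m * nrm x.
Proof.
move=> sq hq.
have [U [V [Ul Vl UV Un UVh]]] := half_sum_isometries hsa h1.
pose w z := h ** z + h ** z.
have UUw z : U (U z) + z = U (w z) by rewrite /w -UVh (linD Ul) (UV z).1.
have wU z : w (U z) = U (w z) by rewrite -UUw /w -UVh (UV z).2.
have Uit n z : nrm (iter n U z) = nrm z by elim: n => //= n <-; rewrite Un.
have Uitl n : linear (iter n U).
  by elim: n => [//|n ih] a u v /=; rewrite ih Ul.
have wit n z : iter n w z = ((2 : R) ^+ n)%:C *: iter n (cmul h) z.
  elim: n => [|n ih] /=; first by rewrite scale1r.
  rewrite ih /w (linZ hlin) -scalerDl -rmorphD /=; congr (_%:C *: _).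
  by rewrite exprS; ring.
have wUit n z : iter n U (w z) = w (iter n U z).
  by elim: n => //= n ->; rewrite wU.
have X2 n z : pact U (('X^2 + 1) ^+ n) z = iter n U (iter n w z).
  elim: n => [|n ih]; first by rewrite expr0 pact1.
  by rewrite exprS (pactM Ul) ih pactD pact1 (pactXn Ul) /= UUw wUit.
(* U^2 + 1 acts as 2 h U, so U^D h^j = 2^(-j) U^(D - j) (U^2 + 1)^j. On the circle z^2 + 1 = 2 z Re
   z, whence Q(z) = z^D q(Re z). *)
pose T j : {poly R[i]} := 'X^(D - j) * ('X^2 + 1) ^+ j.
pose Q : {poly R[i]} := \sum_(j < D.+1) (q`_j / 2 ^+ j)%:C *: T j.
have sT j : (j <= D)%N -> (size (T j) <= D.*2.+1)%N.
  move=> jD; apply: leq_trans (size_polyMleq _ _) _.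
  have := size_poly_exp_leq ('X^2 + 1 : {poly R[i]}) j.
  rewrite -polyC1 size_XnaddC // size_polyXn.
  by move=> ?; lia.
have sQ : (size Q <= D.*2.+1)%N.
  apply: leq_trans (size_sum _ _ _) _; apply/bigmax_leqP => j _.
  by apply: leq_trans (size_scale_leq _ _) _; apply: sT; rewrite -ltnS.
have QU : pact U Q x = iter D U (hact q x).
  rewrite (hact_widen _ sq) (lin_sum (Uitl _)) pact_sum; apply: eq_bigr => j _.
  rewrite (pactZ Ul) (pactM Ul) (pactXn Ul) X2 wit -iterD subnK; last by rewrite -ltnS.
  have n0 : (2 : R) ^+ j != 0 by rewrite expf_eq0 pnatr_eq0 andbF.
  by rewrite !(linZ (Uitl _)) scalerA -rmorphM /= (divfK n0).
have Q1 z : `|z| = 1 -> `|Q.[z]| <= m%:C.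
  move=> z1.
  have z21 : z ^+ 2 + 1 = z * (2 * (complex.Re z)%:C).
    by rewrite -addcJ mulrDr -expr2 -sqr_normc z1 expr1n.
  have -> : Q.[z] = z ^+ D * (q.[complex.Re z])%:C.
    rewrite /Q horner_sum (horner_coef_wide _ sq) rmorph_sum mulr_sumr.
    apply: eq_bigr => j _; rewrite hornerZ /T hornerM hornerXn horner_exp.
    rewrite !hornerE z21 !exprMn.
    have -> : z ^+ D = z ^+ (D - j) * z ^+ j by rewrite -exprD subnK // -ltnS.
    rewrite !rmorphM /= fmorphV !rmorphXn /= rmorph_nat.
    have : (2 : R[i]) ^+ j != 0 by rewrite expf_eq0 pnatr_eq0 andbF.
    by move=> ?; field.
  rewrite normrM normrX z1 expr1n mul1r normc_def /= expr0n addr0 sqrtr_sqr lecR.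
  by apply: hq; have := normc_ge_Re z; rewrite z1 -[1]/(1%:C) lecR.
rewrite -(Uit D) -QU (@pact_widen _ _ _ _ _ _ sQ).
apply: le_trans (ler_nrm_sum _ _ _) _.
rewrite -mulrA mulr_natl -[X in _ *+ X]card_ord -sumr_const.
apply: ler_sum => k _; rewrite nrmZ Uit ler_wpM2r ?nrm_ge0 //.
rewrite -lecR RRe_real ?ger0_real //.
exact: (coef_bound_unit_circle sQ).
Qed.

Lemma hact_sqr q x : nrm (hact q x) ^+ 2 <= nrm x * nrm (hact (q ^+ 2) x).
Proof.
rewrite -nrm_star_mul hact_adj -hactM -expr2 -(nrm_star x); exact: nrmM.
Qed.

(** Iterates [hact_sqr], a Cauchy-Schwarz inequality for x* q(h)^2 x. *)
Lemma hact_pow2 q x n :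
  nrm (hact q x) ^+ (2 ^ n) * nrm x <= nrm x ^+ (2 ^ n) * nrm (hact (q ^+ (2 ^ n)) x).
Proof.
elim: n => [|n ih]; first by rewrite expn0 !expr1 mulrC.
have [/nrm0_eq0 ->|xn] := eqVneq (nrm x) 0.
  by rewrite nrm0 mulr0 mulr_ge0 // ?nrm_ge0 // exprn_ge0.
have x0 : 0 < nrm x by rewrite lt_neqAle eq_sym xn nrm_ge0.
rewrite expnSr !exprM -(ler_pM2r x0).
have := hact_sqr (q ^+ (2 ^ n)) x; move: (nrm (hact (q ^+ (2 ^ n)) x)) ih => B ih.
move: (nrm (hact ((q ^+ (2 ^ n)) ^+ 2) x)) => C.
move: (nrm x) (nrm (hact q x)) (2 ^ n)%N (nrm_ge0 x) (nrm_ge0 (hact q x)) x0 ih.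
move=> u v N u0 v0 up ih hs; rewrite -mulrA -expr2 -exprMn.
have h2 : (v ^+ N * u) ^+ 2 <= (u ^+ N * B) ^+ 2.
  have p0 : 0 <= v ^+ N * u by rewrite mulr_ge0 ?exprn_ge0.
  by apply: lerXn2r; rewrite ?nnegrE // (le_trans p0).
apply: le_trans h2 _; rewrite exprMn.
have -> : (u ^+ N) ^+ 2 * C * u = (u ^+ N) ^+ 2 * (u * C) by ring.
by rewrite ler_wpM2l // !exprn_ge0.
Qed.

End SupBound.

(** If r = a / b > 1, Bernoulli gives r^(2 N) >= (N (r - 1))^2 for N = 2^n, and a quadratic in N
    eventually exceeds the linear bound 2 d N + 1. *)
Lemma pow2_dominates (R : realType) (a b : R) (d : nat) : 0 <= a -> 0 <= b ->
  (forall n, a ^+ (2 ^ n) <= (d * 2 ^ n).+1%:R * b ^+ (2 ^ n)) -> a <= b.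
Proof.
move=> a0 b0 h; have [//|ba] := leP a b.
have [b00|bn] := eqVneq b 0.
  have := h 0%N; rewrite expn0 !expr1 b00 mulr0; move: ba; rewrite b00 => ? ?.
  by exfalso; lra.
have bp : 0 < b by rewrite lt_neqAle eq_sym bn.
pose r := a / b; have r1 : 1 < r by rewrite ltr_pdivlMr // mul1r.
have hr n : r ^+ (2 ^ n) <= (d * 2 ^ n).+1%:R.
  by rewrite expr_div_n ler_pdivrMr ?exprn_gt0.
have bern n : 1 + n%:R * (r - 1) <= r ^+ n.
  elim: n => [|n ih]; first by rewrite mul0r addr0.
  rewrite exprS -natr1.
  have : r * (1 + n%:R * (r - 1)) <= r * r ^+ n by rewrite ler_wpM2l //; lra.
  have : 0 <= n%:R * (r - 1) ^+ 2 by rewrite mulr_ge0 // sqr_ge0.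
  rewrite expr2; nra.
have [n hn] : exists n : nat, (2 * d.+1)%:R / (r - 1) ^+ 2 < n%:R.
  exists (Num.bound ((2 * d.+1)%:R / (r - 1) ^+ 2)).
  by apply: archi_boundP; rewrite divr_ge0 // sqr_ge0.
have s0 : 0 < (r - 1) ^+ 2 by rewrite exprn_gt0 // subr_gt0.
move: hn; rewrite ltr_pdivrMr // => hn.
have n2 : (n%:R : R) <= (2 ^ n)%:R by rewrite ler_nat ltnW // ltn_expl.
set N := (2 ^ n)%N in n2.
have N0 : (1 : R) <= N%:R by rewrite ler1n expn_gt0.
have h2 := hr n.+1; rewrite expnSr exprM -/N mulnA mulnC in h2.
have h3 := bern N.
have h4 : (N%:R * (r - 1)) ^+ 2 <= (r ^+ N) ^+ 2.
  have : 0 <= N%:R * (r - 1) by rewrite mulr_ge0 // subr_ge0 ltW.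
  by move=> ?; rewrite lerXn2r ?nnegrE //; lra.
have h5 : (2 * (d * N)).+1%:R = 2 * d%:R * N%:R + 1 :> R.
  by rewrite -natr1 !natrM mulrA.
rewrite h5 in h2; rewrite natrM -natr1 in hn.
have h6 : n%:R * (r - 1) ^+ 2 <= N%:R * (r - 1) ^+ 2 by rewrite ler_wpM2r // ltW.
have h7 : 2 * (d%:R + 1) * N%:R < N%:R * (r - 1) ^+ 2 * N%:R.
  by rewrite ltr_pM2r; lra.
rewrite exprMn in h4; exfalso.
have : N%:R * (r - 1) ^+ 2 * N%:R = N%:R ^+ 2 * (r - 1) ^+ 2 by ring.
lra.
Qed.

Lemma hact_bound (R : realType) (A : cstarAlgType R) (h : A) (q : {poly R})
    (m : R) x : star h = h -> nrm h <= 1 ->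
  (forall t, `|t| <= 1 -> `|q.[t]| <= m) -> nrm (hact h q x) <= m * nrm x.
Proof.
move=> hsa h1 hq.
have m0 : 0 <= m.
  by apply: le_trans (hq 0 _); rewrite ?normr0 // normr_ge0.
apply: (@pow2_dominates _ _ _ (size q).*2); rewrite ?mulr_ge0 ?nrm_ge0 // => n.
have [/nrm0_eq0 ->|xn] := eqVneq (nrm x) 0.
  rewrite (lin0 (hact_lin _ _)) nrm0 mulr0 expr0n gtn_eqF ?expn_gt0 //.
  by rewrite mulr0.
have x0 : 0 < nrm x by rewrite lt_neqAle eq_sym xn nrm_ge0.
rewrite -(ler_pM2r x0); apply: le_trans (hact_pow2 hsa q x n) _.
set N := (2 ^ n)%N.
have sN : (size (q ^+ N) <= (size q * N).+1)%N.
  apply: leq_trans (size_poly_exp_leq _ _) _.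
  by rewrite ltnS leq_mul2r leq_pred orbT.
have hN t : `|t| <= 1 -> `|(q ^+ N).[t]| <= m ^+ N.
  by move=> /hq ht; rewrite horner_exp normrX lerXn2r ?nnegrE ?normr_ge0.
have := hact_bound_crude hsa h1 x sN hN.
rewrite -doubleMl => hb; have u0 : 0 <= nrm x ^+ N by rewrite exprn_ge0 ?nrm_ge0.
apply: le_trans (ler_wpM2l u0 hb) _; rewrite exprMn le_eqVlt; apply/orP; left.
by apply/eqP; ring.
Qed.

(** * Uniform limits of polynomials on [-1, 1] *)

Section PolynomialLimits.
Context {R : realType}.
Implicit Types f g : R -> R.

(** Plays the role of continuity on [-1, 1]. The functions of the calculus are built from constants
    and the identity by sums, products, absolute values and inverses, so closure under these
    operations replaces a general approximation theorem. *)
Definition poly_limit f : Prop := forall e : R, 0 < e ->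
  exists p : {poly R}, forall t, `|t| <= 1 -> `|f t - p.[t]| <= e.

Lemma inv_pow2_small (C e : R) : 0 < e -> exists n, C / 2 ^+ n <= e.
Proof.
move=> e0; pose n := Num.bound (`|C| / e); exists n.
rewrite ler_pdivrMr ?exprn_gt0 //.
have h : `|C| / e < n%:R by apply: archi_boundP; rewrite divr_ge0 // ltW.
have h2 : (n%:R : R) <= 2 ^+ n by rewrite -natrX ler_nat ltnW // ltn_expl.
move: h; rewrite ltr_pdivrMr // => h.
have := ler_norm C; have : e * n%:R <= e * 2 ^+ n by rewrite ler_wpM2l // ltW.
lra.
Qed.

Lemma poly_bounded (p : {poly R}) : exists2 B, 0 < B &
  forall t, `|t| <= 1 -> `|p.[t]| <= B.
Proof.
elim/poly_ind: p => [|p c [B B0 ih]].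
  by exists 1 => // t _; rewrite horner0 normr0.
exists (B + `|c| + 1) => [|t t1]; first by have := normr_ge0 c; lra.
rewrite hornerMXaddC; apply: le_trans (ler_normD _ _) _; rewrite normrM.
have := ler_pM (normr_ge0 _) (normr_ge0 _) (ih t t1) t1; lra.
Qed.

Lemma poly_limit_bounded f : poly_limit f -> exists2 B, 0 < B &
  forall t, `|t| <= 1 -> `|f t| <= B.
Proof.
move=> /(_ _ ltr01)[p hp]; have [B B0 hB] := poly_bounded p.
exists (B + 1) => [|t t1]; first lra.
rewrite -(subrK p.[t] (f t)); apply: le_trans (ler_normD _ _) _.
by rewrite addrC lerD ?hB ?hp.
Qed.

Lemma poly_limit_poly (p : {poly R}) : poly_limit (fun t => p.[t]).
Proof. by move=> e e0; exists p => t _; rewrite subrr normr0 ltW. Qed.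

Lemma poly_limit_ext f g : (forall t, `|t| <= 1 -> f t = g t) ->
  poly_limit f -> poly_limit g.
Proof. by move=> fg hf e /hf[p hp]; exists p => t t1; rewrite -fg ?hp. Qed.

Lemma poly_limit_cst (c : R) : poly_limit (fun=> c).
Proof.
by apply: (@poly_limit_ext (fun t => (c%:P).[t])) => [t _|];
  [rewrite hornerC|exact: poly_limit_poly].
Qed.

Lemma poly_limit_id : poly_limit id.
Proof.
by apply: (@poly_limit_ext (fun t => ('X).[t])) => [t _|];
  [rewrite hornerX|exact: poly_limit_poly].
Qed.

Lemma poly_limitD f g : poly_limit f -> poly_limit g ->
  poly_limit (fun t => f t + g t).
Proof.
move=> hf hg e e0; have e2 : 0 < e / 2 by lra.
have [p hp] := hf _ e2; have [q hq] := hg _ e2.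
exists (p + q) => t t1; rewrite hornerD opprD addrACA.
apply: le_trans (ler_normD _ _) _; have := hp t t1; have := hq t t1; lra.
Qed.

Lemma mul_approx (a a' b b' B C e : R) : `|a| <= B -> `|b| <= C ->
  `|a - a'| <= e -> `|b - b'| <= e -> 0 <= e <= 1 ->
  `|a * b - a' * b'| <= (B + C + 1) * e.
Proof.
move=> aB bC ae be /andP[e0 e1].
have -> : a * b - a' * b' = (a - a') * b + a * (b - b') - (a - a') * (b - b').
  by ring.
apply: le_trans (ler_normB _ _) _.
have := ler_normD ((a - a') * b) (a * (b - b')).
rewrite !normrM.
have := ler_pM (normr_ge0 _) (normr_ge0 _) ae bC.
have := ler_pM (normr_ge0 _) (normr_ge0 _) aB be.
have := ler_pM (normr_ge0 _) (normr_ge0 _) ae be.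
have : e * e <= e * 1 by rewrite ler_wpM2l.
lra.
Qed.

Lemma poly_limitM f g : poly_limit f -> poly_limit g ->
  poly_limit (fun t => f t * g t).
Proof.
move=> hf hg e e0.
have [B B0 hB] := poly_limit_bounded hf; have [C C0 hC] := poly_limit_bounded hg.
pose d := Num.min 1 (e / (B + C + 1)).
have D0 : 0 < B + C + 1 by lra.
have d0 : 0 < d by rewrite lt_min ltr01 divr_gt0.
have d1 : d <= 1 by rewrite ge_min lexx.
have de : (B + C + 1) * d <= e.
  by rewrite mulrC -ler_pdivlMr // ge_min lexx orbT.
have [p hp] := hf _ d0; have [q hq] := hg _ d0.
exists (p * q) => t t1; rewrite hornerM; apply: le_trans de.
by apply: mul_approx; [exact: hB|exact: hC|exact: hp|exact: hq|rewrite d1 ltW].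
Qed.

Lemma poly_limitN f : poly_limit f -> poly_limit (fun t => - f t).
Proof.
move=> hf; apply: (@poly_limit_ext (fun t => (-1) * f t)) => [t _|].
  by rewrite mulN1r.
exact: poly_limitM (poly_limit_cst _) hf.
Qed.

Lemma poly_limitB f g : poly_limit f -> poly_limit g ->
  poly_limit (fun t => f t - g t).
Proof. by move=> hf /poly_limitN; exact: poly_limitD. Qed.

Lemma poly_limitZ (c : R) f : poly_limit f -> poly_limit (fun t => c * f t).
Proof. by apply: poly_limitM; exact: poly_limit_cst. Qed.

(* [z <- z + (s^2 - z^2) / 2] decreases from 1 to |s|, uniformly on [-1, 1]. *)
Lemma abs_approx (e : R) : 0 < e -> exists p : {poly R},
  forall s, `|s| <= 1 -> `| `|s| - p.[s] | <= e.
Proof.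
move=> e0; pose z := fix z n : {poly R} := if n is n.+1 then
  z n + (2^-1) *: ('X^2 - z n ^+ 2) else 1.
have zP n s : `|s| <= 1 ->
    [/\ 0 <= (z n).[s] - `|s|, (z n).[s] - `|s| <= 2 / n.+2%:R & (z n).[s] <= 1].
  move=> s1; elim: n => [|n [ih1 ih2 ih3]].
    by rewrite /= hornerC divff ?pnatr_eq0 //; have := normr_ge0 s; split; lra.
  have -> : (z n.+1).[s] = (z n).[s] + 2^-1 * (s ^+ 2 - (z n).[s] ^+ 2).
    by rewrite /= !hornerE.
  have /visser_rate/andP[] : 0 <= (z n).[s] - `|s| <= 2 / n.+2%:R by rewrite ih1.
  move: (2 / n.+3%:R) => c.
  rewrite -[s ^+ 2]real_normK ?num_real //.
  move: (z n).[s] `|s| (normr_ge0 s) ih1 s1 ih3 => a b b0 ih1 s1 t2 h1 h2.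
  have h3 : 0 <= (a - b) * b by rewrite mulr_ge0 //; lra.
  have h4 : 0 <= (a - b) * (2 - a - b) by rewrite mulr_ge0 //; lra.
  have h5 : 0 <= (a - b) * (a + b) by rewrite mulr_ge0 //; lra.
  by split; rewrite !expr2 in h1 h2 *; lra.
have [n hn] := inv_pow2_small 2 e0.
exists (z (2 ^ n)%N) => s s1; have [h1 h2 _] := zP (2 ^ n)%N s s1.
rewrite distrC ger0_norm //; apply: le_trans h2 (le_trans _ hn).
by rewrite ler_pM2l // lef_pV2 ?posrE ?ltr0n ?exprn_gt0 // -natrX ler_nat; lia.
Qed.

Lemma poly_limit_abs f : poly_limit f -> poly_limit (fun t => `|f t|).
Proof.
move=> hf e e0; have [B B0 hB] := poly_limit_bounded hf.
have e2 : 0 < e / 2 by lra.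
pose d := Num.min 1 (e / 2).
have d0 : 0 < d by rewrite lt_min ltr01.
have d1 : d <= 1 by rewrite ge_min lexx.
have de : d <= e / 2 by rewrite ge_min lexx orbT.
have [p hp] := hf _ d0.
have C0 : 0 < B + 1 by lra.
have [q hq] := abs_approx (divr_gt0 e2 C0).
(* The absolute value is approximated on [-1, 1] only, hence the rescaling by B + 1, which bounds
   |p| because |f| <= B and [d] <= 1. *)
exists ((B + 1) *: (q \Po ((B + 1)^-1 *: p))) => t t1.
rewrite hornerZ horner_comp hornerZ; set s := _ * p.[t].
have ps : p.[t] = (B + 1) * s by rewrite /s mulrA divff ?mul1r // gt_eqF.
have h1 := hp t t1; have h2 := hB t t1.
have s1 : `|s| <= 1.
  rewrite /s normrM gtr0_norm ?invr_gt0 // mulrC ler_pdivrMr // mul1r.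
  have : `|p.[t]| <= `|f t| + `|f t - p.[t]|.
    by rewrite -[X in `|X| <= _](subKr (f t)) ler_normB.
  lra.
have h3 := hq s s1.
have h4 : `| `|f t| - `|p.[t]| | <= d by apply: le_trans (ler_dist_dist _ _) h1.
have h5 : `|(B + 1) * `|s| - (B + 1) * q.[s]| <= e / 2.
  by rewrite -mulrBr normrM gtr0_norm // mulrC -ler_pdivlMr.
have h6 : `|p.[t]| = (B + 1) * `|s| by rewrite ps normrM gtr0_norm.
rewrite -(subrKA `|p.[t]|); apply: le_trans (ler_normD _ _) _.
rewrite {2}h6; lra.
Qed.

Lemma poly_limit_max f g : poly_limit f -> poly_limit g ->
  poly_limit (fun t => Num.max (f t) (g t)).
Proof.
move=> hf hg.
apply: (@poly_limit_ext (fun t => 2^-1 * (f t + g t + `|f t - g t|))) => [t _|].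
  by rewrite maxr_absE mulrC.
apply/poly_limitZ/poly_limitD; first exact: poly_limitD.
exact/poly_limit_abs/poly_limitB.
Qed.

Lemma poly_limit_min f g : poly_limit f -> poly_limit g ->
  poly_limit (fun t => Num.min (f t) (g t)).
Proof.
move=> hf hg.
apply: (@poly_limit_ext (fun t => 2^-1 * (f t + g t - `|f t - g t|))) => [t _|].
  by rewrite minr_absE mulrC.
apply/poly_limitZ/poly_limitB; first exact: poly_limitD.
exact/poly_limit_abs/poly_limitB.
Qed.

Lemma geometric_small (x e : R) : 0 <= x < 1 -> 0 < e -> exists n, x ^+ n <= e.
Proof.
move=> /andP[x0 x1] e0; have [/eqP ->|xn] := boolP (x == 0).
  by exists 1%N; rewrite expr1 ltW.
have xp : 0 < x by rewrite lt_neqAle eq_sym xn.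
pose s := x^-1 - 1; have s0 : 0 < s by rewrite subr_gt0 invf_gt1.
have bern n : 1 + n%:R * s <= (x^-1) ^+ n.
  elim: n => [|n ih]; first by rewrite mul0r addr0.
  rewrite exprS -natr1.
  have i0 : 0 <= x^-1 by rewrite invr_ge0.
  have := ler_wpM2l i0 ih.
  have : 0 <= n%:R * s * s by rewrite !mulr_ge0 // ltW.
  have : x^-1 = s + 1 by rewrite /s subrK.
  by move=> ->; lra.
pose n := Num.bound (e^-1 / s); exists n.
have h : e^-1 / s < n%:R by apply: archi_boundP; rewrite divr_ge0 ?invr_ge0 ?ltW.
move: h; rewrite ltr_pdivrMr // => h; have := bern n; rewrite exprVn => hb.
rewrite -[x ^+ n]invrK -[e]invrK lef_pV2 ?posrE ?invr_gt0 ?exprn_gt0 //; lra.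
Qed.

(** Geometric series: u = 1 - f / B lies in [0, 1 - s / B], and 1 / f is B^(-1) times the sum of the
    powers of u. *)
Lemma poly_limit_inv (s B : R) f : 0 < s -> poly_limit f ->
  (forall t, `|t| <= 1 -> s <= f t <= B) -> poly_limit (fun t => (f t)^-1).
Proof.
move=> s0 hf hs.
have sB : s <= B.
  by have /andP[h1 h2] := hs 0 (ltac:(rewrite normr0; lra)); lra.
have B0 : 0 < B by lra.
pose u t := 1 - B^-1 * f t.
have hu : poly_limit u by apply: poly_limitB (poly_limit_cst _) (poly_limitZ _ hf).
pose S n t := B^-1 * \sum_(i < n) u t ^+ i.
have hS n : poly_limit (S n).
  apply: poly_limitZ; elim: n => [|n ih].
    by apply: poly_limit_ext (poly_limit_cst 0) => t _; rewrite big_ord0.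
  apply: (@poly_limit_ext (fun t => 1 + u t * \sum_(i < n) u t ^+ i)) => [t _|].
    rewrite big_ord_recl expr0 mulr_sumr; congr (_ + _).
    by apply: eq_bigr => i _; rewrite exprS.
  exact: poly_limitD (poly_limit_cst _) (poly_limitM hu ih).
have x01 : 0 <= 1 - s / B < 1.
  have h1 : s / B <= 1 by rewrite ler_pdivrMr // mul1r.
  have h2 : 0 < s / B by rewrite divr_gt0.
  by apply/andP; split; lra.
have key n t : `|t| <= 1 -> `|(f t)^-1 - S n t| <= (1 - s / B) ^+ n / s.
  move=> t1; have /andP[f1 f2] := hs t t1.
  have f0 : f t != 0 by rewrite gt_eqF //; lra.
  have Bn : B != 0 by rewrite gt_eqF.
  have un : (f t)^-1 - S n t = u t ^+ n / f t.
    have e1 : 1 - u t ^+ n = (1 - u t) * \sum_(i < n) u t ^+ i.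
      by rewrite -opprB subrX1 -mulNr opprB.
    have e2 : 1 - u t = B^-1 * f t by rewrite /u; ring.
    have -> : u t ^+ n = 1 - B^-1 * f t * \sum_(i < n) u t ^+ i.
      by rewrite -e2 -e1; ring.
    by rewrite /S; field; rewrite f0 Bn.
  rewrite un normrM normfV (gtr0_norm (_ : 0 < f t)); last lra.
  have u1 : 0 <= u t <= 1 - s / B.
    rewrite /u mulrC; apply/andP; split.
      by rewrite subr_ge0 ler_pdivrMr // mul1r.
    by rewrite lerB // ler_pM2r // invr_gt0.
  case/andP: u1 => u1 u2; rewrite normrX (ger0_norm u1).
  apply: ler_pM; rewrite ?exprn_ge0 ?invr_ge0 //; first lra.
    by rewrite lerXn2r ?nnegrE //; case/andP: x01.
  by rewrite lef_pV2 ?posrE //; lra.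
move=> e e0; have [n hn] := geometric_small x01 (mulr_gt0 (divr_gt0 e0 (ltr0Sn _ 1)) s0).
have [p hp] := hS n _ (divr_gt0 e0 (ltr0Sn _ 1)).
exists p => t t1; rewrite -(subrKA (S n t)); apply: le_trans (ler_normD _ _) _.
have := key n t t1; have := hp t t1; rewrite -ler_pdivrMr // in hn; lra.
Qed.

End PolynomialLimits.

Section FunctionalCalculus.
Context {R : realType} {A : cstarAlgType R}.
Implicit Types (f g : R -> R) (F G : A -> A) (x y : A).

(* The operator [x |-> f(h) x]; working with operators dispenses with a unit. *)
Definition calculus (h : A) f F : Prop := forall e : R, 0 < e ->
  exists2 p : {poly R}, forall t, `|t| <= 1 -> `|f t - p.[t]| <= e
    & forall x, nrm (F x - hact h p x) <= e * nrm x.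

Lemma nrm_eq0_lin (C : R) x : (forall e, 0 < e -> nrm x <= C * e) -> x = 0.
Proof.
move=> hx; apply: nrm_eq0_eps => e e0.
have C1 : 0 < `|C| + 1 by have := normr_ge0 C; lra.
apply: le_trans (hx _ (divr_gt0 e0 C1)) _.
rewrite mulrA ler_pdivrMr // mulrC ler_wpM2l ?(ltW e0) //.
by have := ler_norm C; lra.
Qed.

Variable h : A.
Hypotheses (hsa : star h = h) (h1 : nrm h <= 1).

Lemma calculus_exists f : poly_limit f -> exists F, calculus h f F.
Proof.
move=> hf.
have hpow n : 0 < (2 ^+ n)^-1 :> R by rewrite invr_gt0 exprn_gt0.
have /choice[p hp] : forall n, exists p : {poly R},
  forall t, `|t| <= 1 -> `|f t - p.[t]| <= (2 ^+ n)^-1 by move=> n; exact: hf.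
have /choice[F hF] x : exists l, forall n,
    nrm (l - hact h (p n) x) <= 3 * nrm x / 2 ^+ n.
  apply: lim_telescope => [n||e e0]; last exact: inv_pow2_small.
    (* 2^(-n) + 2^(-n-1) equals (3 / 2) 2^(-n), which is also the drop of 3 / 2^n from n to n + 1;
       this fixes the rate given to [lim_telescope]. *)
    have hq t : `|t| <= 1 -> `|(p n.+1 - p n).[t]| <= 3 / 2 * (2 ^+ n)^-1.
      move=> t1; rewrite hornerD hornerN -(subrKA (f t)).
      apply: le_trans (ler_normD _ _) _.
      have := hp n t t1; have := hp n.+1 t t1.
      by rewrite [`|f t - (p n.+1).[t]|]distrC exprS invfM; lra.
    have := hact_bound x hsa h1 hq; rewrite hactB exprS invfM; lra.
  by move=> n; rewrite divr_ge0 ?mulr_ge0 ?nrm_ge0 // exprn_ge0.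
exists F => e e0; have [n hn] := inv_pow2_small 3 e0.
exists (p n) => [t t1|x].
  apply: le_trans (hp n t t1) (le_trans _ hn).
  by rewrite -[X in X <= _]mul1r ler_pM2r // ler1n.
by apply: le_trans (hF x n) _; rewrite mulrAC ler_wpM2r ?nrm_ge0.
Qed.

Lemma calculus_ext f g F : (forall t, `|t| <= 1 -> f t = g t) ->
  calculus h f F -> calculus h g F.
Proof. by move=> fg hF e /hF[p hp hF']; exists p => // t t1; rewrite -fg ?hp. Qed.

Lemma calculus_poly (p : {poly R}) : calculus h (fun t => p.[t]) (hact h p).
Proof.
move=> e e0; exists p => [t _|x]; first by rewrite subrr normr0 ltW.
by rewrite subrr nrm0 mulr_ge0 ?nrm_ge0 // ltW.
Qed.

Lemma calculus_id : calculus h id (cmul h).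
Proof.
apply: (@calculus_ext (fun t => 'X.[t])) => [t _|]; first by rewrite hornerX.
by have := calculus_poly 'X; congr (calculus _ _ _); apply/funext => x; rewrite hactX.
Qed.

Lemma calculus_bound f F M x : calculus h f F ->
  (forall t, `|t| <= 1 -> `|f t| <= M) -> nrm (F x) <= M * nrm x.
Proof.
move=> hF fM; apply: le_epsilon => e e0.
have x0 := nrm_ge0 x; have D0 : 0 < 2 * nrm x + 1 by lra.
have [p hp hx] := hF _ (divr_gt0 e0 D0); set d := e / _ in hp hx.
have hq t : `|t| <= 1 -> `|p.[t]| <= M + d.
  move=> t1; have := hp t t1; have := fM t t1.
  have := ler_normB (f t) (f t - p.[t]); rewrite subKr; lra.
have := hact_bound x hsa h1 hq; have := hx x.
have := ler_nrm_add (F x) (hact h p x).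
have d0 : 0 <= d by rewrite divr_ge0 ?ltW.
have : d * (2 * nrm x + 1) = e by rewrite /d divfK // gt_eqF.
lra.
Qed.

Lemma calculus_mulr f F x y : calculus h f F -> F (x ** y) = F x ** y.
Proof.
move=> hF; apply/eqP; rewrite -subr_eq0; apply/eqP.
apply: (@nrm_eq0_lin (nrm (x ** y) + nrm x * nrm y)) => e e0.
have [p _ hp] := hF e e0.
have -> : F (x ** y) - F x ** y =
    (F (x ** y) - hact h p (x ** y)) - (F x - hact h p x) ** y.
  by rewrite cmulBl hact_mulr; zmod.
apply: le_trans (ler_nrmB _ _) _; rewrite mulrC mulrDr lerD ?hp //.
by apply: le_trans (nrmM _ _) _; rewrite mulrA ler_wpM2r ?nrm_ge0.
Qed.

Lemma calculus_adj f F x y : calculus h f F -> star (F x) ** y = star x ** F y.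
Proof.
move=> hF; apply/eqP; rewrite -subr_eq0; apply/eqP.
apply: (@nrm_eq0_lin (nrm x * nrm y + nrm x * nrm y)) => e e0.
have [p _ hp] := hF e e0.
have -> : star (F x) ** y - star x ** F y =
    star (F x - hact h p x) ** y - star x ** (F y - hact h p y).
  by rewrite starB cmulBl cmulBr hact_adj //; zmod.
apply: le_trans (ler_nrmB _ _) _.
apply: le_trans (lerD (nrmM _ _) (nrmM _ _)) _; rewrite !nrm_star.
have := ler_wpM2l (nrm_ge0 x) (hp y); have := ler_wpM2r (nrm_ge0 y) (hp x); lra.
Qed.

(** The device that turns identities between functions on [-1, 1] into identities between operators:
    both sides are calculi of the same function. *)
Lemma calculus_uniq f F G x : calculus h f F -> calculus h f G -> F x = G x.
Proof.
move=> hF hG; apply/eqP; rewrite -subr_eq0; apply/eqP.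
apply: (@nrm_eq0_lin (4 * nrm x)) => e e0.
have [p hp hx] := hF e e0; have [q hq hy] := hG e e0.
have hpq t : `|t| <= 1 -> `|(p - q).[t]| <= 2 * e.
  move=> t1; rewrite hornerD hornerN -(subrKA (f t)).
  apply: le_trans (ler_normD _ _) _; rewrite distrC.
  by have := hp t t1; have := hq t t1; lra.
have -> : F x - G x = (F x - hact h p x) - (G x - hact h q x) + hact h (p - q) x.
  by rewrite hactB; zmod.
apply: le_trans (ler_nrmD _ _) _.
have := ler_nrmB (F x - hact h p x) (G x - hact h q x).
have := hact_bound x hsa h1 hpq; have := hx x; have := hy x; lra.
Qed.

Lemma calculusB f g F G : calculus h f F -> calculus h g G ->
  calculus h (fun t => f t - g t) (fun x => F x - G x).
Proof.
move=> hF hG e e0; have e2 : 0 < e / 2 by lra.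
have [p hp hx] := hF _ e2; have [q hq hy] := hG _ e2.
exists (p - q) => [t t1|x].
  rewrite hornerD hornerN; have := hp t t1; have := hq t t1.
  have := ler_normB (f t - p.[t]) (g t - q.[t]).
  rewrite (_ : f t - p.[t] - (g t - q.[t]) = f t - g t - (p.[t] - q.[t])); last by ring.
  lra.
rewrite hactB (_ : _ - _ = (F x - hact h p x) - (G x - hact h q x)); last by zmod.
by apply: le_trans (ler_nrmB _ _) _; have := hx x; have := hy x; lra.
Qed.

Lemma calculus_poly_limit f F : calculus h f F -> poly_limit f.
Proof. by move=> hF e /hF[p hp _]; exists p. Qed.

Lemma calculusM f g F G : calculus h f F -> calculus h g G ->
  calculus h (fun t => f t * g t) (F \o G).
Proof.
move=> hF hG e e0.
have [B B0 hB] := poly_limit_bounded (calculus_poly_limit hF).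
have [C C0 hC] := poly_limit_bounded (calculus_poly_limit hG).
pose d := Num.min 1 (e / (B + C + 1)).
have D0 : 0 < B + C + 1 by lra.
have d0 : 0 < d by rewrite lt_min ltr01 divr_gt0.
have d1 : d <= 1 by rewrite ge_min lexx.
have de : (B + C + 1) * d <= e.
  by rewrite mulrC -ler_pdivlMr // ge_min lexx orbT.
have [p hp hx] := hF _ d0; have [q hq hy] := hG _ d0.
exists (p * q) => [t t1|x].
  rewrite hornerM; apply: le_trans de.
  by apply: mul_approx; [exact: hB|exact: hC|exact: hp|exact: hq|rewrite d1 ltW].
have hpB t : `|t| <= 1 -> `|p.[t]| <= B + 1.
  move=> t1; have := hp t t1; have := hB t t1.
  by have := ler_normB (f t) (f t - p.[t]); rewrite subKr; lra.
have -> : (F \o G) x - hact h (p * q) x =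
    (F (G x) - hact h p (G x)) + hact h p (G x - hact h q x).
  by rewrite hactM (linB (hact_lin _ _)) /=; zmod.
apply: le_trans (ler_nrmD _ _) _.
apply: le_trans (_ : (B + C + 1) * d * nrm x <= _); last by rewrite ler_wpM2r ?nrm_ge0.
have t1 := hx (G x); have t2 := hact_bound (G x - hact h q x) hsa h1 hpB.
have t3 : (B + 1) * nrm (G x - hact h q x) <= (B + 1) * (d * nrm x).
  by rewrite ler_wpM2l //; lra.
have t4 : d * nrm (G x) <= d * (C * nrm x).
  by rewrite ler_wpM2l ?(ltW d0) //; exact: calculus_bound hG hC.
lra.
Qed.

Lemma calculus_comm f F G x g : calculus h f F -> calculus h g G ->
  F (G x) = G (F x).
Proof.
move=> hF hG; apply: (@calculus_uniq _ (F \o G) (G \o F) x (calculusM hF hG)).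
by apply: calculus_ext (calculusM hG hF) => t _; rewrite mulrC.
Qed.

(* [F h] is the element of A corresponding to the function [t f(t)]. *)
Lemma calculus_elt f F x : calculus h f F -> F h ** x = F (h ** x).
Proof. by move=> hF; rewrite (calculus_mulr _ _ hF). Qed.

Lemma calculus_elt_sa f F : calculus h f F -> star (F h) = F h.
Proof.
move=> hF; apply: cmul_inj => z; rewrite (calculus_adj _ _ hF) hsa.
by rewrite (calculus_elt _ hF) (calculus_comm _ hF calculus_id).
Qed.

End FunctionalCalculus.

(** * Cuts: functions of h that vanish near 0 *)

Section CutFunctions.
Context {R : realType}.
Implicit Types r s t : R.

(** Piecewise linear in |t|: 0 up to r, 1 from s on. The absolute value keeps both signs of the
    spectrum, so the cut is almost a unit for h. *)
Definition cutf r s t : R := Num.min 1 (Num.max 0 ((`|t| - r) / (s - r))).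

(* [t (cutg r s t) = cutf r s t]. *)
Definition cutg r s t : R := t * (Num.max `|t| r)^-1 ^+ 2 * cutf r s t.

Lemma cutf01 r s t : 0 <= cutf r s t <= 1.
Proof. by rewrite le_min ler01 le_max lexx ge_min lexx. Qed.

Lemma cutf_low r s t : r < s -> `|t| <= r -> cutf r s t = 0.
Proof.
move=> rs tr; rewrite /cutf max_l ?min_r ?ler01 //.
by rewrite pmulr_lle0 ?invr_gt0 ?subr_gt0 // subr_le0.
Qed.

Lemma cutf_high r s t : r < s -> s <= `|t| -> cutf r s t = 1.
Proof.
move=> rs ts; have h : 1 <= (`|t| - r) / (s - r).
  by rewrite ler_pdivlMr ?subr_gt0 // mul1r lerB.
by rewrite /cutf max_r ?min_l // (le_trans ler01).
Qed.

Lemma poly_limit_norm : poly_limit (fun t => `|t| : R).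
Proof. exact: poly_limit_abs poly_limit_id. Qed.

Lemma poly_limit_cutf r s : poly_limit (cutf r s).
Proof.
apply: poly_limit_min (poly_limit_cst _) (poly_limit_max (poly_limit_cst _) _).
apply: poly_limitM (poly_limit_cst _); apply: poly_limitB (poly_limit_cst _).
exact: poly_limit_norm.
Qed.

Lemma poly_limit_maxinv r : 0 < r ->
  poly_limit (fun t => (Num.max `|t| r)^-1).
Proof.
move=> r0; apply: (poly_limit_inv (B := Num.max 1 r) r0).
  exact: poly_limit_max poly_limit_norm (poly_limit_cst _).
by move=> t t1; rewrite le_max lexx orbT /= le_max2.
Qed.

Lemma poly_limit_maxinv2 r : 0 < r ->
  poly_limit (fun t => t * (Num.max `|t| r)^-1 ^+ 2).
Proof.
move=> r0; apply: poly_limitM poly_limit_id _.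
apply: (poly_limit_ext _ (poly_limitM (poly_limit_maxinv r0) (poly_limit_maxinv r0))).
by move=> t _; rewrite expr2.
Qed.

Lemma poly_limit_cutg r s : 0 < r -> poly_limit (cutg r s).
Proof. by move=> r0; exact: poly_limitM (poly_limit_maxinv2 r0) (poly_limit_cutf r s). Qed.

Lemma maxinv_cutf r s t : 0 < r < s ->
  t * (t * (Num.max `|t| r)^-1 ^+ 2) * cutf r s t = cutf r s t.
Proof.
move=> /andP[r0 rs]; have [tr|rt] := leP `|t| r; first by rewrite cutf_low ?mulr0.
have t0 : `|t| != 0 by rewrite gt_eqF // (lt_trans r0).
have -> : t * (t * `|t|^-1 ^+ 2) = 1.
  by rewrite mulrA -expr2 -real_normK ?num_real // exprVn divff // expf_neq0.
by rewrite mul1r.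
Qed.

Lemma maxinv2_le r t : 0 < r -> `|t * (Num.max `|t| r)^-1 ^+ 2| <= r^-1.
Proof.
move=> r0; set m := Num.max _ _.
have m0 : 0 < m by rewrite lt_max r0 orbT.
have tm : `|t| <= m by rewrite le_max lexx.
have rm : r <= m by rewrite le_max lexx orbT.
rewrite normrM normrX normfV (gtr0_norm m0).
rewrite expr2 mulrA -[X in _ <= X]mul1r ler_pM ?mulr_ge0 ?invr_ge0 ?(ltW m0) //.
  by rewrite ler_pdivrMr // mul1r.
by rewrite lef_pV2.
Qed.

End CutFunctions.

Section Cuts.
Context {R : realType} {A : cstarAlgType R}.
Implicit Types (h x y : A) (r s : R) (f : R -> R).

Definition fc h f : A -> A := xget (cst 0) [set F | calculus h f F].

Lemma fcP h f : star h = h -> nrm h <= 1 -> poly_limit f -> calculus h f (fc h f).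
Proof.
by move=> hsa h1 hf; have [F hF] := calculus_exists hsa h1 hf; exact: (@xgetPex _ (cst 0) [set F | calculus h f F] (ex_intro _ F hF)).
Qed.

(** The maximum with 1 keeps the scaling invertible at h = 0 and trivial on the unit ball. *)
Definition scale1 h : R := Num.max 1 (nrm h).

Definition unitball h : A := ((scale1 h)^-1)%:C *: h.

(* The element [cutf r s (h)], where [h] is first scaled into the unit ball. *)
Definition cut h r s : A :=
  fc (unitball h) (cutg (r / scale1 h) (s / scale1 h)) (unitball h).

Lemma scale1_gt0 h : 0 < scale1 h.
Proof. by rewrite lt_max ltr01. Qed.

Lemma unitballK h : (scale1 h)%:C *: unitball h = h.
Proof.
by rewrite /unitball scalerA -rmorphM /= divff ?scale1r // gt_eqF // scale1_gt0.
Qed.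

Lemma scale_conj (k : R) x y :
  (k%:C *: x) ** y ** (k%:C *: x) = (k ^+ 2)%:C *: (x ** y ** x).
Proof. by rewrite !(cscalel, cscaler) scalerA -rmorphM -expr2. Qed.

Lemma unitball_le1 h : nrm (unitball h) <= 1.
Proof.
rewrite nrmZr gtr0_norm ?invr_gt0 ?scale1_gt0 // mulrC ler_pdivrMr ?scale1_gt0 //.
by rewrite mul1r le_max lexx orbT.
Qed.

Lemma unitball_sa h : star h = h -> star (unitball h) = unitball h.
Proof. by move=> hsa; rewrite starZr hsa. Qed.

Section Properties.
Variable h : A.
Hypothesis hsa : star h = h.

Let c := scale1 h.
Let c0 : 0 < c := scale1_gt0 h.
Let u := unitball h.
Let usa : star u = u := unitball_sa hsa.
Let u1 : nrm u <= 1 := unitball_le1 h.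

Let scaled r s : 0 < r < s -> 0 < r / c < s / c.
Proof. by move=> /andP[r0 rs]; rewrite divr_gt0 //= ltr_pM2r // invr_gt0. Qed.

Let cutgP r s : 0 < r < s ->
  calculus u (cutg (r / c) (s / c)) (fc u (cutg (r / c) (s / c))).
Proof.
by move=> /scaled/andP[r0 rs]; apply: fcP => //; exact: poly_limit_cutg.
Qed.

(** Since [cutf] vanishes near 0 it is t times the continuous [cutg], and so comes from an element
    of A and not merely from an operator. *)
Lemma cut_calculus r s : 0 < r < s ->
  calculus u (cutf (r / c) (s / c)) (cmul (cut h r s)).
Proof.
move=> rs; have hG := cutgP rs.
have := calculusM usa u1 hG (calculus_id u).
rewrite (_ : _ \o _ = cmul (cut h r s)); last first.
  by apply/funext => x; rewrite /= -(calculus_elt _ hG).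
apply: calculus_ext => t _; rewrite /cutg mulrC !mulrA -[RHS](maxinv_cutf t (scaled rs)).
by rewrite !mulrA.
Qed.

Lemma cut_sa r s : 0 < r < s -> star (cut h r s) = cut h r s.
Proof. by move=> rs; exact: calculus_elt_sa usa u1 _ _ (cutgP rs). Qed.

Lemma cut_contract r s x : 0 < r < s -> nrm (cut h r s ** x) <= nrm x.
Proof.
move=> rs; rewrite -[leRHS]mul1r; apply: (calculus_bound usa u1 _ (cut_calculus rs)).
by move=> t _; have /andP[? ?] := cutf01 (r / c) (s / c) t; rewrite ger0_norm.
Qed.

(** Where the higher cut function is nonzero the lower one is 1. This is where the local units of
    the whole proof come from. *)
Lemma cut_cut r s r' s' : 0 < r' < s' -> s' <= r -> r < s ->
  cut h r s ** cut h r' s' = cut h r s /\ cut h r' s' ** cut h r s = cut h r s.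
Proof.
move=> rs' sr rs; have /andP[r0' rs0'] := rs'.
have rs0 : 0 < r < s by rewrite rs andbT; lra.
have key : cut h r s ** cut h r' s' = cut h r s.
  apply: cmul_inj => x; rewrite -cmulA.
  apply: (calculus_uniq usa u1 _ (calculusM usa u1 (cut_calculus rs0)
    (cut_calculus rs')) (calculus_ext _ (cut_calculus rs0))) => t _.
  have /andP[_ q'] := scaled rs'; have /andP[_ q] := scaled rs0.
  have [tr|rt] := leP `|t| (r / c); first by rewrite cutf_low ?mul0r.
  rewrite (@cutf_high _ (r' / c)) ?mulr1 //; apply: le_trans (ltW rt).
  by rewrite ler_pM2r // invr_gt0.
split=> //; rewrite -[LHS]starK starM !cut_sa // key cut_sa //.
Qed.

Lemma cut_comm r s : 0 < r < s -> h ** cut h r s = cut h r s ** h.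
Proof.
move=> rs; rewrite -{1 4}(unitballK h) cscalel cscaler; congr (_ *: _).
apply: cmul_inj => x; rewrite -!cmulA.
exact: (calculus_comm usa u1 _ (calculus_id u) (cut_calculus rs)).
Qed.

Lemma cut_near r s : 0 < r < s -> nrm (h - h ** cut h r s) <= s.
Proof.
move=> rs; have /andP[r0 rs1] := rs.
have hB x : nrm (u ** x - u ** (cut h r s ** x)) <= s / c * nrm x.
  apply: (calculus_bound usa u1 _ (calculusB (calculus_id u)
    (calculusM usa u1 (calculus_id u) (cut_calculus rs)))) => t t1.
  have /andP[q0 q1] := scaled rs.
  rewrite -[X in `|X - _|]mulr1 -mulrBr normrM.
  have [ts|st] := leP (s / c) `|t|; first by rewrite cutf_high // subrr normr0 mulr0 divr_ge0 ?(ltW c0) //; lra.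
  have /andP[? ?] := cutf01 (r / c) (s / c) t.
  rewrite [X in _ * X]ger0_norm ?subr_ge0 //.
  have k1 : 1 - cutf (r / c) (s / c) t <= 1 by lra.
  have k0 : 0 <= 1 - cutf (r / c) (s / c) t by lra.
  by have := ler_pM (normr_ge0 t) k0 (ltW st) k1; rewrite mulr1.
(* The bound on the operator becomes a bound on the element w by testing it on star w. *)
have hw : nrm (u - u ** cut h r s) ^+ 2 <= s / c * nrm (u - u ** cut h r s).
  rewrite -nrm_mul_star; set w := u - _.
  by have := hB (star w); rewrite cmulA -cmulBl -/w nrm_star.
have hn : nrm (u - u ** cut h r s) <= s / c.
  have [e|e] := eqVneq (nrm (u - u ** cut h r s)) 0.
    by rewrite e divr_ge0 ?(ltW c0) //; lra.
  have p : 0 < nrm (u - u ** cut h r s) by rewrite lt_neqAle eq_sym e nrm_ge0.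
  by move: hw; rewrite expr2 ler_pM2r.
rewrite -{1 2}(unitballK h) cscalel -scalerBr nrmZr gtr0_norm //.
by rewrite mulrC -ler_pdivlMr.
Qed.

Lemma cut_neq0 r s : 0 < r < s -> s < nrm h -> cut h r s <> 0.
Proof.
move=> rs sh e; have := cut_near rs; rewrite e cmul0r subr0; lra.
Qed.

(** On the support of the cut, t is inverted by t / max(|t|, r)^2, a function bounded by 1 / r. *)
Lemma cut_below r s x : 0 < r < s ->
  r * nrm (cut h r s ** x) <= nrm (h ** (cut h r s ** x)).
Proof.
move=> rs; have /andP[q0 q1] := scaled rs; have /andP[r0 _] := rs.
set k := fun t : R => t * (Num.max `|t| (r / c))^-1 ^+ 2.
have hk := fcP usa u1 (poly_limit_maxinv2 q0).
have e : fc u k (u ** (cut h r s ** x)) = cut h r s ** x.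
  apply: (calculus_uniq usa u1 _ (calculusM usa u1 hk (calculusM usa u1
    (calculus_id u) (cut_calculus rs))) (calculus_ext _ (cut_calculus rs))) => t _.
  by rewrite /= mulrCA mulrA maxinv_cutf // q0.
have h2 := calculus_bound usa u1 (u ** (cut h r s ** x)) hk (fun t _ => maxinv2_le t q0).
rewrite e invf_div in h2.
have -> : nrm (h ** (cut h r s ** x)) = c * nrm (u ** (cut h r s ** x)).
  by rewrite -{1}(unitballK h) cscalel nrmZr gtr0_norm.
by rewrite mulrC -ler_pdivlMr // mulrAC.
Qed.

(** An exact factorization: cuts of h inherit membership in ideals and corners from h without
    passing to closures. *)
Lemma cut_factor r s : 0 < r < s -> exists m, cut h r s = h ** m ** h.
Proof.
move=> rs; have /andP[q0 q1] := scaled rs.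
have hk := fcP usa u1 (poly_limit_maxinv2 q0); set k := fun t : R => _ in hk.
(* The function is k^3 [cutf], where t k = 1 on the support of [cutf]. Of the three factors t that
   compensate k^3, two are the outer h and the third turns the operator F into the element [F u]. *)
have hm := calculusM usa u1 (calculusM usa u1 hk hk) (calculusM usa u1 hk (cut_calculus rs)).
set F := (X in calculus _ _ X) in hm.
exists ((c^-1 ^+ 2)%:C *: F u).
rewrite -{2 3}(unitballK h) scale_conj cscaler cscalel scalerA -rmorphM /= -/u -/c.
rewrite -exprMn divff ?gt_eqF // expr1n scale1r; apply: cmul_inj => x; rewrite -!cmulA (calculus_elt _ hm).
have hL := calculusM usa u1 (calculus_id u) (calculusM usa u1 hm
  (calculusM usa u1 (calculus_id u) (calculus_id u))).
apply: (calculus_uniq usa u1 _ (calculus_ext _ (cut_calculus rs)) hL) => t _.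
have e := maxinv_cutf t (scaled rs); rewrite -/c -/(k t) in e.
rewrite -[LHS]e -[in LHS]e -[in LHS]e; ring.
Qed.

End Properties.

(** On the support of the cut, r <= |t| <= 1 and so |1 - t^2| <= 1 - r^2. For r near 1 this compares
    a cut with its product by h^2. *)
Lemma cut_top h r s : star h = h -> nrm h = 1 -> 0 < r < s -> s < 1 ->
  nrm (cut h r s - h ** h ** cut h r s) <= 1 - r ^+ 2.
Proof.
move=> hsa h1 rs s1; have /andP[r0 rs1] := rs.
have c1 : scale1 h = 1 by rewrite /scale1 h1 maxxx.
have u1 : unitball h = h by rewrite /unitball c1 invr1 scale1r.
have h1' : nrm h <= 1 by rewrite h1.
have hc := cut_calculus hsa rs; rewrite c1 !divr1 u1 in hc.
have hB x : nrm (cut h r s ** x - h ** (h ** (cut h r s ** x))) <= (1 - r ^+ 2) * nrm x.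
  apply: (calculus_bound hsa h1' _ (calculusB hc (calculusM hsa h1' (calculus_id h)
    (calculusM hsa h1' (calculus_id h) hc)))) => t t1.
  rewrite mulrA -{1}[cutf r s t]mul1r -mulrBl normrM -expr2 -(real_normK (num_real t)).
  have r2 : 0 <= 1 - r ^+ 2 by rewrite subr_ge0 expr_le1 //; lra.
  have [tr|rt] := leP `|t| r; first by rewrite cutf_low // normr0 mulr0.
  have /andP[? ?] := cutf01 r s t.
  rewrite [X in _ * X]ger0_norm // ger0_norm ?subr_ge0 ?expr_le1 //.
  have k0 : 0 <= 1 - `|t| ^+ 2 by rewrite subr_ge0 expr_le1.
  have k1 : 1 - `|t| ^+ 2 <= 1 - r ^+ 2.
    by rewrite lerB // lerXn2r ?nnegrE // ?(ltW r0) // ltW.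
  have k2 : cutf r s t <= 1 by [].
  have k3 : 0 <= cutf r s t by [].
  by have := ler_pM k0 k3 k1 k2; rewrite mulr1.
set w := _ - _; have hw : nrm w ^+ 2 <= (1 - r ^+ 2) * nrm w.
  by rewrite -nrm_mul_star /w; have := hB (star w); rewrite !cmulA -cmulBl nrm_star.
have [->|e] := eqVneq (nrm w) 0; first by rewrite subr_ge0 expr_le1 //; lra.
have p : 0 < nrm w by rewrite lt_neqAle eq_sym e nrm_ge0.
by move: hw; rewrite expr2 ler_pM2r.
Qed.

End Cuts.

(** * Cuts and minimal projections *)

Section Projections.
Context {R : realType} {A : cstarAlgType R}.
Implicit Types (c d e h p x y z : A) (r s : R).

Lemma mul_sa_comm x y : star x = x -> star y = y -> x ** y = x -> y ** x = x.
Proof. by move=> sx sy xy; rewrite -{1}sx -{1}sy -starM xy. Qed.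

(** The part of z* z near the top of its spectrum. The lower level makes z bounded below by |z| / 2
    on its range; the upper level is below |z|^2, so the cut is nonzero. *)
Definition topcut z : A :=
  cut (star z ** z) (nrm z ^+ 2 / 2) (3 / 4 * nrm z ^+ 2).

Section TopCut.
Variable z : A.
Hypothesis z0 : 0 < nrm z.

Let levels : 0 < nrm z ^+ 2 / 2 < 3 / 4 * nrm z ^+ 2.
Proof. have : 0 < nrm z ^+ 2 by rewrite exprn_gt0. by move=> ?; apply/andP; split; lra. Qed.

Lemma topcut_sa : star (topcut z) = topcut z.
Proof. by rewrite /topcut (cut_sa (mul_star_sa z) levels). Qed.

Lemma topcut_neq0 : topcut z <> 0.
Proof.
apply: (cut_neq0 (mul_star_sa z) levels); rewrite nrm_star_mul.
have : 0 < nrm z ^+ 2 by rewrite exprn_gt0. lra.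
Qed.

Lemma topcut_factor : exists m, topcut z = star z ** m ** z.
Proof.
have [m mE] := cut_factor (mul_star_sa z) levels.
by exists (z ** m ** star z); rewrite /topcut mE !cmulA.
Qed.

Lemma topcut_lower y : nrm z * nrm (topcut z ** y) <= 2 * nrm (z ** (topcut z ** y)).
Proof.
have h1 := cut_below (mul_star_sa z) y levels; rewrite -/(topcut z) in h1.
have h2 := nrmM (star z) (z ** (topcut z ** y)); rewrite nrm_star in h2.
rewrite cmulA in h2; have h3 := le_trans h1 h2.
rewrite -(ler_pM2l z0); move: h3; rewrite expr2; lra.
Qed.

(** The transfer principle: an upper bound m < |z| / 2 contradicts the lower bound of [topcut_lower]
    unless the vector is 0. Norm bounds up to a factor 2 are derived from it by contradiction. *)
Lemma topcut_kill (m : R) y : 2 * m < nrm z ->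
  nrm (z ** (topcut z ** y)) <= m * nrm (topcut z ** y) -> topcut z ** y = 0.
Proof.
move=> mz h; have h1 := topcut_lower y.
apply: nrm_le0; have h2 : (nrm z - 2 * m) * nrm (topcut z ** y) <= 0 by lra.
by rewrite pmulr_rle0 // subr_gt0 in h2.
Qed.

End TopCut.

(** With h = x* x and k the cut, |x - x k|^2 = |(1 - k)(h - h k)| <= 2 s, whence s = e^2 / 2. *)
Lemma approx_right_cut x (e : R) : 0 < e -> exists2 s, 0 < s &
  forall r, 0 < r < s -> nrm (x - x ** cut (star x ** x) r s) <= e.
Proof.
move=> e0; exists (e ^+ 2 / 2) => [|r rs]; first by rewrite divr_gt0 ?exprn_gt0.
have hsa := mul_star_sa x; set h := star x ** x in hsa *; set s := e ^+ 2 / 2 in rs *.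
set k := cut h r s; have ksa : star k = k := cut_sa hsa rs.
rewrite -(@ler_pXn2r _ 2) ?nnegrE ?nrm_ge0 ?(ltW e0) // -nrm_star_mul.
have -> : star (x - x ** k) ** (x - x ** k) = (h - h ** k) - k ** (h - h ** k).
  rewrite starB starM ksa cmulBl !cmulBr !cmulA -!(cmulA k) -/h.
  by rewrite ?cmulA; zmod.
apply: le_trans (ler_nrmB _ _) _.
have := cut_near hsa rs; have := cut_contract hsa (h - h ** k) rs.
rewrite -/k /s; lra.
Qed.

Definition is_proj p := star p = p /\ p ** p = p.

Definition minproj p : Prop :=
  [/\ is_proj p, p <> 0 & forall x, exists a : R[i], p ** x ** p = a *: p].

Definition corner c x := exists y, x = c ** y ** c.

Lemma corner_trans c d x : corner c d -> corner d x -> corner c x.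
Proof. by move=> [y ->] [z ->]; exists (y ** c ** z ** c ** y); rewrite !cmulA. Qed.

Lemma cut_corner h r s : star h = h -> 0 < r < s -> corner h (cut h r s).
Proof. by move=> hsa rs; have [m ->] := cut_factor hsa rs; exists m. Qed.

Definition unsplittable c : Prop := forall x y, corner c x -> corner c y ->
  star x = x -> star y = y -> x ** y = 0 -> x = 0 \/ y = 0.

(** For a higher cut l, the elements d l d and d^2 - d k d are orthogonal because l k = l. The first
    is nonzero, so the second must vanish. *)
Lemma unsplittable_cut c d r s : unsplittable c -> corner c d -> star d = d ->
  0 < r < s -> s < nrm d -> d ** d ** cut d r s = d ** d.
Proof.
move=> cu cd dsa rs sd; have /andP[r0 rs1] := rs.
pose t := (s + nrm d) / 2.
have st : 0 < s < t by rewrite /t; apply/andP; split; lra.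
have td : t < nrm d by rewrite /t; lra.
set k := cut d r s; set l := cut d s t.
have ksa : star k = k := cut_sa dsa rs; have lsa : star l = l := cut_sa dsa st.
have dk : d ** k = k ** d := cut_comm dsa rs.
have dl : d ** l = l ** d := cut_comm dsa st.
have [lk _] : l ** k = l /\ k ** l = l.
  by apply: cut_cut => //; case/andP: st.
have c1 : corner c (d ** l ** d) by apply: corner_trans cd _; exists l.
have c2 : corner c (d ** d - d ** k ** d).
  case: cd => y ->; exists (y ** c ** c ** y - y ** c ** k ** c ** y).
  by rewrite cmulBr cmulBl !cmulA.
have [||| h0|h0] := cu _ _ c1 c2.
- by rewrite !starM dsa lsa cmulA.
- by rewrite starB !starM dsa ksa cmulA.
- rewrite cmulBr !cmulA.
  have e : d ** l ** d ** d ** k = d ** l ** d ** d.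
    by rewrite -[LHS]cmulA dk cmulA -[d ** l ** d ** k]cmulA dk cmulA -(cmulA d l k) lk.
  by rewrite e subrr.
- exfalso; apply: (cut_neq0 dsa st td); apply: cmul_inj => x; rewrite cmul0l.
  have dl0 : d ** l = 0.
    by apply: star_mul_eq0; rewrite starM dsa lsa -dl cmulA h0 cmul0l.
  apply: nrm_le0; have := cut_below dsa x st.
  rewrite cmulA -/l dl0 cmul0l nrm0 pmulr_rle0 //; lra.
- have e : d ** k ** d = d ** d ** k by rewrite -cmulA -dk cmulA.
  by rewrite -e; apply/esym/eqP; rewrite -subr_eq0 h0.
Qed.

(** From d^2 k = d^2, the element d^2 k (k x - x) vanishes; d commutes with k and is bounded below
    on its range, so both factors d cancel. *)
Lemma unsplittable_proj c d r s : unsplittable c -> corner c d -> star d = d ->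
  0 < r < s -> s < nrm d -> is_proj (cut d r s).
Proof.
move=> cu cd dsa rs sd; have ddk := unsplittable_cut cu cd dsa rs sd.
have /andP[r0 rs1] := rs; have dk := cut_comm dsa rs.
split; first exact: cut_sa.
set k := cut d r s in ddk dk *; apply: cmul_inj => x.
apply/eqP; rewrite -subr_eq0 -cmulA -cmulBr; apply/eqP.
set y := k ** x - x.
have ddky : d ** (d ** (k ** y)) = 0.
  by rewrite !cmulA ddk /y cmulBr cmulA ddk subrr.
have kdy : k ** (d ** y) = 0.
  apply: nrm_le0; have := cut_below dsa (d ** y) rs.
  by rewrite -/k cmulA -dk -cmulA cmulA -[d ** k ** _]cmulA ddky nrm0 pmulr_rle0.
apply: nrm_le0; have := cut_below dsa y rs.
by rewrite -/k cmulA dk -cmulA kdy nrm0 pmulr_rle0.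
Qed.

(** Every cut k of e is a nonzero projection under p, and k (p - k) = 0 forces k = p. Letting the
    levels tend to 1 in [cut_top] gives e^2 = p, so p + e and p - e are orthogonal and one of them
    vanishes. *)
Lemma unsplittable_sa c p e : unsplittable c -> is_proj p -> corner c p ->
  corner p e -> star e = e -> nrm e = 1 -> e = p \/ e = - p.
Proof.
move=> cu [psa pp] cp pe esa e1.
have ce := corner_trans cp pe.
have [ep epr] : p ** e = e /\ e ** p = e.
  by case: pe => y ->; rewrite !cmulA pp -!cmulA pp.
have key r s : 0 < r < s -> s < 1 -> cut e r s = p.
  move=> rs s1; have s1' : s < nrm e by rewrite e1.
  have [ksa kk] := unsplittable_proj cu ce esa rs s1'.
  have [m mE] := cut_factor esa rs.
  have pk : p ** cut e r s = cut e r s by rewrite mE !cmulA ep.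
  have kp : cut e r s ** p = cut e r s by rewrite mE -!cmulA epr.
  have ck : corner c (cut e r s) by apply: corner_trans ce _; exists m.
  have cpk : corner c (p - cut e r s).
    case: cp ck => [y {1}->] [z ->]; exists (y - z); by rewrite cmulBr cmulBl.
  have [|| k0|] := cu _ _ ck cpk ksa.
  - by rewrite starB psa ksa.
  - by rewrite cmulBr kp kk subrr.
  - by case: (cut_neq0 esa rs s1').
  - by move/eqP; rewrite subr_eq0 => /eqP.
have ee : e ** e = p.
  apply/eqP; rewrite eq_sym -subr_eq0; apply/eqP; apply: nrm_eq0_eps => d d0.
  have [r [s [rs s1 hr]]] : exists r s, [/\ 0 < r < s, s < 1 & 1 - r ^+ 2 <= d].
    pose r : R := Num.max (1 / 2) (1 - d / 2); exists r, ((1 + r) / 2).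
    have r1 : r < 1 by rewrite gt_max; apply/andP; split; lra.
    have rh : 1 / 2 <= r by rewrite le_max lexx.
    have rd : 1 - d / 2 <= r by rewrite le_max lexx orbT.
    split; [by apply/andP; split; lra|lra|].
    have -> : 1 - r ^+ 2 = (1 - r) * (1 + r) by ring.
    have : (1 - r) * (1 + r) <= (1 - r) * 2 by rewrite ler_wpM2l //; lra.
    lra.
  have := cut_top esa e1 rs s1; rewrite (key r s rs s1) -(cmulA e e p) epr.
  by move/le_trans; apply.
have c1 : corner c (p + e).
  by case: cp ce => [y {1}->] [z ->]; exists (y + z); rewrite cmulDr cmulDl.
have c2 : corner c (p - e).
  by case: cp ce => [y {1}->] [z ->]; exists (y - z); rewrite cmulBr cmulBl.
have [||| h0|h0] := cu _ _ c1 c2.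
- by rewrite starD psa esa.
- by rewrite starB psa esa.
- by rewrite cmulBr !cmulDl pp ep epr ee; zmod.
- by right; apply/eqP; rewrite -addr_eq0 addrC h0.
- by left; apply/eqP; rewrite eq_sym -subr_eq0 h0.
Qed.

Lemma unsplittable_minproj c : star c = c -> c <> 0 -> unsplittable c ->
  exists2 p, minproj p & corner c p.
Proof.
(* c itself need not have the form c y c; its cube does, and is nonzero. *)
move=> csa c0 cu; pose d := c ** c ** c.
have dsa : star d = d by rewrite /d !starM csa cmulA.
have d0 : d <> 0.
  move=> e; apply: c0; apply: (sa_sqr_eq0 csa); apply: sa_sqr_eq0.
    by rewrite starM csa.
  by rewrite !cmulA -/d e cmul0l.
have cd : corner c d by exists c.
have n0 := nrm_gt0 d0.
have rs : 0 < nrm d / 3 < nrm d / 2 by apply/andP; split; lra.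
have sd : nrm d / 2 < nrm d by lra.
have pP := unsplittable_proj cu cd dsa rs sd.
have p0 := cut_neq0 dsa rs sd; have pd := cut_corner dsa rs.
set p := cut d _ _ in pP p0 pd; have cp := corner_trans cd pd.
exists p => //; split=> //.
have hsa e : corner p e -> star e = e -> exists a : R[i], e = a *: p.
  move=> pe esa; have [e0|e0] := eqVneq (nrm e) 0.
    by exists 0; rewrite scale0r (nrm0_eq0 e0).
  pose a := nrm e; have a0 : 0 < a by rewrite lt_neqAle eq_sym e0 nrm_ge0.
  have eE : e = a%:C *: ((a^-1)%:C *: e).
    by rewrite scalerA -rmorphM divff ?gt_eqF // scale1r.
  have [||| h|h] := @unsplittable_sa c p ((a^-1)%:C *: e) cu pP cp.
  - by case: pe => y ->; exists ((a^-1)%:C *: y); rewrite cscaler cscalel.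
  - by rewrite starZr esa.
  - by rewrite nrmZr gtr0_norm ?invr_gt0 // mulVf.
  - by exists a%:C; rewrite {1}eE h.
  - by exists (- a%:C); rewrite {1}eE h scaleNr scalerN.
(* The self-adjoint case is applied to y + star y and to i (y - star y), from which y is
   recovered. *)
case: (pP) => psa pp x; pose y := p ** x ** p.
have [a aE] : exists a : R[i], y + star y = a *: p.
  apply: hsa; last by rewrite starD starK addrC.
  by exists (x + star x); rewrite /y !starM psa cmulDr cmulDl cmulA.
have [b bE] : exists a : R[i], 'i%C *: (y - star y) = a *: p.
  apply: hsa.
    exists ('i%C *: (x - star x)).
    by rewrite /y !starM psa cscaler cscalel cmulBr cmulBl cmulA.
  rewrite starZ starB starK -(opprB y) scalerN -scaleNr; congr (_ *: _).
  by apply/eqP; rewrite eq_complex /= oppr0 opprK !eqxx.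
exists ((a - 'i%C * b) / 2).
have -> : p ** x ** p = (2^-1 : R[i]) *: ((y + star y) - 'i%C *: ('i%C *: (y - star y))).
  rewrite [in X in _ - X]scalerA -expr2 sqr_i scaleN1r opprK.
  rewrite (_ : y + star y + (y - star y) = 2%:R *: y); last by rewrite scaler_nat mulr2n; zmod.
  by rewrite scalerA mulVf ?scale1r // pnatr_eq0.
by rewrite aE bE scalerA -scalerBl scalerA mulrC.
Qed.

End Projections.

(** * The Pedersen ideal *)

Section Pedersen.
Context {R : realType} {A : cstarAlgType R}.
Implicit Types (x y z g : A) (I B S : set A).

Lemma subspaceZ S (a : R[i]) x : linear_subspace S -> S x -> S (a *: x).
Proof. by move=> [S0 SL] Sx; have := SL a x 0 Sx S0; rewrite addr0. Qed.

Lemma subspaceD S x y : linear_subspace S -> S x -> S y -> S (x + y).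
Proof. by move=> [S0 SL] Sx Sy; have := SL 1 x y Sx Sy; rewrite scale1r. Qed.

Lemma subspaceN S x : linear_subspace S -> S x -> S (- x).
Proof. by move=> SL Sx; rewrite -scaleN1r; exact: subspaceZ. Qed.

Lemma subspaceB S x y : linear_subspace S -> S x -> S y -> S (x - y).
Proof. by move=> SL Sx /(subspaceN SL); exact: subspaceD. Qed.

Lemma subspace_sum S (J : Type) (s : seq J) (F : J -> A) : linear_subspace S ->
  (forall j, S (F j)) -> S (\sum_(j <- s) F j).
Proof.
move=> SL SF; elim/big_ind: _ => [|x y|//]; first by case: SL.
exact: subspaceD.
Qed.

Lemma idealMl B I b x : ideal_of B I -> B b -> I x -> I (b ** x).
Proof. by move=> [_ _ h] Bb Ix; case: (h b x Bb Ix). Qed.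

Lemma idealMr B I b x : ideal_of B I -> B b -> I x -> I (x ** b).
Proof. by move=> [_ _ h] Bb Ix; case: (h b x Bb Ix). Qed.

(** v is the sum of z^n over n >= 1, that is (1 - z)^(-1) - 1, which makes sense without a unit. *)
Lemma quasi_inverse z : nrm z <= 1 / 2 -> exists v, v = z + z ** v.
Proof.
move=> z1; pose s := fix s n := if n is n.+1 then z + z ** s n else 0 : A.
pose rho n : R := 1 / 2 ^+ n.
have rhoS n : rho n.+1 = rho n / 2.
  by rewrite /rho exprS invfM; lra.
have r0 n : 0 <= rho n by rewrite /rho mul1r invr_ge0 exprn_ge0.
have hs n : nrm (s n.+1 - s n) <= rho n - rho n.+1.
  elim: n => [|n ih].
    by rewrite rhoS /= /rho expr0 cmul0r addr0 subr0; lra.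
  have -> : s n.+2 - s n.+1 = z ** (s n.+1 - s n).
    by rewrite cmulBr /=; zmod.
  apply: le_trans (nrmM _ _) _.
  have := ler_pM (nrm_ge0 z) (nrm_ge0 (s n.+1 - s n)) z1 ih.
  by move: (nrm z * _) => w; rewrite !rhoS; lra.
have [v hv] := lim_telescope hs r0 (@inv_pow2_small R 1).
exists v; apply/eqP; rewrite -subr_eq0; apply/eqP.
apply: nrm_eq0_eps => e e0; have [n hn] := inv_pow2_small 1 (divr_gt0 e0 (ltr0Sn _ 1)).
rewrite -/(rho n) in hn.
have -> : v - (z + z ** v) = (v - s n.+1) - z ** (v - s n).
  by rewrite cmulBr /=; zmod.
apply: le_trans (ler_nrmB _ _) _.
have := nrmM z (v - s n); have := ler_pM (nrm_ge0 z) (nrm_ge0 _) z1 (hv n).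
have := hv n.+1; rewrite rhoS; have := r0 n; lra.
Qed.

(* If y in I is close to g then e (1 - (g - y)) = e y, and 1 - (g - y) is
   invertible in the unitization. *)
Lemma dense_ideal_unit I e g : dense_ideal_of [set: A] I -> e ** g = e -> I e.
Proof.
move=> [hI dI] eg; have [_ IL _] := hI.
have h2 : (0 : R) < 1 / 2 by lra.
have /closure_nrmP/(_ _ h2)[y Iy hy] : closure I g by exact: dI.
have [v hv] := quasi_inverse hy.
have -> : e = e ** y + e ** y ** v.
  have hz : e ** (g - y) = e - e ** y by rewrite cmulBr eg.
  have : e ** v = (e - e ** y) + (e - e ** y) ** v.
    by rewrite -hz -cmulA -cmulDr -hv.
  by rewrite cmulBl => /eqP; rewrite -subr_eq0 => /eqP h0; rewrite -[LHS]addr0 -h0; zmod.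
have Iey : I (e ** y) by apply: (idealMl hI).
by apply: subspaceD => //; apply: (idealMr hI).
Qed.

(** The criterion by which elements constructed below, such as cuts and infinite sums, are seen to
    lie in the Pedersen ideal. *)
Lemma pedersen_unit e g : e ** g = e -> pedersen_ideal [set: A] e.
Proof. by move=> eg I hI; exact: dense_ideal_unit hI eg. Qed.

Lemma pedersen_ideal_of B : B 0 -> linear_subspace B ->
  (forall b x, B b -> B x -> B (b ** x)) -> ideal_of B (pedersen_ideal B).
Proof.
move=> B0 BL BM; split.
- by move=> x /(_ B); apply; split; [split|exact: subset_closure] => // b x' *; split; exact: BM.
- split=> [I [[_ [I0 _] _] _] //|a x y hx hy I hI].
  by have [[_ [_ IL] _] _] := hI; apply: IL; [exact: hx|exact: hy].
- move=> b x Bb hx; split=> I hI; have [h _] := hI.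
    by apply: (idealMl h Bb); exact: hx.
  by apply: (idealMr h Bb); exact: hx.
Qed.

Lemma ped_ideal : ideal_of [set: A] (pedersen_ideal [set: A]).
Proof. by apply: pedersen_ideal_of. Qed.

Lemma cut_has_unit (h : A) (r s : R) : star h = h -> 0 < r < s ->
  cut h r s ** cut h (r / 2) r = cut h r s /\ cut h (r / 2) r ** cut h r s = cut h r s.
Proof.
move=> hsa /andP[r0 rs]; apply: cut_cut => //.
by apply/andP; split; lra.
Qed.

Lemma ped_cut (h : A) (r s : R) : star h = h -> 0 < r < s ->
  pedersen_ideal [set: A] (cut h r s).
Proof.
by move=> hsa rs; have [h1 _] := cut_has_unit hsa rs; exact: pedersen_unit h1.
Qed.

(** x is approximated by its products with cuts of x* x, and a cut lies in every dense ideal because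
    a lower cut is a unit for it. *)
Lemma ped_dense x : closure (pedersen_ideal [set: A]) x.
Proof.
apply/closure_nrmP => e e0; have [s s0 hs] := approx_right_cut x e0.
have rs : 0 < s / 2 < s by apply/andP; split; lra.
exists (x ** cut (star x ** x) (s / 2) s); last exact: hs.
by apply: (idealMl ped_ideal) => //; apply: ped_cut => //; exact: mul_star_sa.
Qed.

Lemma dense_left_faithful S y : (forall x, closure S x) ->
  (forall c, S c -> y ** c = 0) -> y = 0.
Proof.
move=> dS hy; rewrite -[y]starK; suff -> : star y = 0 by rewrite star0.
apply: star_mul_eq0; rewrite starK; apply: (@nrm_eq0_lin _ _ (nrm y)) => e e0.
have /closure_nrmP/(_ _ e0)[c Sc hc] := dS (star y).
have -> : y ** star y = y ** (star y - c) by rewrite cmulBr (hy c Sc) subr0.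
by apply: le_trans (nrmM _ _) _; rewrite ler_wpM2l ?nrm_ge0.
Qed.

End Pedersen.

(** * Uniform boundedness principle *)

Section Boundedness.
Context {R : realType} {A : cstarAlgType R}.
Implicit Types (x y z b c d g p : A).
Notation K := (pedersen_ideal [set: A]).

(** A gliding hump with signs: x is a sum of terms +- xi n of size 5^(-n), where G n is almost
    extremal at xi n and the later terms are too small to undo its large value. *)
Lemma uniform_boundedness (J : Type) (F : J -> A -> A) :
  (forall j (a : R) x y, F j (a%:C *: x + y) = a%:C *: F j x + F j y) ->
  (forall j, exists B : R, forall x, nrm (F j x) <= B * nrm x) ->
  (forall x, exists C : R, forall j, nrm (F j x) <= C) ->
  exists M : R, forall j x, nrm (F j x) <= M * nrm x.
Proof.
move=> Flin Fb Fp; apply: contrapT => nM.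
have F0 j : F j 0 = 0.
  have := Flin j (-1) 0 0; rewrite scaler0 addr0 rmorphN1 scaleN1r addNr //.
have FZ j (a : R) x : F j (a%:C *: x) = a%:C *: F j x.
  by have := Flin j a x 0; rewrite F0 !addr0.
have FD j x y : F j (x + y) = F j x + F j y.
  by have := Flin j 1 x y; rewrite !scale1r.
have FN j x : F j (- x) = - F j x.
  by have := FZ j (-1) x; rewrite rmorphN1 !scaleN1r.
(* k is the least integer bound of F j, so that k - 1 is not a bound *)
have step (n : nat) : exists q : J * nat * A,
    let: (j, k, xi) := q in
    [/\ forall x, nrm (F j x) <= k%:R * nrm x, (n * 5 ^ n + 1 < k)%N,
        nrm xi <= (5 ^+ n)^-1 & (k%:R - 1) / 5 ^+ n <= nrm (F j xi)].
  have [j [x0 hx0]] : exists j x, (n * 5 ^ n + 1)%:R * nrm x < nrm (F j x).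
    apply: contrapT => h; apply: nM; exists (n * 5 ^ n + 1)%:R => j x.
    by rewrite leNgt; apply/negP => h'; apply: h; exists j, x.
  have bnd : exists k : nat, `[< forall x, nrm (F j x) <= k%:R * nrm x >].
    have [B hB] := Fb j; exists (Num.bound `|B|); apply/asboolP => x.
    apply: le_trans (hB x) _; rewrite ler_wpM2r ?nrm_ge0 //.
    by apply: le_trans (ler_norm B) _; apply/ltW/archi_boundP/normr_ge0.
  case: (ex_minnP bnd) => k /asboolP kb kmin.
  have hk : (n * 5 ^ n + 1 < k)%N.
    rewrite ltnNge; apply/negP => kle; have := kb x0; apply/negP; rewrite -ltNge.
    by apply: le_lt_trans hx0; rewrite ler_wpM2r ?nrm_ge0 // ler_nat.
  have k0 : (0 < k)%N by lia.
  have [x hx] : exists x, (k.-1)%:R * nrm x < nrm (F j x).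
    apply: contrapT => h; have : (k <= k.-1)%N.
      apply: kmin; apply/asboolP => x; rewrite leNgt; apply/negP => h'.
      by apply: h; exists x.
    lia.
  have x0' : 0 < nrm x.
    apply: nrm_gt0 => e; move: hx; rewrite e F0 nrm0 mulr0 ltxx //.
  have p0 : (0 : R) < 5 ^+ n by rewrite exprn_gt0.
  pose a : R := (5 ^+ n)^-1 / nrm x; have a0 : 0 < a by rewrite divr_gt0 ?invr_gt0.
  exists (j, k, a%:C *: x); split=> //.
    by rewrite nrmZr gtr0_norm // /a divfK ?gt_eqF.
  rewrite FZ nrmZr gtr0_norm // /a.
  have -> : (k%:R - 1 : R) = (k.-1)%:R by rewrite -{1}(prednK k0) -natr1 addrK.
  rewrite [leRHS](_ : _ = nrm (F j x) / nrm x / 5 ^+ n); last by ring.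
  by rewrite ler_pM2r ?invr_gt0 // ler_pdivlMr // ltW.
have /choice[q hq] := step.
pose G n := F (q n).1.1; pose k n := (q n).1.2; pose xi n := (q n).2.
have qP n : [/\ forall x, nrm (G n x) <= (k n)%:R * nrm x, (n * 5 ^ n + 1 < k n)%N,
    nrm (xi n) <= (5 ^+ n)^-1 & ((k n)%:R - 1) / 5 ^+ n <= nrm (G n (xi n))].
  by have := hq n; rewrite /G /k /xi; case: (q n) => [[j m] x].
(* One of the two signs always works, since 2 v = (u + v) - (u - v) gives max(|u + v|, |u - v|) >=
   |v|. *)
pose s := fix s n := if n is n.+1 then
  (if nrm (G n (xi n)) <= nrm (G n (s n + xi n)) then s n + xi n else s n - xi n)
  else 0 : A.
have sP n : nrm (G n (xi n)) <= nrm (G n (s n.+1)) /\ nrm (s n.+1 - s n) <= (5 ^+ n)^-1.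
  have [_ _ hxi _] := qP n.
  have -> : s n.+1 = if nrm (G n (xi n)) <= nrm (G n (s n + xi n)) then s n + xi n
    else s n - xi n by [].
  move: (s n) => w; case: (leP (nrm (G n (xi n))) (nrm (G n (w + xi n)))) => h; first by split=> //; rewrite addrAC subrr add0r.
  split; last by rewrite addrAC subrr add0r nrmN.
  have GD y z : G n (y + z) = G n y + G n z by exact: FD.
  have GN y : G n (- y) = - G n y by exact: FN.
  rewrite GD in h; rewrite GD GN; move: (G n w) (G n (xi n)) h => u v h.
  have : nrm (v + v) <= nrm (u + v) + nrm (u - v).
    by rewrite (_ : v + v = (u + v) - (u - v)); [exact: ler_nrmB|zmod].
  have -> : v + v = (2 : R)%:C *: v by rewrite rmorph_nat scaler_nat mulr2n.
  by rewrite nrmZr ger0_norm //; lra.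
(* The sum of 5^(-k) over k >= n. What remains after step n is at most a quarter of 5^(-n), which
   leaves (3 k / 4 - 1) / 5^n in the lower bound for |G n x|. *)
pose rho n : R := 5 / 4 / 5 ^+ n.
have p5 n : (0 : R) < 5 ^+ n by rewrite exprn_gt0.
have rhoS n : rho n.+1 = 1 / 4 / 5 ^+ n.
  by rewrite /rho exprS; field; rewrite gt_eqF.
have [x hx] : exists x, forall n, nrm (x - s n) <= rho n.
  apply: lim_telescope => [n|n|e e0].
  - by rewrite rhoS; apply: le_trans (sP n).2 _; rewrite /rho; lra.
  - by rewrite /rho divr_ge0 // ltW.
  - have [n hn] := inv_pow2_small (5 / 4) e0; exists n; apply: le_trans hn.
    by rewrite /rho ler_pM2l // lef_pV2 ?posrE ?exprn_gt0 // lerXn2r ?nnegrE // ler_nat.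
have [C hC] := Fp x.
have key n : 3 / 4 * n%:R <= C.
  have [hb hk _ hxi] := qP n; have [h1 h2] := sP n.
  have h3 := hC (q n).1.1; rewrite -/(G n) in h3.
  have h4 := hb (x - s n.+1); have h5 := hx n.+1; rewrite rhoS in h5.
  have h6 : nrm (G n (s n.+1)) <= nrm (G n x) + nrm (G n (x - s n.+1)).
    have -> : G n (x - s n.+1) = G n x - G n (s n.+1) by rewrite /G FD FN.
    by rewrite -nrmC; have := ler_nrm_add (G n (s n.+1)) (G n x).
  have h7 : (k n)%:R * nrm (x - s n.+1) <= (k n)%:R * (1 / 4 / 5 ^+ n) by rewrite ler_wpM2l.
  have h8 : (3 / 4 * (k n)%:R - 1) / 5 ^+ n <= C.
    by rewrite mulrBl mul1r; rewrite mulrBl mul1r in hxi; lra.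
  have h9 : n%:R * 5 ^+ n + 2 <= (k n)%:R :> R.
    by rewrite -natrX -natrM -natrD ler_nat; lia.
  apply: le_trans h8; rewrite ler_pdivlMr //; lra.
have C0 : 0 <= C by have := key 0%N; rewrite mulr0.
have h := archi_boundP (_ : 0 <= 4 / 3 * C); have := key (Num.bound (4 / 3 * C)).
have : 0 <= 4 / 3 * C by lra.
by move=> /h h'; lra.
Qed.

End Boundedness.

(** * Bounded elements of a left centralizer *)

Section Centralizer.
Context {R : realType} {A : cstarAlgType R}.
Implicit Types (x y z b c d g p : A).
Notation K := (pedersen_ideal [set: A]).
Variable T : A -> A.
Hypothesis hT : left_centralizer K T.

Lemma ped_mull x y : K y -> K (x ** y).
Proof. by move=> Ky; apply: (idealMl ped_ideal). Qed.

Lemma ped_mulr x y : K x -> K (x ** y).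
Proof. by move=> Kx; apply: (idealMr ped_ideal). Qed.

Lemma ped_subspace : linear_subspace K.
Proof. by have [_ h _] := @ped_ideal R A. Qed.

Lemma central_lin (a : R[i]) x y : K x -> K y -> T (a *: x + y) = a *: T x + T y.
Proof. by case: hT => _ h _; exact: h. Qed.

Lemma central0 : T 0 = 0.
Proof.
have K0 : K 0 by case: ped_subspace.
by have := central_lin (-1) K0 K0; rewrite scaler0 addr0 scaleN1r addNr.
Qed.

Lemma centralZ (a : R[i]) x : K x -> T (a *: x) = a *: T x.
Proof.
move=> Kx; have K0 : K 0 by case: ped_subspace.
by have := central_lin a Kx K0; rewrite central0 !addr0.
Qed.

(** The axiom covers d in K only. Multiplying both sides by c in K reduces a general d to it,
    because c and d c both lie in K and K is dense. *)
Lemma central_mulr x d : K x -> T (x ** d) = T x ** d.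
Proof.
move=> Kx; case: hT => _ _ TM; apply/eqP; rewrite -subr_eq0; apply/eqP.
apply: (dense_left_faithful (@ped_dense R A)) => c Kc; rewrite cmulBl.
rewrite -(TM _ _ (ped_mulr d Kx) Kc) -!cmulA.
by rewrite (TM _ _ Kx (ped_mull d Kc)) subrr.
Qed.

(** The ideal N of the overview. The factor x ranges over all of A, which is possible because x d is
    in K. *)
Definition Tbounded d := K d /\ exists M : R, forall x, nrm (T (x ** d)) <= M * nrm x.

Lemma Tbounded_mulr d x : Tbounded d -> Tbounded (d ** x).
Proof.
move=> [Kd [M hM]]; split; first exact: ped_mulr.
exists (M * nrm x) => y; rewrite cmulA (central_mulr _ (ped_mull y Kd)).
apply: le_trans (nrmM _ _) _; have := ler_wpM2r (nrm_ge0 x) (hM y); lra.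
Qed.

Lemma Tbounded_mull d x : Tbounded d -> Tbounded (x ** d).
Proof.
move=> [Kd [M hM]]; split; first exact: ped_mull.
exists (`|M| * nrm x) => y; rewrite cmulA; apply: le_trans (hM _) _.
have h : M * nrm (y ** x) <= `|M| * nrm (y ** x) by rewrite ler_wpM2r ?nrm_ge0 // ler_norm.
by have := ler_wpM2l (normr_ge0 M) (nrmM y x); lra.
Qed.

Lemma unbounded_large d (D M : R) : K d -> ~ Tbounded d -> 0 < D ->
  exists x, nrm x <= D /\ M < nrm (T (x ** d)).
Proof.
move=> Kd hd D0; have [x hx] : exists x, `|M| / D * nrm x < nrm (T (x ** d)).
  apply: contrapT => h; apply: hd; split=> //; exists (`|M| / D) => x.
  by rewrite leNgt; apply/negP => h'; apply: h; exists x.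
have x0 : 0 < nrm x.
  by apply: nrm_gt0 => e; move: hx; rewrite e cmul0l central0 nrm0 mulr0 ltxx.
pose a : R := D / nrm x; have a0 : 0 < a by rewrite divr_gt0.
exists (a%:C *: x); split; first by rewrite nrmZr gtr0_norm // /a divfK ?gt_eqF.
rewrite cscalel (centralZ _ (ped_mull x Kd)) nrmZr gtr0_norm //.
have := hx; rewrite -(ltr_pM2l a0) (_ : a * _ = `|M|); last first.
  by rewrite /a; field; rewrite !gt_eqF.
exact: le_lt_trans (ler_norm M).
Qed.

(* Gliding hump: if every c_n^2 is unbounded, some y = sum x_k c_k makes
   T(y) c_n = T(x_n c_n^2) too large; y is in K because y g = y. *)
Lemma orthogonal_bounded g (c : nat -> A) :
  (forall n, c n ** g = c n) -> (forall m n, m <> n -> c m ** c n = 0) ->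
  exists n, Tbounded (c n ** c n).
Proof.
move=> cg orth; apply: contrapT => nb.
have Kc n : K (c n) by exact: pedersen_unit (cg n).
have Kcc n : K (c n ** c n) := ped_mull (c n) (Kc n).
have c1 n : 0 < nrm (c n) + 1 by have := nrm_ge0 (c n); lra.
have p2 n : (0 : R) < 2 ^+ n by rewrite exprn_gt0.
(* The terms x_n c_n have norm at most 2^(-n-1). The factor |c n| + 1 in the lower bound outweighs
   the |c n| in |T y c_n| <= |T y| |c n|, and it is safe to divide by. *)
have /choice[x hx] n : exists x, nrm x <= (1 / 2 ^+ n.+1) / (nrm (c n) + 1) /\
    n%:R * (nrm (c n) + 1) < nrm (T (x ** (c n ** c n))).
  apply: unbounded_large => //; first by move=> h; apply: nb; exists n.
  by rewrite !divr_gt0.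
pose s n := \sum_(k < n) x k ** c k.
pose rho n : R := 1 / 2 ^+ n.
have rhoS n : rho n = rho n.+1 + rho n.+1.
  by rewrite /rho exprS; field; rewrite gt_eqF.
have rho0 n : 0 <= rho n by rewrite divr_ge0 ?(ltW (p2 _)).
have [y hy] : exists y, forall n, nrm (y - s n) <= rho n.
  apply: lim_telescope => [n|//|e e0]; last exact: inv_pow2_small.
  rewrite /s big_ord_recr addrC addKr rhoS addrK.
  apply: le_trans (nrmM _ _) _; have [h _] := hx n; move: h.
  rewrite ler_pdivlMr // -/(rho n.+1).
  by have := nrm_ge0 (x n); lra.
have sg n : s n ** g = s n.
  by rewrite /s cmul_suml; apply: eq_bigr => k _; rewrite -cmulA cg.
have yg : y ** g = y.
  apply/eqP; rewrite -subr_eq0; apply/eqP.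
  apply: (@nrm_eq0_lin _ _ (nrm g + 1)) => e e0; have [n hn] := inv_pow2_small 1 e0.
  have -> : y ** g - y = (y - s n) ** g - (y - s n) by rewrite cmulBl sg; zmod.
  apply: le_trans (ler_nrmB _ _) _; have := nrmM (y - s n) g.
  have := ler_wpM2r (nrm_ge0 g) (le_trans (hy n) hn); have := le_trans (hy n) hn; lra.
have yc n : y ** c n = x n ** (c n ** c n).
  apply/eqP; rewrite -subr_eq0; apply/eqP.
  apply: (@nrm_eq0_lin _ _ (nrm (c n))) => e e0; have [m hm] := inv_pow2_small 1 e0.
  have sc k : s (n.+1 + k)%N ** c n = x n ** (c n ** c n).
    elim: k => [|k ih].
      rewrite addn0 /s big_ord_recr cmulDl cmul_suml big1 ?add0r ?cmulA //.
      by move=> i _; rewrite -cmulA orth ?cmul0r //=; have := ltn_ord i; lia.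
    have nk : (n.+1 + k)%N <> n by lia.
    rewrite addnS /s big_ord_recr cmulDl -/(s (n.+1 + k)%N) ih /=.
    by rewrite -[X in _ + X]cmulA (orth _ _ nk) cmul0r addr0.
  have rmono k : rho (m + k)%N <= rho m.
    by elim: k => [|k]; [rewrite addn0|rewrite addnS rhoS; have := rho0 (m + k).+1; lra].
  have -> : y ** c n - x n ** (c n ** c n) = (y - s (n.+1 + m)%N) ** c n.
    by rewrite cmulBl sc.
  apply: le_trans (nrmM _ _) _; rewrite mulrC ler_wpM2l ?nrm_ge0 //.
  apply: le_trans (hy _) (le_trans _ hm); rewrite addnC; exact: rmono.
have Ky := pedersen_unit yg.
have key n : n%:R <= nrm (T y).
  have [_ h] := hx n; rewrite -yc (central_mulr _ Ky) in h.
  have h2 := nrmM (T y) (c n); have h3 := nrm_ge0 (T y).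
  rewrite -(ler_pM2r (c1 n)); lra.
have := key (Num.bound (nrm (T y))).
by rewrite leNgt archi_boundP // nrm_ge0.
Qed.

Definition bounded_absorbed g d := Tbounded d /\ g ** d = d.

(** Pointwise bounds come from g d = d: T(x d) = T(x g) d has norm at most |T(x g)| |d|. Uniform
    boundedness over the normalized d does the rest. *)
Lemma bounded_uniformly g : K g -> exists2 M : R, 0 <= M &
  forall d x, bounded_absorbed g d -> nrm (T (x ** d)) <= M * nrm x * nrm d.
Proof.
move=> Kg; pose J := {d : A | bounded_absorbed g d}.
(* For d = 0 the inverse norm is 0 by convention, and [F] is the zero map. *)
pose F (j : J) x := ((nrm (sval j))^-1)%:C *: T (x ** sval j).
have Kj (j : J) x : K (x ** sval j).
  by case: j => d /= [[Kd _] _]; exact: ped_mull.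
have [|||M hM] := @uniform_boundedness R A J F.
- move=> j a x y; rewrite /F cmulDl cscalel (central_lin _ (Kj j x) (Kj j y)).
  by rewrite scalerDr !scalerA mulrC.
- move=> j; case: (svalP j) => [[_ [B hB]] _]; exists ((nrm (sval j))^-1 * B) => x.
  by rewrite /F nrmZr ger0_norm ?invr_ge0 ?nrm_ge0 // -mulrA ler_wpM2l ?invr_ge0 ?nrm_ge0.
- move=> x; exists (nrm (T (x ** g))) => j.
  rewrite /F nrmZr ger0_norm ?invr_ge0 ?nrm_ge0 //.
  case: (svalP j) => _ gd; rewrite -{2}gd cmulA (central_mulr _ (ped_mull x Kg)).
  have [->|j0] := eqVneq (nrm (sval j)) 0; first by rewrite invr0 mul0r nrm_ge0.
  have jp : 0 < nrm (sval j) by rewrite lt_neqAle eq_sym j0 nrm_ge0.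
  by rewrite mulrC ler_pdivrMr //; exact: nrmM.
exists `|M| => // d x hd.
have [/nrm0_eq0 ->|d0] := eqVneq (nrm d) 0.
  by rewrite cmul0r central0 nrm0 mulr0.
have dp : 0 < nrm d by rewrite lt_neqAle eq_sym d0 nrm_ge0.
have := hM (exist _ d hd) x; rewrite /F /= nrmZr gtr0_norm ?invr_gt0 //.
rewrite mulrC ler_pdivrMr // => h; apply: le_trans h _.
by rewrite ler_wpM2r ?nrm_ge0 // ler_wpM2r ?nrm_ge0 // ler_norm.
Qed.

Section Annihilator.
Variable g : A.
Hypothesis gsa : star g = g.

Definition bounded_annihilator c := [/\ g ** c = c, c ** g = c &
  forall d, bounded_absorbed g d -> c ** d = 0].

Lemma annihilator_corner c x : bounded_annihilator c -> corner c x ->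
  bounded_annihilator x.
Proof.
move=> [gc cg h] [y ->]; split; first by rewrite !cmulA gc.
  by rewrite -!cmulA cg.
by move=> d hd; rewrite -cmulA (h d hd) cmul0r.
Qed.

(** d = c* c lies in N and g d = d, so c d = 0; hence d^2 = 0 and d = 0. *)
Lemma annihilator_unbounded c : bounded_annihilator c -> Tbounded c -> c = 0.
Proof.
move=> [gc cg h] bc; apply: star_mul_eq0.
apply: (sa_sqr_eq0 (mul_star_sa c)); rewrite -cmulA; apply: (etrans _ (cmul0r (star c))).
congr (_ ** _); apply: h; split; first exact: Tbounded_mull _ bc.
by rewrite !cmulA -{1}gsa -starM cg.
Qed.

(** Since b^2 is not in N, some z = T(x b^2) is more than twice as large as the uniform bound on
    bounded absorbed elements permits. That bound controls z on [topcut z ** d], so the top cut of z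
    annihilates every such d. *)
Lemma annihilator_neq0 b : K g -> star b = b -> b ** g = b ->
  ~ Tbounded (b ** b) ->
  exists c, [/\ bounded_annihilator c, star c = c & c <> 0].
Proof.
move=> Kg bsa bg nb; have gb := mul_sa_comm bsa gsa bg.
have [M M0 hM] := bounded_uniformly Kg.
have Kb := pedersen_unit bg.
have Kbb : K (b ** b) := ped_mull b Kb.
have [x hx] : exists x, 2 * (M * nrm x * nrm (b ** b)) < nrm (T (x ** (b ** b))).
  apply: contrapT => h; apply: nb; split=> //.
  exists (2 * M * nrm (b ** b)) => x; rewrite leNgt; apply/negP => h'.
  apply: h; exists x.
  by rewrite (_ : 2 * _ = 2 * M * nrm (b ** b) * nrm x) //; ring.
rewrite cmulA (central_mulr _ (ped_mull x Kb)) in hx.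
have [z zE] : exists z, z = T (x ** b) ** b by exists (T (x ** b) ** b).
rewrite -zE in hx.
have z0 : 0 < nrm z.
  by apply: le_lt_trans hx; rewrite !mulr_ge0 ?nrm_ge0.
have wsa := topcut_sa z0; have [m mE] := topcut_factor z0.
have zg : z ** g = z by rewrite zE -cmulA bg.
have wg : topcut z ** g = topcut z by rewrite mE -cmulA zg.
have gw := mul_sa_comm wsa gsa wg.
exists (topcut z); split=> //; last exact: topcut_neq0.
split=> // d [bd gd]; apply: (topcut_kill z0 hx).
have b2 : bounded_absorbed g (b ** b ** (topcut z ** d)).
  by split; [exact/Tbounded_mull/Tbounded_mull|rewrite !cmulA gb].
rewrite {1}zE -(central_mulr b (ped_mull x Kb)) -(central_mulr _ (ped_mulr b (ped_mull x Kb))).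
rewrite -!cmulA (cmulA b b); apply: le_trans (hM _ x b2) _.
have Mx : 0 <= M * nrm x by rewrite mulr_ge0 ?nrm_ge0.
by have := ler_wpM2l Mx (nrmM (b ** b) (topcut z ** d)); rewrite mulrA.
Qed.

Lemma annihilator_unsplittable c0 :
  bounded_annihilator c0 -> star c0 = c0 -> c0 <> 0 ->
  exists c, [/\ bounded_annihilator c, star c = c, c <> 0 & unsplittable c].
Proof.
move=> h0 s0 n0; apply: contrapT => nc.
pose good c := [/\ bounded_annihilator c, star c = c & c <> 0].
have /choice[q hq] c : exists q : A * A, good c ->
    [/\ corner c q.1, corner c q.2, good q.1, good q.2 & q.1 ** q.2 = 0].
  have [hc|hc] := pselect (good c); last by exists (0, 0).
  apply: contrapT => h; apply: nc; exists c; case: (hc) => ac sc cn; split=> //.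
  move=> x y cx cy sx sy xy; apply: contrapT => /not_orP[x0 y0].
  by apply: h; exists (x, y) => _; split=> //; split=> //; apply: annihilator_corner ac _.
pose v n := iter n (fun c => (q c).2) c0.
have vgood n : good (v n).
  by elim: n => [|n ih]; [|case: (hq _ ih)].
pose u n := (q (v n)).1.
have ugood n : good (u n) by case: (hq _ (vgood n)).
have uv m k : u m ** v (m + k).+1 = 0.
  elim: k => [|k ih]; first by rewrite addn0; case: (hq _ (vgood m)).
  rewrite addnS; have [_ [y hy] _ _ _] := hq _ (vgood (m + k).+1).
  by rewrite [v _]hy !cmulA ih !cmul0l.
have uu m n : (m < n)%N -> u m ** u n = 0.
  move=> mn; have [[y hy] _ _ _ _] := hq _ (vgood n).
  have := uv m (n - m.+1)%N; rewrite -addSn subnKC // => h.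
  by rewrite [u n]hy !cmulA h !cmul0l.
have orth m n : m <> n -> u m ** u n = 0.
  move=> mn; have [|nm] := ltnP m n; first exact: uu.
  have [_ sm _] := ugood m; have [_ sn _] := ugood n.
  rewrite -[LHS]starK starM sm sn uu ?star0 //; lia.
have ug n : u n ** g = u n by case: (ugood n) => [[_ ? _] _ _].
have [n hn] := orthogonal_bounded ug orth.
have [an sn un] := ugood n; apply: un; apply: (sa_sqr_eq0 sn).
apply: annihilator_unbounded hn.
case: an => gu ug' h; split; [by rewrite cmulA gu|by rewrite -cmulA ug'|].
by move=> d hd; rewrite -cmulA (h d hd) cmul0r.
Qed.

Lemma unbounded_minproj b : K g -> star b = b -> b ** g = b ->
  ~ Tbounded (b ** b) ->
  exists p, [/\ minproj p, ~ Tbounded p & g ** p = p].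
Proof.
move=> Kg bsa bg nb; have [c0 [h0 s0 n0]] := annihilator_neq0 Kg bsa bg nb.
have [c [hc sc cn cu]] := annihilator_unsplittable h0 s0 n0.
have [p pm cp] := unsplittable_minproj sc cn cu.
have hp := annihilator_corner hc cp; exists p; split=> //; last by case: hp.
by move=> /(annihilator_unbounded hp) p0; case: pm => _ /(_ p0).
Qed.

End Annihilator.

End Centralizer.

(** * Splitting off the unbounded minimal projections *)

Section Generated.
Context {R : realType} {A : cstarAlgType R}.
Implicit Types (x y z u v p t w : A) (I J S B : set A).

Lemma re_norm_ge0 (a : R[i]) : 0 <= complex.Re `|a|.
Proof. by rewrite -ler0c RRe_real ?ger0_real. Qed.

(** Finite sums of terms u p v, an ideal without any closure. A projection p in S is itself such a
    term, as p = p p p. *)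
Inductive gen S : A -> Prop :=
| gen_zero : gen S 0
| gen_step u p v x : S p -> gen S x -> gen S (u ** p ** v + x).

Lemma genD S x y : gen S x -> gen S y -> gen S (x + y).
Proof.
move=> + Sy; elim=> [|u p v z Sp _ ih]; first by rewrite add0r.
by rewrite -addrA; exact: gen_step.
Qed.

Lemma gen_mem S u p v : S p -> gen S (u ** p ** v).
Proof. by move=> Sp; rewrite -[_ ** v]addr0; apply: gen_step => //; exact: gen_zero. Qed.

Lemma genZ S (a : R[i]) x : gen S x -> gen S (a *: x).
Proof.
elim=> [|u p v z Sp _ ih]; first by rewrite scaler0; exact: gen_zero.
by rewrite scalerDr -!cscalel; exact: gen_step.
Qed.

Lemma gen_subspace S : linear_subspace (gen S).
Proof. by split=> [|a x y Sx Sy]; [exact: gen_zero|apply: genD => //; exact: genZ]. Qed.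

Lemma gen_ideal S : ideal_of [set: A] (gen S).
Proof.
split=> //; first exact: gen_subspace.
move=> b x _; elim=> [|u p v z Sp _ [ih1 ih2]].
  by rewrite cmul0l cmul0r; split; exact: gen_zero.
split; first by rewrite cmulDr !cmulA; exact: gen_step.
by rewrite cmulDl -(cmulA _ v); exact: gen_step.
Qed.

Lemma gen_sub S I : ideal_of [set: A] I -> S `<=` I -> gen S `<=` I.
Proof.
move=> hI SI x; elim=> [|u p v z Sp _ ih]; first by case: hI => _ [].
have [_ IL _] := hI; apply: subspaceD => //.
by apply: (idealMr hI) => //; apply: (idealMl hI) => //; exact: SI.
Qed.

Lemma gen_star S x : (forall p, S p -> star p = p) -> gen S x -> gen S (star x).
Proof.
move=> Ssa; elim=> [|u p v z Sp _ ih]; first by rewrite star0; exact: gen_zero.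
by rewrite starD !starM (Ssa p Sp) cmulA; exact: gen_step.
Qed.

Lemma closure_ideal I : ideal_of [set: A] I -> closed_ideal_of [set: A] (closure I).
Proof.
move=> hI; have [_ IL _] := hI; split; last exact: closed_closure.
split=> //; first split.
- by apply: subset_closure; case: IL.
- move=> a x y /closure_nrmP cx /closure_nrmP cy; apply/closure_nrmP => e e0.
  pose c := complex.Re `|a| + 1.
  have c0 : 0 < c by have := re_norm_ge0 a; rewrite /c; lra.
  have [x' Ix hx] := cx _ (divr_gt0 e0 (mulr_gt0 (ltr0Sn R 1) c0)).
  have [y' Iy hy] := cy _ (divr_gt0 e0 (ltr0Sn _ 1)).
  exists (a *: x' + y'); first by case: IL => _; exact.
  rewrite opprD addrACA -scalerBr; apply: le_trans (ler_nrmD _ _) _.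
  rewrite nrmZ; have h : c * nrm (x - x') <= e / 2.
    rewrite mulrC -ler_pdivlMr //; apply: le_trans hx _.
    by rewrite invfM mulrA.
  have := nrm_ge0 (x - x'); rewrite /c in h; lra.
- move=> b x _ /closure_nrmP cx.
  have b0 : 0 < nrm b + 1 by have := nrm_ge0 b; lra.
  split; apply/closure_nrmP => e e0.
    have [y Iy hy] := cx _ (divr_gt0 e0 b0); exists (b ** y); first exact: (idealMl hI).
    rewrite -cmulBr; apply: le_trans (nrmM _ _) _.
    by move: hy; rewrite ler_pdivlMr //; have := nrm_ge0 (x - y); lra.
  have [y Iy hy] := cx _ (divr_gt0 e0 b0); exists (y ** b); first exact: (idealMr hI).
  rewrite -cmulBl; apply: le_trans (nrmM _ _) _.
  by move: hy; rewrite ler_pdivlMr //; have := nrm_ge0 (x - y); lra.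
Qed.

Lemma closure_star S x : (forall y, S y -> S (star y)) -> closure S x ->
  closure S (star x).
Proof.
move=> hS /closure_nrmP cx; apply/closure_nrmP => e /cx[y Sy hy].
by exists (star y); [exact: hS|rewrite -starB nrm_star].
Qed.

Lemma nilpotent_eq0 t : (forall y, t ** y ** t = 0) -> t = 0.
Proof.
move=> h; apply: star_mul_eq0; apply: (sa_sqr_eq0 (mul_star_sa t)).
by rewrite -cmulA (cmulA t) h cmul0r.
Qed.

(** Semiprimeness: t = y v x satisfies t w t = y v (x w y) v x = 0 for all w, so t = 0. *)
Lemma annihilate_sym x y : (forall v, x ** v ** y = 0) -> forall v, y ** v ** x = 0.
Proof.
move=> h v; apply: nilpotent_eq0 => w.
by rewrite !cmulA -(cmulA _ x w) -(cmulA _ (x ** w) y) h cmul0r !cmul0l.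
Qed.

(** The middle factor v makes this an ideal on both sides, whatever S is. *)
Definition annihilator_of S : set A :=
  [set x | forall p v, S p -> p ** v ** x = 0].

Lemma annihilator_right S x p v : annihilator_of S x -> S p -> x ** v ** p = 0.
Proof. by move=> hx Sp; apply: annihilate_sym => w; exact: hx. Qed.

Lemma annihilator_closed_ideal S : closed_ideal_of [set: A] (annihilator_of S).
Proof.
split; first split=> //; first split.
- by move=> p v _; rewrite cmul0r.
- by move=> a x y hx hy p v Sp; rewrite cmulDr cscaler hx // hy // scaler0 addr0.
- move=> b x _ hx; split=> p v Sp; first by rewrite cmulA -(cmulA p) hx.
  by rewrite cmulA hx // cmul0l.
apply/closed_nrmP => x cx p v Sp.
apply: (@nrm_eq0_lin _ _ (nrm (p ** v))) => e e0; have [y hy xy] := cx e e0.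
have -> : p ** v ** x = p ** v ** (x - y) by rewrite cmulBr hy // subr0.
by apply: le_trans (nrmM _ _) _; rewrite ler_wpM2l ?nrm_ge0.
Qed.

Lemma orth_norm x y : star x ** y = 0 -> nrm x <= nrm (x + y).
Proof.
move=> xy; have [->|x0] := eqVneq (nrm x) 0; first exact: nrm_ge0.
have xp : 0 < nrm x by rewrite lt_neqAle eq_sym x0 nrm_ge0.
rewrite -(ler_pM2l xp) -expr2 -nrm_star_mul.
have -> : star x ** x = star x ** (x + y) by rewrite cmulDr xy addr0.
by apply: le_trans (nrmM _ _) _; rewrite nrm_star.
Qed.

(** Orthogonality gives |x| <= |x + y|, so the I-parts of approximations of z form a Cauchy
    sequence. Only I has to be closed; the remainder is caught in the closure of J. *)
Lemma orth_decomposition I J z : closed I -> linear_subspace I ->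
  linear_subspace J -> (forall x y, I x -> J y -> star x ** y = 0) ->
  (forall e : R, 0 < e -> exists x y, [/\ I x, J y & nrm (z - (x + y)) <= e]) ->
  exists x, I x /\ closure J (z - x).
Proof.
move=> /closed_nrmP cI IL JL orth dz.
have p2 n : (0 : R) < (2 ^+ n)^-1 by rewrite invr_gt0 exprn_gt0.
have /choice[q hq] n : exists q : A * A,
    [/\ I q.1, J q.2 & nrm (z - (q.1 + q.2)) <= (2 ^+ n)^-1].
  by have [x [y h]] := dz _ (p2 n); exists (x, y).
pose rho n : R := 3 / 2 ^+ n.
have [|||l hl] := @lim_telescope R A (fun n => (q n).1) rho.
- move=> n; have [I1 J1 h1] := hq n; have [I2 J2 h2] := hq n.+1.
  have -> : rho n - rho n.+1 = (2 ^+ n)^-1 + (2 ^+ n.+1)^-1.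
    by rewrite /rho exprS; field; rewrite gt_eqF // exprn_gt0.
  apply: le_trans (orth_norm (y := (q n.+1).2 - (q n).2) _) _.
    by apply: orth; apply: subspaceB.
  have -> : (q n.+1).1 - (q n).1 + ((q n.+1).2 - (q n).2) =
    (z - ((q n).1 + (q n).2)) - (z - ((q n.+1).1 + (q n.+1).2)) by zmod.
  by apply: le_trans (ler_nrmB _ _) _; rewrite lerD.
- by move=> n; rewrite divr_ge0 // exprn_ge0.
- by move=> e; exact: inv_pow2_small.
exists l; split.
  apply: cI => e e0; have [n hn] := inv_pow2_small 3 e0.
  by exists (q n).1; [case: (hq n)|exact: le_trans (hl n) hn].
apply/closure_nrmP => e e0; have [n hn] := inv_pow2_small 4 e0.
have [_ Jq h] := hq n; exists (q n).2 => //.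
have -> : z - l - (q n).2 = (z - ((q n).1 + (q n).2)) - (l - (q n).1) by zmod.
apply: le_trans (ler_nrmB _ _) _; have := hl n; rewrite /rho; lra.
Qed.

End Generated.

Section EquivalentProjections.
Context {R : realType} {A : cstarAlgType R}.
Implicit Types (x y z u v p q t w : A).

Lemma minproj_real p y : minproj p -> p ** y = y -> y <> 0 ->
  exists a : R, a != 0 /\ y ** star y = a%:C *: p.
Proof.
move=> [[psa pp] p0 hp] py y0.
have yp : star y ** p = star y by rewrite -{1}psa -starM py.
have [a aE] := hp (y ** star y); rewrite cmulA py -cmulA yp in aE.
have aa : a = (a^*)%C.
  have : (a - (a^*)%C) *: p = 0.
    by rewrite scalerBl -{2}psa -starZ -aE starM starK subrr.
  by move=> /eqP; rewrite scaler_eq0 subr_eq0 => /orP[/eqP//|/eqP].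
have [r ar] : exists r : R, a = r%:C.
  move: aa; case: a {aE} => r i [] /= /eqP; rewrite -addr_eq0 -mulr2n mulrn_eq0 /=.
  by move=> /eqP ->; exists r.
exists r; rewrite -ar; split=> //; apply/eqP => r0; apply: y0.
rewrite -[y]starK; suff -> : star y = 0 by rewrite star0.
by apply: star_mul_eq0; rewrite starK aE ar r0 scale0r.
Qed.

(** Murray-von Neumann equivalence: y y* = a p makes y a multiple of a partial isometry. Dividing y*
    y by a gives the other projection without a square root. *)
Lemma minproj_transport p y : minproj p -> p ** y = y -> y <> 0 ->
  exists c : R[i], let p' := c *: (star y ** y) in
    minproj p' /\ exists u w, p = u ** p' ** w.
Proof.
move=> pm py y0; have [a [a0 aE]] := minproj_real pm py y0.
have [[psa pp] p0 hp] := pm.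
have ac0 : a%:C != 0 :> R[i] by rewrite eq_complex /= eqxx andbT.
have yp : star y ** p = star y by rewrite -{1}psa -starM py.
have yyy : star y ** y ** star y = a%:C *: star y.
  by rewrite -cmulA aE cscaler yp.
exists (a^-1)%:C; set c := (a^-1)%:C; set p' := c *: _ => /=.
have cE : c = (a%:C)^-1 by rewrite /c fmorphV.
have yp' : y ** p' = y.
  by rewrite /p' cscaler cmulA aE cscalel py scalerA cE mulVf ?scale1r.
split; last first.
  exists (c *: y), (star y).
  by rewrite cscalel yp' cscalel aE scalerA cE mulVf ?scale1r.
split.
- split; first by rewrite /p' /c starZr mul_star_sa.
  by rewrite {1}/p' cscalel -cmulA yp'.
- by move=> e; apply: y0; rewrite -yp' e cmul0r.
- move=> x; have [b bE] := hp (y ** x ** star y).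
  have e : p' ** x ** p' = (c * c) *: (star y ** (y ** x ** star y) ** y).
    by rewrite /p' !(cscalel, cscaler) scalerA !cmulA.
  exists (c * b); rewrite e.
  have -> : y ** x ** star y = b *: p.
    by rewrite -bE -!cmulA yp !cmulA py.
  by rewrite cscaler cscalel yp /p' !scalerA; congr (_ *: _); rewrite mulrAC mulrC mulrA.
Qed.

End EquivalentProjections.

Section Splitting.
Context {R : realType} {A : cstarAlgType R}.
Implicit Types (x y z u v p q t w g d : A).
Notation K := (pedersen_ideal [set: A]).
Variable T : A -> A.
Hypothesis hT : left_centralizer K T.

Definition unbounded_proj p := minproj p /\ ~ Tbounded T p.

Notation P := [set p | unbounded_proj p].

(** The summand A_1; its complement A_0 is [bounded_part]. *)
Definition dual_part : set A := closure (gen P).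

Definition bounded_part : set A := annihilator_of P.

Lemma unbounded_proj_sa p : P p -> star p = p.
Proof. by move=> [[[]]]. Qed.

Lemma unbounded_transport p y : P p -> p ** y = y -> y <> 0 ->
  exists c : R[i], P (c *: (star y ** y)).
Proof.
move=> [pm pu] py y0; have [c [cm [u [w uw]]]] := minproj_transport pm py y0.
exists c; split=> // hb; apply: pu; rewrite uw.
by apply: Tbounded_mulr => //; exact: Tbounded_mull.
Qed.

Lemma dual_bounded_orth x y : bounded_part x -> gen P y -> star x ** y = 0.
Proof.
move=> hx; elim=> [|u p v z Pp _ ih]; first by rewrite cmul0r.
rewrite cmulDr ih addr0 !cmulA.
have := hx p (star u) Pp => /(congr1 star).
rewrite !starM starK (unbounded_proj_sa Pp) star0 cmulA => ->; exact: cmul0l.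
Qed.

Definition absorbed_proj g q := [/\ is_proj q, gen P q & q ** g = q].

(** Adding projections one at a time must stop: an endless orthogonal sequence with common unit g
    would, by [orthogonal_bounded], contain some p = p^2 in N. *)
Lemma maximal_absorbed_proj g : exists2 q, absorbed_proj g q &
  forall p, P p -> p ** q = 0 -> p ** g <> p.
Proof.
apply: contrapT => h.
have /choice[f hf] q : exists p, absorbed_proj g q -> [/\ P p, p ** q = 0 & p ** g = p].
  have [hq|nq] := pselect (absorbed_proj g q); last by exists 0.
  apply: contrapT => h'; apply: h; exists q => // p Pp pq pg.
  by apply: h'; exists p.
pose s := fix s n := if n is n.+1 then s n + f (s n) else 0 : A.
have sP n : absorbed_proj g (s n).
  elim: n => [|n ih].
    split; [|exact: gen_zero|exact: cmul0l].
    by split; [exact: star0|exact: cmul0l].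
  have [Pf fs fg] := hf _ ih; have [[ssa ss] sg sG] := ih.
  have [[[fsa ff] _ _] _] := Pf.
  split; rewrite /=; last by rewrite cmulDl sG fg.
    split; first by rewrite starD ssa fsa.
    have sf : s n ** f (s n) = 0.
      by rewrite -[LHS]starK starM ssa fsa fs star0.
    by rewrite cmulDl !cmulDr ss ff fs sf; zmod.
  apply: genD => //; rewrite -ff -{1}ff; exact: gen_mem.
pose u n := f (s n).
have uP n : [/\ P (u n), u n ** s n = 0 & u n ** g = u n] by exact: hf.
have su m k : s (m + k).+1 ** u m = u m.
  elim: k => [|k ih].
    have [Pu us _] := uP m; have [[[usa uu] _ _] _] := Pu.
    have [[ssa _] _ _] := sP m.
    have su0 : s m ** u m = 0 by rewrite -[LHS]starK starM ssa usa us star0.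
    by rewrite addn0 /= cmulDl su0 add0r.
  rewrite addnS [s _.+1]/= cmulDl ih -{2}ih cmulA -/(u _).
  by have [_ -> _] := uP (m + k).+1; rewrite cmul0l addr0.
have uu m n : (m < n)%N -> u n ** u m = 0.
  move=> mn; have := su m (n - m.+1)%N; rewrite -addSn subnKC // => <-.
  by rewrite cmulA; have [_ -> _] := uP n; rewrite cmul0l.
have usa n : star (u n) = u n by have [/unbounded_proj_sa] := uP n.
have orth m n : m <> n -> u m ** u n = 0.
  move=> mn; have [nm|] := ltnP n m; first exact: uu.
  by move=> nm; rewrite -[LHS]starK starM !usa uu ?star0 //; lia.
have ug n : u n ** g = u n by have [] := uP n.
have [n] := orthogonal_bounded hT ug orth.
by have [[[[_ ->] _ _] nb] _ _] := uP n.
Qed.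

Lemma decompose_with_unit a g : star g = g -> a ** g = a ->
  exists2 b, gen P b & bounded_part (a - b).
Proof.
move=> gsa ag; have [q [[qsa qq] Gq qg] qmax] := maximal_absorbed_proj g.
exists (a ** q); first by apply: (idealMl (gen_ideal _)).
move=> p v Pp; apply: contrapT => y0; set y := p ** v ** _ in y0.
have py : p ** y = y by have [[[_ pp] _ _] _] := Pp; rewrite /y !cmulA pp.
have [c Pc] := unbounded_transport Pp py y0.
have yq : y ** q = 0 by rewrite /y -cmulA cmulBl -(cmulA a) qq subrr cmul0r.
have yg : y ** g = y by rewrite /y -cmulA cmulBl -(cmulA a) qg ag.
apply: (qmax _ Pc); first by rewrite cscalel -cmulA yq cmul0r scaler0.
by rewrite cscalel -cmulA yg.
Qed.

Lemma bounded_closed_ideal : closed_ideal_of [set: A] bounded_part.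
Proof. exact: annihilator_closed_ideal. Qed.

Lemma dual_closed_ideal : closed_ideal_of [set: A] dual_part.
Proof. exact/closure_ideal/gen_ideal. Qed.

Lemma dual_bounded_mul x y : bounded_part x -> dual_part y -> star x ** y = 0.
Proof.
move=> hx /closure_nrmP hy; apply: (@nrm_eq0_lin _ _ (nrm (star x))) => e e0.
have [z Gz yz] := hy e e0.
have -> : star x ** y = star x ** (y - z).
  by rewrite cmulBr (dual_bounded_orth hx Gz) subr0.
by apply: le_trans (nrmM _ _) _; rewrite ler_wpM2l ?nrm_ge0.
Qed.

Lemma splitting : direct_sum_decomposition bounded_part dual_part.
Proof.
have [hb cb] := bounded_closed_ideal; have [hd cd] := dual_closed_ideal.
have [_ bL _] := hb; have [_ dL _] := hd.
split; [exact: bounded_closed_ideal|exact: dual_closed_ideal| |].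
  apply/seteqP; split=> [x [bx dx]|x ->]; last by split; [case: bL|case: dL].
  by apply: star_mul_eq0; exact: dual_bounded_mul.
(* The second summand enters as the algebraic ideal [gen P], where [decompose_with_unit] produces
   it; the closure in the conclusion is [dual_part]. *)
move=> x; have [||e e0|x0 [b0 d1]] := @orth_decomposition R A bounded_part (gen P) x cb bL.
- exact: gen_subspace.
- exact: dual_bounded_orth.
- have [s s0 hs] := approx_right_cut x e0.
  have rs : 0 < s / 2 < s by apply/andP; split; lra.
  have hsa := mul_star_sa x; have [kg _] := cut_has_unit hsa rs.
  have gsa : star (cut (star x ** x) (s / 2 / 2) (s / 2)) = cut (star x ** x) (s / 2 / 2) (s / 2).
    by apply: cut_sa => //; apply/andP; split; lra.
  have ag : x ** cut (star x ** x) (s / 2) s ** cut (star x ** x) (s / 2 / 2) (s / 2) =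
      x ** cut (star x ** x) (s / 2) s by rewrite -cmulA kg.
  have [b Gb hb'] := decompose_with_unit gsa ag.
  exists (x ** cut (star x ** x) (s / 2) s - b), b; split=> //.
  by rewrite subrK; exact: hs.
- by exists x0, (x - x0); split=> //; rewrite addrC subrK.
Qed.

End Splitting.

(** * Local boundedness *)

Section LocalBoundedness.
Context {R : realType} {A : cstarAlgType R}.
Implicit Types (x y z u v p q t w g d f b : A) (I : set A).
Notation K := (pedersen_ideal [set: A]).

(** A dense ideal I of A meets A0 in a dense ideal of A0, because cuts lie in I. Conversely, for I
    dense in A0 the sum I + A1 is a dense ideal of A, and an element of A0 in it already lies in
    I. *)
Lemma direct_sum_pedersen (A0 A1 : set A) : direct_sum_decomposition A0 A1 ->
  pedersen_ideal A0 = K `&` A0.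
Proof.
move=> [[h0 c0] [h1 c1] h01 hsum]; have [_ L0 M0] := h0; have [_ L1 M1] := h1.
have z01 x : A0 x -> A1 x -> x = 0 by move=> x0 x1; have : (A0 `&` A1) x by []; rewrite h01.
apply/seteqP; split=> x hx.
  split=> [I [hI dI]|]; last first.
    apply: (hx A0); split; last exact: subset_closure.
    by split=> // b y _ A0y; split; [apply: (idealMl h0)|apply: (idealMr h0)].
  have [_ IL IM] := hI.
  suff : (I `&` A0) x by case.
  apply: hx; split.
    split=> [y []//|| b y A0b [Iy A0y]].
      split; first by split; [case: IL|case: L0].
      move=> a y z [Iy A0y] [Iz A0z]; split; first by case: IL => _; exact.
      by case: L0 => _; exact.
    have [i1 i2] := IM b y Logic.I Iy; have [i3 i4] := M0 b y Logic.I A0y.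
    by split; split.
  move=> y A0y; apply/closure_nrmP => e e0; have [s s0 hs] := approx_right_cut y e0.
  have rs : 0 < s / 2 < s by apply/andP; split; lra.
  exists (y ** cut (star y ** y) (s / 2) s); last exact: hs.
  split; last by apply: (idealMr h0).
  apply: (idealMl hI) => //; apply: (ped_cut (mul_star_sa y) rs); split=> //.
case: hx => Kx A0x I [hI dI]; have [IA0 IL IM] := hI.
pose S : set A := [set y | exists y0 y1, [/\ I y0, A1 y1 & y = y0 + y1]].
have [y0 [y1 [Iy0 A1y1 xE]]] : S x.
  apply: Kx; split; last first.
    move=> y _; have [y0 [y1 [A0y0 A1y1 ->]]] := hsum y.
    apply/closure_nrmP => e e0; have /closure_nrmP/(_ e e0)[w Iw hw] := dI y0 A0y0.
    exists (w + y1); first by exists w, y1.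
    by rewrite opprD addrACA subrr addr0.
  split=> //; first split.
  - by exists 0, 0; split; [case: IL|case: L1|rewrite addr0].
  - move=> a y z [y0 [y1 [i0 i1 ->]]] [z0 [z1 [j0 j1 ->]]].
    exists (a *: y0 + z0), (a *: y1 + z1); split; [by case: IL => _; exact|by case: L1 => _; exact|].
    by rewrite scalerDr addrACA.
  - move=> b y _ [y0 [y1 [i0 i1 ->]]]; have [b0 [b1 [bA0 bA1 ->]]] := hsum b.
    have m01 u v : A0 u -> A1 v -> u ** v = 0 /\ v ** u = 0.
      move=> hu hv; split; apply: z01.
      - exact: (idealMr h0).
      - exact: (idealMl h1).
      - exact: (idealMl h0).
      - exact: (idealMr h1).
    have [k1 k2] := m01 _ _ (IA0 _ i0) bA1; have [k3 k4] := m01 _ _ bA0 i1.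
    have [k5 k6] := IM b0 y0 bA0 i0.
    split.
      exists (b0 ** y0), (b1 ** y1); split=> //; first exact: (idealMl h1).
      by rewrite cmulDl !cmulDr k2 k3 addr0 add0r.
    exists (y0 ** b0), (y1 ** b1); split=> //; first exact: (idealMl h1).
    by rewrite cmulDl !cmulDr k1 k4 addr0 add0r.
suff y10 : y1 = 0 by rewrite xE y10 addr0.
apply: z01 => //; have -> : y1 = x - y0 by rewrite xE; zmod.
by apply: (subspaceB L0) => //; exact: IA0.
Qed.

(** The second annihilator of the ideal generated by f. It is closed, contains f, and what f
    annihilates on the right is annihilated by all of it. *)
Definition double_annihilator f : set A :=
  [set w | forall t, (forall v, f ** v ** t = 0) -> forall v, w ** v ** t = 0].

Lemma double_annihilator_closed_ideal f :
  closed_ideal_of [set: A] (double_annihilator f).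
Proof.
split; first split=> //; first split.
- by move=> t _ v; rewrite !cmul0l.
- by move=> a x y hx hy t ht v; rewrite !(cmulDl, cscalel) hx // hy // scaler0 addr0.
- move=> b x _ hx; split=> t ht v; last by rewrite -(cmulA x) hx.
  by rewrite -!cmulA (cmulA x) hx // cmul0r.
apply/closed_nrmP => x cx t ht v.
apply: (@nrm_eq0_lin _ _ (nrm (v ** t))) => e e0; have [y hy xy] := cx e e0.
have -> : x ** v ** t = (x - y) ** (v ** t).
  by rewrite cmulBl !cmulA (hy t ht v) subr0.
by apply: le_trans (nrmM _ _) _; rewrite mulrC ler_wpM2l ?nrm_ge0.
Qed.

Lemma double_annihilator_mem f : double_annihilator f f.
Proof. by []. Qed.

Variable T : A -> A.
Hypothesis hT : left_centralizer K T.

(* f b = f, so y f = (y f b) b and T is bounded on the elements y f; the cut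
   of |T y| transfers this bound to T y. *)
Lemma bounded_on_double_annihilator f b : star f = f -> f ** b = f ->
  Tbounded T (b ** b) -> bounded_on (K `&` double_annihilator f) T.
Proof.
move=> fsa fb [_ [M hM]].
suff key y : K y -> double_annihilator f y -> nrm (T y) <= 2 * (`|M| * nrm y).
  exists (2 * `|M|)%:C => y [Ky dy]; rewrite !nrmE -rmorphM /= lecR -mulrA.
  exact: key.
move=> Ky dy; rewrite leNgt; apply/negP; set z := T y => hz.
have z0 : 0 < nrm z by apply: le_lt_trans hz; rewrite !mulr_ge0 ?nrm_ge0.
have wsa := topcut_sa z0; set w := topcut z in wsa.
have wf v : w ** v ** f = 0.
  rewrite -cmulA; apply: (topcut_kill z0 hz); rewrite -/w.
  have -> : z ** (w ** (v ** f)) = T (y ** (w ** (v ** f)) ** (b ** b)).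
    rewrite /z -(central_mulr hT _ Ky); congr (T _).
    by rewrite -!cmulA (cmulA f) fb fb.
  apply: le_trans (hM _) _.
  apply: le_trans (ler_wpM2r (nrm_ge0 _) (ler_norm M)) _.
  by have := ler_wpM2l (normr_ge0 M) (nrmM y (w ** (v ** f))); rewrite mulrA.
(* w A f = 0 gives f A w = 0 by symmetry, hence y A w = 0 because y is in the second annihilator. *)
have zw : z ** (w ** w) = 0.
  rewrite /z -(central_mulr hT _ Ky) cmulA (dy w) ?central0 //.
  exact: annihilate_sym.
have ww : w ** w = 0.
  have := topcut_lower z0 w; rewrite -/w zw nrm0 mulr0 pmulr_rle0 //.
  exact: nrm_le0.
exact: (topcut_neq0 z0 (sa_sqr_eq0 wsa ww)).
Qed.

Lemma bounded_part_bounded g b : bounded_part T g -> K g -> star g = g ->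
  star b = b -> b ** g = b -> Tbounded T (b ** b).
Proof.
move=> hg Kg gsa bsa bg; apply: contrapT => nb.
have [p [pm pu gp]] := unbounded_minproj hT gsa Kg bsa bg nb.
have pp : bounded_part T p.
  by rewrite -gp; apply: (idealMr (bounded_closed_ideal T).1).
have := pp p p (conj pm pu); case: pm => [[_ e] p0 _].
by rewrite !e.
Qed.

Lemma bounded_part_cut x (r s : R) : bounded_part T x -> 0 < r < s ->
  bounded_part T (cut (star x ** x) r s).
Proof.
move=> hx rs; have [m ->] := cut_factor (mul_star_sa x) rs.
have hi := (bounded_closed_ideal T).1.
by do 2!apply: (idealMl hi) => //.
Qed.

Lemma locally_bounded_part : locally_bounded (bounded_part T) T.
Proof.
have KE := direct_sum_pedersen (splitting hT).
have [hi ci] := bounded_closed_ideal T; have [_ bL _] := hi.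
split.
  rewrite KE; split.
  - move=> x [Kx bx]; split; first by case: hT => h _ _; exact: h.
    (* On the other side the product can be moved into T: T(x) v p = T(x v p) = T(0). *)
    move=> p v Pp; apply: annihilate_sym => {}v.
    rewrite -!(central_mulr hT) //; last exact: ped_mulr.
    by rewrite (annihilator_right _ bx Pp) central0.
  - by move=> a x y [Kx _] [Ky _]; exact: central_lin.
  - by move=> x b [Kx _] _; exact: central_mulr.
(* All closed ideals on which T is bounded form the family, so only density of their sum remains to
   be shown. *)
pose good I := closed_ideal_of (bounded_part T) I /\
  bounded_on (pedersen_ideal (bounded_part T) `&` I) T.
exists {I : set A | good I}, (fun I : {I : set A | good I} => sval I); split.
- by move=> [I [? ?]].
- apply/seteqP; split=> x hx.
    apply/closure_nrmP => e e0; have [s s0 hs] := approx_right_cut x e0.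
    (* Three nested cuts of x* x: f at (s/2, s), b at (s/4, s/2), g at (s/8, s/4), with f b = f and
       b g = b. The unit g in A_0 puts b^2 in N, b bounds T on the second annihilator of f, and x f
       is close to x. *)
    have rs : 0 < s / 2 < s by apply/andP; split; lra.
    have rs2 : 0 < s / 2 / 2 < s / 2 by apply/andP; split; lra.
    have rs3 : 0 < s / 2 / 2 / 2 < s / 2 / 2 by apply/andP; split; lra.
    have hsa := mul_star_sa x; have hc := hs _ rs.
    have [fb _] := cut_has_unit hsa rs; have [bg _] := cut_has_unit hsa rs2.
    set f := cut _ (s / 2) s in fb hc.
    have fsa : star f = f by exact: cut_sa.
    have bb := bounded_part_bounded (bounded_part_cut hx rs3) (ped_cut hsa rs3)
      (cut_sa hsa rs3) (cut_sa hsa rs2) bg.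
    have hb := bounded_on_double_annihilator fsa fb bb.
    have [dI dc] := double_annihilator_closed_ideal f; have [_ dL dM] := dI.
    have gI : good (bounded_part T `&` double_annihilator f).
      split; last first.
        by case: hb => M hM; exists M => y [Ky [_ dy]]; apply: hM; split=> //; rewrite KE in Ky; case: Ky.
      split; last exact: closedI.
      split=> [y []//|| c y _ [by' dy]].
        split; first by split; [case: bL|case: dL].
        move=> a y z [y1 y2] [z1 z2].
        by split; [case: bL => _; exact|case: dL => _; exact].
      split; split; [exact: (idealMl hi)|exact: (idealMl dI)|exact: (idealMr hi)|exact: (idealMr dI)].
    have fx : bounded_part T f := bounded_part_cut hx rs.
    have xf : (bounded_part T `&` double_annihilator f) (x ** f).
      split; first exact: (idealMl hi).
      by apply: (idealMl dI) => //; exact: double_annihilator_mem.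
    exists (x ** f) => //.
    (* A family must select an element of every ideal in it, hence the default 0 where x f is not a
       member. *)
    exists [:: exist _ _ gI], (fun j => if pselect (sval j (x ** f)) then x ** f else 0).
      move=> [I gI'] /=; case: pselect => [h|nh]; first exact: h.
      by have [[[_ [I0 _] _] _] _] := gI'.
    by rewrite big_seq1; case: pselect => // -[].
  move/closed_nrmP: ci; apply => e e0; move/closure_nrmP: hx => /(_ e e0)[y [s [a ha ->]] hy].
  exists (\sum_(j <- s) a j) => //; apply: subspace_sum => // j.
  by have [[[h _ _] _] _] := svalP j; apply: h.
- by move=> [I [? ?]].
Qed.

End LocalBoundedness.

(** * Elementary blocks *)

Section ClosedSubspaces.
Context {R : realType} {A : cstarAlgType R}.

Record csubspace := CSubspace {
  carrier :> A -> Prop;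
  carrier_subspace : linear_subspace carrier;
  carrier_closed : closed carrier }.

Variable S : csubspace.

(** Membership is made boolean so that its proofs are irrelevant and equality is that of the
    underlying elements. *)
Record subsp := Subsp { subval : A; subvalP : `[< S subval >] }.

HB.instance Definition _ := [isSub for subval].
HB.instance Definition _ := [Choice of subsp by <:].

Lemma subvalS (x : subsp) : S (subval x).
Proof. exact/asboolP/subvalP. Qed.

Definition mksub x (Sx : S x) : subsp := Subsp (introT (asboolP _) Sx).

Lemma subval_inj (x y : subsp) : subval x = subval y -> x = y.
Proof. exact: val_inj. Qed.

Let SL := carrier_subspace S.

Definition sub_zero : subsp := mksub SL.1.
Definition sub_opp (x : subsp) := mksub (subspaceN SL (subvalS x)).
Definition sub_add (x y : subsp) := mksub (subspaceD SL (subvalS x) (subvalS y)).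
Definition sub_scale (a : R[i]) (x : subsp) := mksub (subspaceZ a SL (subvalS x)).

Fact sub_addA : associative sub_add.
Proof. by move=> x y z; apply: subval_inj; rewrite /= addrA. Qed.
Fact sub_addC : commutative sub_add.
Proof. by move=> x y; apply: subval_inj; rewrite /= addrC. Qed.
Fact sub_add0 : left_id sub_zero sub_add.
Proof. by move=> x; apply: subval_inj; rewrite /= add0r. Qed.
Fact sub_addN : left_inverse sub_zero sub_opp sub_add.
Proof. by move=> x; apply: subval_inj; rewrite /= addNr. Qed.

HB.instance Definition _ :=
  GRing.isZmodule.Build subsp sub_addA sub_addC sub_add0 sub_addN.

Fact sub_scaleA a b x : sub_scale a (sub_scale b x) = sub_scale (a * b) x.
Proof. by apply: subval_inj; rewrite /= scalerA. Qed.
Fact sub_scale1 : left_id 1 sub_scale.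
Proof. by move=> x; apply: subval_inj; rewrite /= scale1r. Qed.
Fact sub_scaleDr : right_distributive sub_scale +%R.
Proof. by move=> a x y; apply: subval_inj; rewrite /= scalerDr. Qed.
Fact sub_scaleDl x : {morph sub_scale^~ x : a b / a + b}.
Proof. by move=> a b; apply: subval_inj; rewrite /= scalerDl. Qed.

HB.instance Definition _ := GRing.Zmodule_isLmodule.Build R[i] subsp
  sub_scaleA sub_scale1 sub_scaleDr sub_scaleDl.

Definition sub_norm (x : subsp) : R[i] := `|subval x|.

Fact sub_normD x y : sub_norm (x + y) <= sub_norm x + sub_norm y.
Proof. exact: ler_normD. Qed.
Fact sub_normZ (a : R[i]) x : sub_norm (a *: x) = `|a| * sub_norm x.
Proof. exact: normrZ. Qed.
Fact sub_norm0_eq0 x : sub_norm x = 0 -> x = 0.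
Proof. by move=> /normr0_eq0 h; apply: subval_inj. Qed.

HB.instance Definition _ := Lmodule_isNormed.Build R[i] subsp
  sub_normD sub_normZ sub_norm0_eq0.

Fact sub_complete (F : set_system subsp) : ProperFilter F -> cauchy F -> cvg F.
Proof.
move=> PF cF; have /cauchyP cF' := cF.
have FF : ProperFilter (subval @ F) by exact: fmap_proper_filter.
have cG : cauchy (subval @ F).
  apply/cauchyP => e e0; have [x hx] := cF' e e0.
  exists (subval x); rewrite /= /fmap /=; apply: filterS hx => y.
  by rewrite -!ball_normE.
have /cvg_ex[l hl] : cvg (subval @ F) by apply/cauchy_cvgP.
have Sl : S l.
  have /closed_nrmP := @carrier_closed S; apply => e e0.
  have e0' : 0 < e%:C by rewrite ltcR.
  have /cvgrPdist_le/(_ _ e0') h := hl; have [x hx] := filter_ex h.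
  by exists (subval x); [exact: subvalS|rewrite -ler_nrmE].
apply/cvg_ex; exists (mksub Sl); apply/cvgrPdist_le => e e0.
by have /cvgrPdist_le/(_ _ e0) := hl.
Qed.

HB.instance Definition _ := Uniform_isComplete.Build subsp sub_complete.

End ClosedSubspaces.

Section ClosedIdeals.
Context {R : realType} {A : cstarAlgType R}.

Record cideal := CIdeal {
  cideal_sub :> @csubspace R A;
  cidealM : forall x y, cideal_sub x -> cideal_sub y -> cideal_sub (x ** y);
  cideal_star : forall x, cideal_sub x -> cideal_sub (star x) }.

Variable I : cideal.

Definition ialg := subsp I.

HB.instance Definition _ := CompleteNormedModule.copy ialg (subsp I).

Definition ialg_mul (x y : ialg) : ialg := mksub (cidealM (subvalS x) (subvalS y)).
Definition ialg_star (x : ialg) : ialg := mksub (cideal_star (subvalS x)).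

Fact ialg_mulA : associative ialg_mul.
Proof. by move=> x y z; apply: subval_inj; exact: cmulA. Qed.
Fact ialg_mulDl : left_distributive ialg_mul +%R.
Proof. by move=> x y z; apply: subval_inj; exact: cmulDl. Qed.
Fact ialg_mulDr : right_distributive ialg_mul +%R.
Proof. by move=> x y z; apply: subval_inj; exact: cmulDr. Qed.
Fact ialg_scaleAl (a : R[i]) (x y : ialg) : a *: ialg_mul x y = ialg_mul (a *: x) y.
Proof. by apply: subval_inj; exact: cscalerAl. Qed.
Fact ialg_scaleAr (a : R[i]) (x y : ialg) : a *: ialg_mul x y = ialg_mul x (a *: y).
Proof. by apply: subval_inj; exact: cscalerAr. Qed.
Fact ialg_starK : involutive ialg_star.
Proof. by move=> x; apply: subval_inj; exact: starK. Qed.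
Fact ialg_starD : {morph ialg_star : x y / x + y}.
Proof. by move=> x y; apply: subval_inj; exact: starD. Qed.
Fact ialg_starZ (a : R[i]) (x : ialg) : ialg_star (a *: x) = (a^*)%C *: ialg_star x.
Proof. by apply: subval_inj; exact: starZ. Qed.
Fact ialg_starM (x y : ialg) : ialg_star (ialg_mul x y) = ialg_mul (ialg_star y) (ialg_star x).
Proof. by apply: subval_inj; exact: starM. Qed.
Fact ialg_normM (x y : ialg) : `|ialg_mul x y| <= `|x| * `|y|.
Proof. exact: cnormM. Qed.
Fact ialg_norm_star (x : ialg) : `|ialg_mul (ialg_star x) x| = `|x| ^+ 2.
Proof. exact: cnorm_star. Qed.

HB.instance Definition _ := CompleteNormedModule_isCStarAlgebra.Build R ialg
  ialg_mulA ialg_mulDl ialg_mulDr ialg_scaleAl ialg_scaleAr ialg_starK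
  ialg_starD ialg_starZ ialg_starM ialg_normM ialg_norm_star.

End ClosedIdeals.

(** * Total boundedness and compactness *)

Section TotallyBounded.
Context {R : realType} {V : completeNormedModType R[i]}.
Implicit Types (S : set V).

Definition totally_bounded S : Prop := forall e : R, 0 < e ->
  exists s : seq V, forall x, S x -> exists2 y, y \in s & nrm (x - y) <= e.

(** An ultrafilter on the closure contains some ball of every radius, hence is Cauchy and
    converges. *)
Lemma totally_bounded_precompact S : totally_bounded S -> precompact S.
Proof.
move=> tb; exists (closure S); first by move=> x; exact: subset_closure.
split; last exact: closed_closure.
rewrite compact_ultra => F UF FS.
have ball_in e : 0 < e -> exists y : V, F [set x | nrm (x - y) <= e].
  move=> e0; have [s hs] := tb _ (divr_gt0 e0 (ltr0Sn _ 1)).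
  apply: contrapT => h.
  have hF (r : seq V) : F [set x | forall y, y \in r -> e < nrm (x - y)].
    elim: r => [|y r ih]; first by apply: filterS filterT => x _ y; rewrite in_nil.
    have [hy|hy] := in_ultra_setVsetC [set x | nrm (x - y) <= e] UF.
      by exfalso; apply: h; exists y.
    apply: filterS (filterI hy ih) => x [/= /negP]; rewrite -ltNge => xy hr z.
    by rewrite inE => /orP[/eqP ->|]; [exact: xy|exact: hr].
  have [x [cx hx]] := filter_ex (filterI FS (hF s)).
  have /closure_nrmP/(_ _ (divr_gt0 e0 (ltr0Sn _ 1)))[z Sz xz] := cx.
  have [y ys zy] := hs z Sz; have := hx y ys.
  by have := ler_nrmD (x - z) (z - y); rewrite subrKA; lra.
have /cvg_ex[l hl] : cvg F.
  apply/cauchy_cvgP/cauchyP => e /posC[r r0 ->].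
  have [y hy] := ball_in _ (divr_gt0 r0 (ltr0Sn _ 1)).
  exists y; apply: filterS hy => x /= xy.
  rewrite -ball_normE /ball_ /= nrmE ltcR nrmC; apply: le_lt_trans xy _; lra.
exists l; split=> //.
have /closed_nrmP := @closed_closure _ S; apply => e e0.
have hb : F [set y | nrm (l - y) < e] by apply: hl; apply/nbhs_nrmP; exists e.
by have [y [Sy /ltW hy]] := filter_ex (filterI FS hb); exists y.
Qed.

Lemma precompact_cluster S (f : nat -> V) : precompact S -> (forall n, S (f n)) ->
  exists v, forall (e : R) N, 0 < e -> exists2 n, (N <= n)%N & nrm (f n - v) <= e.
Proof.
move=> [U SU [cU _]] Sf.
have [|v [_ cv]] := cU (f @ \oo) _.
  by exists 0%N => // n _; apply: SU; exact: Sf.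
exists v => e N e0.
have fA : (f @ \oo) [set f n | n in [set n | (N <= n)%N]].
  by exists N => // n /= Nn; exists n.
have nB : nbhs v [set y | nrm (v - y) < e] by apply/nbhs_nrmP; exists e.
have [y [[n /= Nn <-] fy]] := cv _ _ fA nB.
by exists n => //; rewrite nrmC ltW.
Qed.

End TotallyBounded.

(** A square grid of mesh e / 2: both coordinates are within e / 2, so the distance is below e. *)
Lemma complex_ball_net (R : realType) (C e : R) : 0 < e ->
  exists s : seq R[i], forall a : R[i], complex.Re `|a| <= C ->
    exists2 b, b \in s & complex.Re `|a - b| <= e.
Proof.
move=> e0; pose d := e / 2; have d0 : 0 < d by rewrite /d; lra.
pose N := (Num.bound (2 * `|C| / d)).+1.
pose g (n : nat) : R := n%:R * d - `|C|.
have net (t : R) : `|t| <= `|C| -> exists2 n : nat, n \in iota 0 N & `|t - g n| <= d.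
  move=> tC; have tC0 : 0 <= (t + `|C|) / d.
    by rewrite divr_ge0 ?(ltW d0) //; have := ler_norm (- t); rewrite normrN; lra.
  have /andP[h1 h2] := truncn_itv tC0; set n := Num.truncn _ in h1 h2.
  rewrite ler_pdivlMr // in h1; rewrite ltr_pdivrMr // -natr1 in h2.
  exists n; last by rewrite /g ler_norml; apply/andP; split; lra.
  rewrite mem_iota /= add0n ltnS; apply: ltnW; rewrite -(ltr_nat R).
  apply: le_lt_trans (archi_boundP (_ : 0 <= 2 * `|C| / d)); last first.
    by rewrite divr_ge0 ?mulr_ge0 // ltW.
  by rewrite ler_pdivlMr //; have := ler_norm t; lra.
exists [seq (Complex (g q.1) (g q.2)) | q <- [seq (m, n) | m <- iota 0 N, n <- iota 0 N]].
move=> [x y] hC.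
have ReC (u v : R) : complex.Re `|Complex u v| = Num.sqrt (u ^+ 2 + v ^+ 2).
  by rewrite normc_def.
have hx (u v : R) : `|u| <= Num.sqrt (u ^+ 2 + v ^+ 2).
  by rewrite -sqrtr_sqr ler_wsqrtr // lerDl sqr_ge0.
rewrite ReC in hC.
have [m mN hm] := net x (le_trans (hx x y) (le_trans hC (ler_norm _))).
have [n nN hn] := net y (le_trans (hx y x) (le_trans (eq_ind_r (fun z => Num.sqrt z <= C) hC (addrC _ _)) (ler_norm _))).
exists (Complex (g m) (g n)).
  by apply/mapP; exists (m, n) => //; apply/allpairsP; exists (m, n).
rewrite -[Complex x y - _]/(Complex (x - g m) (y - g n)) ReC.
have e20 : 0 <= e ^+ 2 by exact: sqr_ge0.
rewrite -[e in _ <= e](ger0_norm (ltW e0)) -sqrtr_sqr ler_wsqrtr //.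
have k1 : (x - g m) ^+ 2 <= d ^+ 2.
  by rewrite -(real_normK (num_real (x - g m))) lerXn2r ?nnegrE ?(ltW d0).
have k2 : (y - g n) ^+ 2 <= d ^+ 2.
  by rewrite -(real_normK (num_real (y - g n))) lerXn2r ?nnegrE ?(ltW d0).
have -> : e ^+ 2 = 4 * d ^+ 2 by rewrite /d; field.
have d2 : 0 <= d ^+ 2 by exact: sqr_ge0.
lra.
Qed.

(** * The Hilbert space of a minimal projection *)

Section MinimalLeftIdeal.
Context {R : realType} {A : cstarAlgType R}.
Implicit Types (x y z : A).

Record mproj := MProj { mproj_val :> A; mprojP : minproj mproj_val }.

Variable p : mproj.

Lemma mproj_sa : star p = p. Proof. by case: (mprojP p) => [[]]. Qed.
Lemma mproj_idem : p ** p = p. Proof. by case: (mprojP p) => [[]]. Qed.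
Lemma mproj_neq0 : (p : A) <> 0. Proof. by case: (mprojP p). Qed.

Lemma mproj_nrm : nrm (p : A) = 1.
Proof.
have h := nrm_sa mproj_sa; rewrite mproj_idem in h.
by apply: (mulfI (lt0r_neq0 (nrm_gt0 mproj_neq0))); rewrite mulr1 -expr2 -h.
Qed.

Definition pcoef x : R[i] := xget 0 [set a : R[i] | p ** x ** p = a *: (p : A)].

Lemma pcoefE x : p ** x ** p = pcoef x *: (p : A).
Proof.
have [_ _ h] := mprojP p; have [a aE] := h x.
exact: (@xgetPex _ 0 [set a : R[i] | p ** x ** p = a *: (p : A)] (ex_intro _ a aE)).
Qed.

Lemma mproj_scale_inj (a b : R[i]) : a *: (p : A) = b *: (p : A) -> a = b.
Proof.
move=> /eqP; rewrite -subr_eq0 -scalerBl scaler_eq0 subr_eq0 => /orP[/eqP //|/eqP].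
by move/mproj_neq0.
Qed.

(* If a < 0 then, with u replaced by u - p u so that p u = 0, the self-adjoint
   s = u + u* satisfies s^2 p = - t p with t > 0, which contradicts
   |1 - s^2 / |s|^2| <= 1. *)
Lemma mproj_positive (u : A) (a : R) : u ** p = u -> star u ** u = a%:C *: (p : A) ->
  0 <= a.
Proof.
move=> up uu; rewrite leNgt; apply/negP => a0.
have pus : p ** star u = star u by rewrite -mproj_sa -starM up.
pose b := pcoef u; have pu : p ** u = b *: (p : A) by rewrite -pcoefE -cmulA up.
have usp : star u ** p = (b^*)%C *: (p : A).
  by rewrite -[LHS]starK starM starK mproj_sa pu starZ mproj_sa.
pose v := u - b *: (p : A).
have vp : v ** p = v by rewrite /v cmulBl up cscalel mproj_idem.
have pv : p ** v = 0 by rewrite /v cmulBr pu cscaler mproj_idem subrr.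
have vsp : star v ** p = 0 by rewrite -[LHS]starK starM starK mproj_sa pv star0.
have [N [N0 NE]] : exists N : R, 0 <= N /\ N%:C = b * (b^*)%C.
  have b0 : 0 <= `|b| ^+ 2 by rewrite exprn_ge0.
  exists (complex.Re (`|b| ^+ 2)).
  by rewrite -ler0c RRe_real ?ger0_real // sqr_normc -?sqr_normc.
have vv : star v ** v = (a - N)%:C *: (p : A).
  rewrite {2}/v cmulBr cscaler vsp scaler0 subr0 /v starB starZ mproj_sa cmulBl uu.
  rewrite cscalel pu scalerA -scalerBl; congr (_ *: _).
  by rewrite rmorphB /= NE mulrC.
pose t := N - a.
have t0 : 0 < t by rewrite /t; lra.
pose s := v + star v; have ssa : star s = s by rewrite /s starD starK addrC.
have ssp : s ** (s ** p) = - (t%:C *: (p : A)).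
  have -> : s ** p = v by rewrite /s cmulDl vsp addr0 vp.
  have v0 : v ** v = 0 by rewrite -{1}vp -cmulA pv cmul0r.
  by rewrite /s cmulDl v0 add0r vv -scaleNr -rmorphN /t opprB.
have s0 : 0 < nrm s.
  apply: nrm_gt0 => e; move: ssp; rewrite e cmul0l => /esym/eqP.
  rewrite oppr_eq0 scaler_eq0 => /orP[|/eqP]; last exact: mproj_neq0.
  by rewrite eq_complex /= (gt_eqF t0).
pose h := ((nrm s)^-1)%:C *: s.
have hsa : star h = h by rewrite /h starZr ssa.
have h1 : nrm h <= 1 by rewrite /h nrmZr gtr0_norm ?invr_gt0 // mulVf ?gt_eqF.
have hq (x : R) : `|x| <= 1 -> `|(1 - 'X^2 : {poly R}).[x]| <= 1.
  move=> x1; have -> : (1 - 'X^2 : {poly R}).[x] = 1 - `|x| ^+ 2.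
    by rewrite !hornerE real_normK ?num_real.
  have x2 : `|x| ^+ 2 <= 1 by rewrite expr_le1.
  by have := sqr_ge0 `|x| => x3; rewrite ler_norml; apply/andP; split; lra.
have := hact_bound (p : A) hsa h1 hq.
have -> : hact h (1 - 'X^2) p = (1 + t / nrm s ^+ 2)%:C *: (p : A).
  rewrite hactB expr2 hactM !hactX -polyC1 hactC scale1r /h !cscalel cscaler.
  have -> : (1 + t / nrm s ^+ 2)%:C = 1 + (t / nrm s ^+ 2)%:C :> R[i].
    by rewrite rmorphD rmorph1.
  rewrite ssp !scalerN opprK !scalerA scalerDl scale1r.
  congr (_ + _ *: _); rewrite -!rmorphM /=; congr (_%:C); field.
  by rewrite gt_eqF.
rewrite nrmZr mproj_nrm !mulr1 ger0_norm.
  have : 0 < t / nrm s ^+ 2 by rewrite divr_gt0 // exprn_gt0.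
  lra.
have : 0 < t / nrm s ^+ 2 by rewrite divr_gt0 // exprn_gt0.
lra.
Qed.

Fact left_ideal_subspace : linear_subspace [set x | x ** p = x].
Proof.
split; first by rewrite /= cmul0l.
by move=> a x y /= xp yp; rewrite cmulDl cscalel xp yp.
Qed.

Fact left_ideal_closed : closed [set x | x ** p = x].
Proof.
apply/closed_nrmP => x cx; apply/eqP; rewrite -subr_eq0; apply/eqP.
apply: (@nrm_eq0_lin _ _ 2) => e e0; have [y /= yp xy] := cx e e0.
have -> : x ** p - x = (x - y) ** p - (x - y) by rewrite cmulBl yp; zmod.
apply: le_trans (ler_nrmB _ _) _; have := nrmM (x - y) p; rewrite mproj_nrm; lra.
Qed.

Definition left_ideal : csubspace := CSubspace left_ideal_subspace left_ideal_closed.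

Definition hilb := subsp left_ideal.

HB.instance Definition _ := CompleteNormedModule.copy hilb (subsp left_ideal).

Implicit Types (u v w : hilb).

Definition vec u : A := subval u.
Definition mkvec x (xp : x ** p = x) : hilb := mksub (S := left_ideal) xp.

Lemma vecp u : vec u ** p = vec u.
Proof. exact: (subvalS u). Qed.

Lemma pvec u : p ** star (vec u) = star (vec u).
Proof. by rewrite -mproj_sa -starM vecp. Qed.

(** v* u lies in p A p, which is one-dimensional, and the inner product is its coordinate. As u* u =
    <u, u> p and |p| = 1, the Hilbert norm is the norm of A, so completeness is inherited. *)
Definition hinner u v : R[i] := pcoef (star (vec v) ** vec u).

Lemma hinnerE u v : star (vec v) ** vec u = hinner u v *: (p : A).
Proof. by rewrite -pcoefE cmulA pvec -cmulA vecp. Qed.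

Fact hinnerPl (a : R[i]) u v w : hinner (a *: u + v) w = a * hinner u w + hinner v w.
Proof.
apply: mproj_scale_inj; rewrite scalerDl -scalerA -!hinnerE.
by rewrite -cscaler -cmulDr.
Qed.

Fact hinner_conj u v : hinner u v = ((hinner v u)^*)%C.
Proof.
by apply: mproj_scale_inj; rewrite -{2}mproj_sa -starZ -!hinnerE starM starK.
Qed.

Fact hinner_norm u : hinner u u = `|u| ^+ 2.
Proof.
have hr : hinner u u = (complex.Re (hinner u u))%:C.
  have := hinner_conj u u; case: (hinner u u) => a b [] /eqP.
  by rewrite -addr_eq0 -mulr2n mulrn_eq0 /= => /eqP ->.
have hE := hinnerE u u; rewrite hr in hE.
have h0 := mproj_positive (vecp u) hE.
rewrite hr nrmE -rmorphXn /=; congr (_%:C).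
by have := congr1 nrm hE; rewrite nrm_star_mul nrmZr mproj_nrm mulr1 ger0_norm.
Qed.

HB.instance Definition _ := CompleteNormedModule_isHilbert.Build R hilb
  hinnerPl hinner_conj hinner_norm.

Lemma hilb_nrm u : nrm u = nrm (vec u).
Proof. by []. Qed.

Definition block : set A := closure (gen [set (p : A)]).

Lemma block_closed_ideal : closed_ideal_of [set: A] block.
Proof. exact/closure_ideal/gen_ideal. Qed.

Lemma gen_mproj_star x : gen [set (p : A)] x -> gen [set (p : A)] (star x).
Proof. by apply: gen_star => _ ->; exact: mproj_sa. Qed.

Definition block_sub : csubspace :=
  CSubspace (let: conj (And3 _ h _) _ := block_closed_ideal in h)
    (let: conj _ h := block_closed_ideal in h).

Fact blockM x y : block_sub x -> block_sub y -> block_sub (x ** y).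
Proof. by move=> _ By; apply: (idealMl block_closed_ideal.1). Qed.

Fact block_star x : block_sub x -> block_sub (star x).
Proof. exact: closure_star gen_mproj_star. Qed.

Definition block_ideal : cideal := CIdeal blockM block_star.

Lemma block_faithful x : block x -> (forall v : A, x ** v ** p = 0) -> x = 0.
Proof.
move=> Bx h; have xg y : gen [set (p : A)] y -> x ** y = 0.
  elim=> [|u q v z -> _ ih]; first exact: cmul0r.
  by rewrite cmulDr ih addr0 !cmulA h cmul0l.
rewrite -[x]starK; suff -> : star x = 0 by rewrite star0.
apply: star_mul_eq0; rewrite starK.
apply: (@nrm_eq0_lin _ _ (nrm x)) => e e0.
have /closure_nrmP/(_ e e0)[y gy xy] := block_star Bx.
have -> : x ** star x = x ** (star x - y) by rewrite cmulBr (xg y gy) subr0.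
by apply: le_trans (nrmM _ _) _; rewrite ler_wpM2l ?nrm_ge0.
Qed.

(** Stands in for isometry of the representation on A p: were |x| larger, the top cut of x would
    vanish on A p, hence be 0 by faithfulness. The factor 2 only enters a Cauchy estimate. *)
Lemma block_bounded x (m : R) : 0 <= m -> block x ->
  (forall u, nrm (x ** vec u) <= m * nrm u) -> nrm x <= 2 * m.
Proof.
move=> m0 Bx h; rewrite leNgt; apply/negP => hx.
have x0 : 0 < nrm x by apply: le_lt_trans hx; rewrite mulr_ge0.
apply: (topcut_neq0 x0); apply: block_faithful => [|v].
  have [k ->] := topcut_factor x0; have hI := block_closed_ideal.1.
  by apply: (idealMl hI).
rewrite -cmulA; apply: (topcut_kill x0 hx).
have wp : topcut x ** (v ** p) ** p = topcut x ** (v ** p).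
  by rewrite -!cmulA mproj_idem.
exact: h (mkvec wp).
Qed.

End MinimalLeftIdeal.

Section Elementary.
Context {R : realType} {A : cstarAlgType R}.
Variable p : @mproj R A.
Implicit Types (x y z : A) (u v w e : hilb p).

Notation H := (hilb p).
Notation unit_ball := [set u : H | `|u| <= 1].

Lemma vec_inj u v : vec u = vec v -> u = v.
Proof. exact: subval_inj. Qed.

Fact act_vecP x u : (x ** vec u) ** p = x ** vec u.
Proof. by rewrite -cmulA vecp. Qed.

Definition act x u : H := mkvec (act_vecP x u).

Lemma vecZ (a : R[i]) u : vec (a *: u) = a *: vec u. Proof. by []. Qed.
Lemma vecD u v : vec (u + v) = vec u + vec v. Proof. by []. Qed.
Lemma vecB u v : vec (u - v) = vec u - vec v. Proof. by []. Qed.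
Lemma vec_act x u : vec (act x u) = x ** vec u. Proof. by []. Qed.

Lemma act_linear x : linear (act x).
Proof.
by move=> a u v; apply: vec_inj; rewrite vecD vecZ !vec_act vecD vecZ cmulDr cscaler.
Qed.

Lemma unit_ballE u : (`|u| <= 1) = (nrm u <= 1).
Proof. by rewrite -[1]/(1%:C) ler_nrmE. Qed.

(** A term a p b has rank one: p b u = l p with |l| <= |b|, so a p b u = l a p, and a finite net of
    scalars l suffices. *)
Lemma gen_totally_bounded y : gen [set (p : A)] y ->
  totally_bounded (act y @` unit_ball).
Proof.
elim=> [|a q b z -> _ ih] e e0.
  exists [:: 0] => _ [u _ <-]; exists 0; first by rewrite inE.
  by rewrite subr0 hilb_nrm vec_act cmul0l nrm0 ltW.
have [s hs] := ih _ (divr_gt0 e0 (ltr0Sn _ 1)).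
have c0 : 0 < 2 * (nrm a + 1) by have := nrm_ge0 a; lra.
have [r hr] := complex_ball_net (nrm b) (divr_gt0 e0 c0).
have app : a ** p ** p = a ** p by rewrite -cmulA mproj_idem.
pose ap : H := mkvec app.
exists [seq q.1 *: ap + q.2 | q <- [seq (c, v) | c <- r, v <- s]].
move=> _ [u /= u1 <-]; rewrite unit_ballE in u1.
have [|v vs hv] := hs (act z u); first by exists u => //=; rewrite unit_ballE.
pose l := pcoef p (b ** vec u).
have lE : p ** (b ** vec u) = l *: (p : A) by rewrite -pcoefE -!cmulA vecp.
have lb : complex.Re `|l| <= nrm b.
  rewrite -[complex.Re _]mulr1 -(mproj_nrm p) -nrmZ -lE.
  apply: le_trans (nrmM _ _) _; rewrite mproj_nrm mul1r.
  apply: le_trans (nrmM _ _) _; rewrite -[leRHS]mulr1 ler_wpM2l ?nrm_ge0 //.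
have [m mr hm] := hr l lb.
exists (m *: ap + v).
  by apply/mapP; exists (m, v) => //; apply/allpairsP; exists (m, v).
have -> : act (a ** p ** b + z) u - (m *: ap + v) = (l - m) *: ap + (act z u - v).
  apply: vec_inj; rewrite !(vecD, vecB, vecZ) !vec_act /= cmulDl -2!cmulA lE.
  rewrite cscaler scalerBl; zmod.
apply: le_trans (ler_nrmD _ _) _.
have h1 : nrm ((l - m) *: ap) <= e / 2.
  rewrite nrmZ; have h2 : nrm ap <= nrm a + 1.
    rewrite hilb_nrm; apply: le_trans (nrmM _ _) _; rewrite mproj_nrm; lra.
  apply: le_trans (ler_pM (re_norm_ge0 _) (nrm_ge0 _) hm h2) _.
  rewrite le_eqVlt; apply/orP; left; apply/eqP; field.
  by have := nrm_ge0 a; lra.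
lra.
Qed.

Lemma block_act_compact x : block p x -> compact_operator (act x).
Proof.
move=> Bx; split; first exact: act_linear.
apply: totally_bounded_precompact => e e0.
have e2 : 0 < e / 2 by lra.
have /closure_nrmP/(_ _ e2)[y gy xy] := Bx.
have [s hs] := gen_totally_bounded gy e2.
exists s => _ [u /= u1 <-]; have [|v vs hv] := hs (act y u); first by exists u.
exists v => //; rewrite unit_ballE in u1.
rewrite -(subrKA (act y u)); apply: le_trans (ler_nrmD _ _) _.
have h : nrm (act x u - act y u) <= e / 2.
  rewrite hilb_nrm vecB !vec_act -cmulBl; apply: le_trans (nrmM _ _) _.
  by have := ler_pM (nrm_ge0 _) (nrm_ge0 _) xy u1; rewrite mulr1.
lra.
Qed.

Section CompactOperator.
Variable k : H -> H.
Hypotheses (klin : linear k) (kc : precompact (k @` unit_ball)).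

Lemma compact_op_bounded : exists2 B : R, 0 <= B & forall u, nrm (k u) <= B * nrm u.
Proof.
have [B hB] : exists B : R, forall u, nrm u <= 1 -> nrm (k u) <= B.
  apply: contrapT => h.
  have /choice[f hf] (n : nat) : exists u, nrm u <= 1 /\ n%:R < nrm (k u).
    apply: contrapT => h'; apply: h; exists n%:R => u u1; rewrite leNgt.
    by apply/negP => h2; apply: h'; exists u.
  have [|v hv] := @precompact_cluster _ _ _ (fun n => k (f n)) kc.
    by move=> n; exists (f n) => //=; rewrite unit_ballE; case: (hf n).
  have [n nN hn] := hv 1 (Num.bound (nrm v + 1)) ltr01.
  have [_ h1] := hf n; have h2 := ler_nrm_add (k (f n)) v.
  have h3 : nrm v + 1 < (Num.bound (nrm v + 1))%:R.
    by apply: archi_boundP; have := nrm_ge0 v; lra.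
  have h4 : (Num.bound (nrm v + 1))%:R <= n%:R :> R by rewrite ler_nat.
  lra.
exists `|B| => // u; have [/nrm0_eq0 ->|u0] := eqVneq (nrm u) 0.
  by rewrite (lin0 klin) !nrm0 mulr0.
have up : 0 < nrm u by rewrite lt_neqAle eq_sym u0 nrm_ge0.
have := hB (((nrm u)^-1)%:C *: u).
rewrite (linZ klin) !nrmZr gtr0_norm ?invr_gt0 // mulVf // lexx => /(_ isT).
rewrite mulrC ler_pdivrMr // => /le_trans; apply.
by rewrite ler_wpM2r ?nrm_ge0 // ler_norm.
Qed.

(** q will be a projection onto a finite-dimensional subspace of A p, and y represents the
    finite-rank operator k q inside the algebraic ideal of p. *)
Definition finite_rank_pair (q y : A) : Prop :=
  [/\ is_proj q, gen [set (p : A)] y & forall u, k (act q u) = act y u].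

Lemma finite_rank_extend q y (eps : R) : finite_rank_pair q y -> 0 <= eps ->
  ~ (forall u, nrm (k (u - act q u)) <= eps * nrm u) ->
  exists e, [/\ star (vec e) ** vec e = p, q ** vec e = 0, eps < nrm (k e) &
    exists y', finite_rank_pair (q + vec e ** star (vec e)) y'].
Proof.
move=> [[qsa qq] gy hy] eps0 h.
have [u hu] : exists u, eps * nrm u < nrm (k (u - act q u)).
  apply: contrapT => h'; apply: h => u; rewrite leNgt; apply/negP => h2.
  by apply: h'; exists u.
pose v := u - act q u.
have qv : q ** vec v = 0 by rewrite vecB vec_act cmulBr cmulA qq subrr.
have vu : nrm v <= nrm u.
  have -> : nrm u = nrm (vec v + q ** vec u).
    by rewrite hilb_nrm vecB vec_act subrK.
  apply: orth_norm.
  by rewrite cmulA -[star (vec v) ** q]starK starM starK qsa qv star0 cmul0l.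
have v0 : 0 < nrm v.
  apply: nrm_gt0 => v0; move: hu; rewrite -/v v0 (lin0 klin) nrm0.
  by apply/negP; rewrite -leNgt mulr_ge0 ?nrm_ge0.
pose e := ((nrm v)^-1)%:C *: v.
have qe : q ** vec e = 0 by rewrite vecZ cscaler qv scaler0.
have ee : star (vec e) ** vec e = p.
  rewrite (hinnerE e e) hinner_norm nrmE nrmZr gtr0_norm ?invr_gt0 // mulVf ?gt_eqF //.
  by rewrite -rmorphXn expr1n scale1r.
exists e; split=> //.
  rewrite (linZ klin) nrmZr gtr0_norm ?invr_gt0 // mulrC ltr_pdivlMr //.
  by apply: le_lt_trans hu; rewrite ler_wpM2l.
(* The new projection adds <w, e> e to q w, and k sends it to <w, e> k(e) = k(e) p e* w. *)
exists (y + vec (k e) ** p ** star (vec e)); split.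
- split; first by rewrite starD starM starK qsa.
  have eq : star (vec e) ** q = 0 by rewrite -[LHS]starK starM starK qsa qe star0.
  rewrite cmulDl !cmulDr qq cmulA qe cmul0l addr0 -cmulA eq cmul0r add0r.
  by rewrite -cmulA (cmulA (star (vec e))) ee pvec.
- by apply: genD => //; exact: gen_mem.
- move=> w.
  have -> : act (q + vec e ** star (vec e)) w = act q w + hinner w e *: e.
    by apply: vec_inj; rewrite vecD vecZ !vec_act cmulDl -cmulA hinnerE cscaler vecp.
  rewrite (linD klin) (linZ klin) hy; apply: vec_inj.
  rewrite vecD vecZ !vec_act cmulDl -!cmulA hinnerE !cscaler mproj_idem vecp //.
Qed.

(** Otherwise there are orthonormal e_n with |k e_n| > eps, and the k e_n cluster at some v with |v|
    >= 3 eps / 4. A sum w of m of them taken near v has |w|^2 = m but |k w| >= m eps / 2, which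
    contradicts boundedness of k for large m. No adjoint of k is involved. *)
Lemma finite_rank_approx (eps : R) : 0 < eps ->
  exists q y, finite_rank_pair q y /\ forall u, nrm (k (u - act q u)) <= eps * nrm u.
Proof.
move=> eps0; apply: contrapT => h.
pose good q := exists y, finite_rank_pair q y.
have /choice[f hf] q : exists e, good q -> [/\ star (vec e) ** vec e = p,
    q ** vec e = 0, eps < nrm (k e) & good (q + vec e ** star (vec e))].
  have [[y qy]|nq] := pselect (good q); last by exists 0.
  have [|e [h1 h2 h3 h4]] := finite_rank_extend qy (ltW eps0); last by exists e.
  by move=> h'; apply: h; exists q, y.
pose s := fix s n := if n is n.+1 then s n + vec (f (s n)) ** star (vec (f (s n))) else 0 : A.
have sP n : good (s n).
  elim: n => [|n ih]; last by case: (hf _ ih).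
  exists 0; split; [by split; [exact: star0|exact: cmul0l]|exact: gen_zero|].
  move=> u; have -> : act 0 u = 0 by apply: vec_inj; rewrite vec_act cmul0l.
  exact: lin0.
pose e n := f (s n).
have eP n : [/\ star (vec (e n)) ** vec (e n) = p, s n ** vec (e n) = 0 &
    eps < nrm (k (e n))] by case: (hf _ (sP n)).
have ssa n : star (s n) = s n by case: (sP n) => y [[]].
have se m j : s (m + j).+1 ** vec (e m) = vec (e m).
  elim: j => [|j ih].
    have [ee s0 _] := eP m.
    by rewrite addn0 [s _]/= cmulDl s0 add0r -cmulA ee vecp.
  rewrite addnS [s _.+1]/= cmulDl ih -{2}ih -cmulA -/(e _).
  rewrite (_ : star (vec (e (m + j).+1)) ** _ = 0) ?cmul0r ?addr0 //.
  have [_ s0 _] := eP (m + j).+1.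
  by rewrite cmulA -[star _ ** s _]starK starM starK ssa s0 star0 cmul0l.
have orth m n : (m < n)%N -> star (vec (e m)) ** vec (e n) = 0.
  move=> mn; have := se m (n - m.+1)%N; rewrite -addSn subnKC // => <-.
  by rewrite starM ssa -cmulA; have [_ -> _] := eP n; rewrite cmul0r.
have e1 n : nrm (e n) = 1.
  have [ee _ _] := eP n; apply: (@pexpIrn _ 2) => //; rewrite ?nnegrE ?nrm_ge0 //.
  by rewrite hilb_nrm -nrm_star_mul ee mproj_nrm expr1n.
have [|v hv] := @precompact_cluster _ _ _ (fun n => k (e n)) kc.
  by move=> n; exists (e n) => //=; rewrite unit_ballE e1.
have nv : 3 / 4 * eps <= nrm v.
  have [n _ hn] := hv (eps / 4) 0%N (divr_gt0 eps0 (ltr0Sn _ 3)).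
  by have [_ _ he] := eP n; have := ler_nrm_add (k (e n)) v; lra.
have sums m : exists N w, [/\ star (vec w) ** vec w = m%:R *: (p : A),
    nrm (k w - m%:R *: v) <= m%:R * (eps / 4) &
    forall n, (N <= n)%N -> star (vec w) ** vec (e n) = 0].
  elim: m => [|m [N [w [ww kw orthw]]]].
    exists 0%N, 0; split; last by move=> n _; rewrite star0 cmul0l.
      by rewrite cmul0r scale0r.
    by rewrite (lin0 klin) scale0r subrr nrm0 mul0r.
  have [n Nn hn] := hv (eps / 4) N (divr_gt0 eps0 (ltr0Sn _ 3)).
  have [ee _ _] := eP n.
  exists n.+1, (w + e n); split.
  - have we := orthw n Nn.
    have ew : star (vec (e n)) ** vec w = 0 by rewrite -[LHS]starK starM starK we star0.
    by rewrite vecD starD cmulDl !cmulDr ww we ew ee addr0 add0r -natr1 scalerDl scale1r.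
  - rewrite (linD klin) -natr1 scalerDl scale1r opprD addrACA.
    apply: le_trans (ler_nrmD _ _) _; rewrite -natr1; lra.
  - move=> j nj; rewrite vecD starD cmulDl orthw ?orth ?addr0 //.
    by apply: leq_trans (leqW Nn) nj.
have [B B0 hB] := compact_op_bounded.
have key (m : nat) : (m%:R * (eps / 2)) ^+ 2 <= B ^+ 2 * m%:R.
  have [N [w [ww kw _]]] := sums m.
  have nw : nrm w ^+ 2 = m%:R.
    by rewrite hilb_nrm -nrm_star_mul ww -(rmorph_nat (real_complex R)) nrmZr mproj_nrm mulr1 ger0_norm.
  have h1 : m%:R * (eps / 2) <= nrm (k w).
    have : nrm (m%:R *: v) = m%:R * nrm v.
      by rewrite -(rmorph_nat (real_complex R)) nrmZr ger0_norm.
    have := ler_nrm_add (m%:R *: v) (k w); rewrite nrmC.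
    have : m%:R * (3 / 4 * eps) <= m%:R * nrm v by rewrite ler_wpM2l.
    lra.
  have h2 := le_trans h1 (hB w).
  have h3 : 0 <= m%:R * (eps / 2) by rewrite mulr_ge0 //; lra.
  have h4 : 0 <= B * nrm w := le_trans h3 h2.
  have : (m%:R * (eps / 2)) ^+ 2 <= (B * nrm w) ^+ 2.
    by apply: lerXn2r; rewrite ?nnegrE.
  by rewrite [X in _ <= X]exprMn nw.
have C0 : 0 < eps ^+ 2 / 4 by rewrite divr_gt0 ?exprn_gt0.
pose m := (Num.bound (B ^+ 2 / (eps ^+ 2 / 4))).+1.
have := key m; have hm : B ^+ 2 / (eps ^+ 2 / 4) < m%:R.
  apply: lt_trans (archi_boundP _) _; last by rewrite ltr_nat.
  by rewrite divr_ge0 ?sqr_ge0 // ltW.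
rewrite ltr_pdivrMr // in hm; have m0 : (0 : R) < m%:R by rewrite ltr0n.
rewrite exprMn expr2 -mulrA mulrC ler_pM2r // expr_div_n.
apply/negP; rewrite -ltNge; lra.
Qed.

Lemma compact_op_block : exists2 x, block p x & forall u, k u = act x u.
Proof.
have p2 n : (0 : R) < (2 ^+ n)^-1 by rewrite invr_gt0 exprn_gt0.
have /choice[y hy] (n : nat) : exists y, gen [set (p : A)] y /\
    forall u, nrm (k u - act y u) <= (2 ^+ n)^-1 * nrm u.
  have [q [y [[_ gy ky] h]]] := finite_rank_approx (p2 n).
  by exists y; split=> // u; rewrite -ky -(linB klin).
have gB x : gen [set (p : A)] x -> block p x by exact: subset_closure.
have gL := gen_subspace [set (p : A)].
(* The factor 2 of [block_bounded] times 2^(-n) + 2^(-n-1) is the drop of 6 / 2^n. *)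
pose rho n : R := 6 / 2 ^+ n.
have [|||x hx] := @lim_telescope R A y rho.
- move=> n; have [g1 h1] := hy n; have [g2 h2] := hy n.+1.
  have -> : rho n - rho n.+1 = 2 * ((2 ^+ n)^-1 + (2 ^+ n.+1)^-1).
    by rewrite /rho exprS; field; rewrite gt_eqF // exprn_gt0.
  apply: block_bounded; first by rewrite addr_ge0 ?ltW.
    by apply: gB; exact: subspaceB.
  move=> u; rewrite -/(vec_act _ u) cmulBl.
  rewrite -[_ - _]/(vec (act (y n.+1) u - act (y n) u)) -hilb_nrm.
  have -> : act (y n.+1) u - act (y n) u = (k u - act (y n) u) - (k u - act (y n.+1) u).
    by zmod.
  by apply: le_trans (ler_nrmB _ _) _; rewrite mulrDl lerD.
- by move=> n; rewrite divr_ge0 // exprn_ge0.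
- by move=> e; exact: inv_pow2_small.
exists x.
  apply/closure_nrmP => e e0; have [n hn] := inv_pow2_small 6 e0.
  by exists (y n); [case: (hy n)|exact: le_trans (hx n) hn].
move=> u; apply/eqP; rewrite -subr_eq0; apply/eqP; apply: vec_inj.
rewrite vecB vec_act; apply: (@nrm_eq0_lin _ _ (2 * nrm u)) => e e0.
have [n hn] := inv_pow2_small 6 e0; have [_ h] := hy n.
have -> : vec (k u) - x ** vec u =
    vec (k u - act (y n) u) - (x - y n) ** vec u.
  by rewrite vecB vec_act cmulBl; zmod.
apply: le_trans (ler_nrmB _ _) _.
have h1 := h u; rewrite hilb_nrm in h1.
have h2 := nrmM (x - y n) (vec u); rewrite -hilb_nrm in h2.
have h3 : nrm (x - y n) * nrm u <= e * nrm u.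
  by rewrite ler_wpM2r ?nrm_ge0 // (le_trans (hx n)).
have h4 : (2 ^+ n)^-1 * nrm u <= e * nrm u.
  rewrite ler_wpM2r ?nrm_ge0 //; apply: le_trans hn.
  by rewrite -[X in X <= _]mul1r ler_pM2r // ler1n.
lra.
Qed.

End CompactOperator.

Lemma block_elementary : elementary_cstar (ialg (block_ideal p)).
Proof.
pose E := ialg (block_ideal p).
have SB (x : E) : block p (subval x) by exact: (subvalS x).
exists H, (fun (x : E) u => act (subval x) u); split.
- move=> a x y u; apply: vec_inj; rewrite vecD vecZ !vec_act.
  by rewrite -cscalel -cmulDl.
- by move=> x y u; apply: vec_inj; rewrite !vec_act cmulA.
- move=> x u v; apply: (@mproj_scale_inj _ _ p).
  by rewrite -!hinnerE !vec_act starM cmulA.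
- move=> x y xy; apply: subval_inj; apply/eqP; rewrite -subr_eq0; apply/eqP.
  apply: (@block_faithful _ _ p); first exact: (SB (x - y : E)).
  move=> v; have vp : v ** p ** p = v ** p by rewrite -cmulA mproj_idem.
  have /(congr1 (fun f => vec (f (mkvec vp)))) := xy.
  by rewrite !vec_act /= => h; rewrite -cmulA cmulBl h subrr.
- apply/seteqP; split=> [_ [x _ <-]|k [klin kc]].
    exact: block_act_compact.
  have [x Bx hx] := compact_op_block klin kc.
  by exists (mksub (S := block_sub p) Bx) => //; apply/funext => u; rewrite hx.
Qed.

End Elementary.

(** * The dual part *)

Section DualPart.
Context {R : realType} {A : cstarAlgType R}.
Implicit Types (x y z u v w : A).
Notation K := (pedersen_ideal [set: A]).
Variable T : A -> A.
Hypothesis hT : left_centralizer K T.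
Notation P := [set p | unbounded_proj T p].

Definition generated_ideal (p : A) : set A := closure (gen [set p]).

(** The choice depends on p only through its closed ideal, so projections with the same ideal
    receive the same representative. *)
Definition block_rep (p : A) : A :=
  xget 0 [set q | P q /\ generated_ideal q = generated_ideal p].

Lemma block_repP p : P p ->
  P (block_rep p) /\ generated_ideal (block_rep p) = generated_ideal p.
Proof.
move=> Pp.
exact: (@xgetPex _ 0 [set q | P q /\ generated_ideal q = generated_ideal p]
  (ex_intro _ p (conj Pp erefl))).
Qed.

Lemma block_rep_eq p q : generated_ideal p = generated_ideal q ->
  block_rep p = block_rep q.
Proof. by rewrite /block_rep => ->. Qed.

Lemma block_repK p : P p -> block_rep (block_rep p) = block_rep p.
Proof. by move=> /block_repP[_ h]; exact: block_rep_eq. Qed.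

(* One projection in each block, so that distinct indices have orthogonal
   blocks. *)
Definition is_rep (p : A) : Prop := P p /\ block_rep p = p.

Definition block_index := {p : A | `[< is_rep p >]}.

Lemma block_indexP (j : block_index) : is_rep (sval j).
Proof. by case: j => p /= /asboolP. Qed.

Definition iproj (j : block_index) : mproj := MProj (block_indexP j).1.1.

Definition rep_block_index p (Pp : P p) : block_index :=
  exist _ (block_rep p) (introT (asboolP _) (conj (block_repP Pp).1 (block_repK Pp))).

Lemma gen_trans (p q : A) : gen [set p] q -> generated_ideal q `<=` generated_ideal p.
Proof.
move=> pq; apply: closure_subset; apply: gen_sub; first exact: gen_ideal.
by move=> _ ->.
Qed.

Lemma gen_self p : P p -> gen [set p] p.
Proof.
by move=> [[[_ pp] _ _] _]; have := gen_mem p p (erefl : [set p] p); rewrite !pp.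
Qed.

(** y = p v q satisfies y* y = a q by minimality of q, and a <> 0 as y <> 0; hence q is a multiple
    of y* y. *)
Lemma linked_gen p q v : P p -> P q -> p ** v ** q <> 0 -> gen [set p] q.
Proof.
move=> Pp [[[qsa qq] q0 hq] _] y0; have [[[psa pp] _ _] _] := Pp.
have [a aE] := hq (star v ** p ** v).
have e : star (p ** v ** q) ** (p ** v ** q) = a *: q.
  by rewrite -aE !starM psa qsa !cmulA -(cmulA (q ** star v)) pp.
have a0 : a != 0.
  by apply/eqP => a0; apply: y0; apply: star_mul_eq0; rewrite e a0 scale0r.
have -> : q = (a^-1 *: (q ** star v)) ** p ** (v ** q).
  rewrite !cscalel -[LHS]scale1r -(mulVf a0) -scalerA -aE.
  by congr (_ *: _); rewrite !cmulA.
exact: gen_mem.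
Qed.

Lemma linked_block p q v : P p -> P q -> p ** v ** q <> 0 ->
  generated_ideal p = generated_ideal q.
Proof.
move=> Pp Pq pq; apply/seteqP; split; apply: gen_trans; last exact: linked_gen pq.
apply: contrapT => h; apply: pq; apply: annihilate_sym => w.
by apply: contrapT => h'; apply: h; exact: linked_gen h'.
Qed.

Lemma block_index_orth (i j : block_index) v : i <> j -> iproj i ** v ** iproj j = 0.
Proof.
move=> ij; apply: contrapT => h; apply: ij; apply: val_inj => /=.
have [Pi <-] := block_indexP i; have [Pj <-] := block_indexP j.
exact/block_rep_eq/linked_block/h.
Qed.

Notation blk j := (block (iproj j)).
Notation ann j := (annihilator_of [set (iproj j : A)]).

Lemma blk_ideal j : ideal_of [set: A] (blk j).
Proof. by have [] := block_closed_ideal (iproj j). Qed.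

Lemma ann_ideal j : ideal_of [set: A] (ann j).
Proof. by have [] := annihilator_closed_ideal [set (iproj j : A)]. Qed.

Lemma blk_subspace j : linear_subspace (blk j).
Proof. by have [_ h _] := blk_ideal j. Qed.

Lemma ann_subspace j : linear_subspace (ann j).
Proof. by have [_ h _] := ann_ideal j. Qed.

Lemma blk_ann_mul j x y : blk j x -> ann j y -> x ** y = 0.
Proof.
move=> Bx hy; have h z : gen [set (iproj j : A)] z -> z ** y = 0.
  elim=> [|u p v w -> _ ih]; first exact: cmul0l.
  by rewrite cmulDl ih addr0 -!cmulA (cmulA (iproj j)) hy // cmul0r.
apply: (@nrm_eq0_lin _ _ (nrm y)) => e e0.
have /closure_nrmP/(_ e e0)[z gz xz] := Bx.
have -> : x ** y = (x - z) ** y by rewrite cmulBl (h z gz) subr0.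
by apply: le_trans (nrmM _ _) _; rewrite mulrC ler_wpM2l ?nrm_ge0.
Qed.

Lemma ann_star j x : ann j x -> ann j (star x).
Proof.
move=> hx p v ->; have e : star (iproj j) = (iproj j : A) := mproj_sa _.
have h : star (iproj j ** v ** star x) = 0.
  by rewrite !starM starK e cmulA; exact: annihilator_right hx _.
by rewrite -[LHS]starK h star0.
Qed.

Lemma ann_blk_mul j x y : ann j x -> blk j y -> x ** y = 0.
Proof.
move=> hx hy; rewrite -[LHS]starK starM (@blk_ann_mul j) ?star0 //.
  exact: block_star.
exact: ann_star.
Qed.

Lemma blk_ann0 j x : blk j x -> ann j x -> x = 0.
Proof.
by move=> Bx /ann_star ax; apply: star_mul_eq0; exact: ann_blk_mul ax Bx.
Qed.

Lemma blk_orth i j : i <> j -> blk i `<=` ann j.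
Proof.
move=> ij; have [_ ca] := annihilator_closed_ideal [set (iproj j : A)].
rewrite [X in _ `<=` X]((closure_id _).1 ca); apply: closure_subset.
apply: gen_sub; first exact: ann_ideal.
by move=> _ -> p v ->; apply: block_index_orth => /esym.
Qed.

Lemma blk_rep_block_index p (Pp : P p) : blk (rep_block_index Pp) = generated_ideal p.
Proof. by have [_ h] := block_repP Pp. Qed.

(** Each term u p v is of one of two kinds: p generates the block j, or p and the projection of j
    are unlinked and the term annihilates the block. *)
Lemma gen_blk_ann j x : gen P x -> exists y, blk j y /\ ann j (x - y).
Proof.
elim=> [|u p v z Pp _ [y [By ay]]].
  exists 0; split; first by case: (blk_subspace j).
  by rewrite subrr; case: (ann_subspace j).
have [bp|nb] := pselect (generated_ideal p = generated_ideal (iproj j)).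
  exists (u ** p ** v + y); split.
    apply: subspaceD By; first exact: blk_subspace.
    apply: (idealMr (blk_ideal j)) => //; apply: (idealMl (blk_ideal j)) => //.
    by rewrite /block -/(generated_ideal _) -bp; apply: subset_closure; exact: gen_self.
  by rewrite opprD addrACA subrr add0r.
exists y; split=> //; rewrite -addrA; apply: subspaceD ay; first exact: ann_subspace.
move=> _ w ->; rewrite !cmulA -(cmulA _ w).
suff -> : iproj j ** (w ** u) ** p = 0 by rewrite cmul0l.
apply: contrapT => h; apply: nb; apply/esym.
exact: linked_block (block_indexP j).1 Pp h.
Qed.

(** Membership in the block is unconditional, with value 0 off [dual_part], so that the component
    defines a map on all of A with values in the type of the block. *)
Lemma component_exists j x : exists y, blk j y /\ (dual_part T x -> ann j (x - y)).
Proof.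
have [dx|nd] := pselect (dual_part T x); last first.
  by exists 0; split=> //; case: (blk_subspace j).
have [_ cb] := block_closed_ideal (iproj j).
have [_ ca] := annihilator_closed_ideal [set (iproj j : A)].
have [|y z By az|e e0|y [By ay]] :=
  @orth_decomposition _ _ (blk j) (ann j) x cb (blk_subspace j).
- exact: ann_subspace.
- by apply: (@blk_ann_mul j) => //; exact: block_star.
- have /closure_nrmP/(_ e e0)[g Gg xg] := dx.
  have [y [By ay]] := gen_blk_ann j Gg.
  by exists y, (g - y); split=> //; rewrite [y + _]addrC subrK.
- by exists y; split=> // _; rewrite ((closure_id _).1 ca).
Qed.

Definition component j x : A := xget 0 [set y | blk j y /\ (dual_part T x -> ann j (x - y))].

Lemma componentP j x :
  blk j (component j x) /\ (dual_part T x -> ann j (x - component j x)).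
Proof.
have [y hy] := component_exists j x.
exact: (@xgetPex _ 0 [set y | blk j y /\ (dual_part T x -> ann j (x - y))]
  (ex_intro _ y hy)).
Qed.

Lemma component_uniq j x y : dual_part T x -> blk j y -> ann j (x - y) ->
  component j x = y.
Proof.
move=> dx By ay; have [Bc /(_ dx) ac] := componentP j x.
apply/eqP; rewrite -subr_eq0; apply/eqP; apply: (@blk_ann0 j).
  by apply: subspaceB Bc By; exact: blk_subspace.
have -> : component j x - y = (x - y) - (x - component j x) by zmod.
by apply: subspaceB ay ac; exact: ann_subspace.
Qed.

Lemma dual_ideal : ideal_of [set: A] (dual_part T).
Proof. by have [] := dual_closed_ideal T. Qed.

Lemma dual_subspace : linear_subspace (dual_part T).
Proof. by have [_ h _] := dual_ideal. Qed.

Lemma dual_star x : dual_part T x -> dual_part T (star x).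
Proof.
by apply: closure_star => y; apply: gen_star => p; exact: unbounded_proj_sa.
Qed.

Lemma blk_dual j : blk j `<=` dual_part T.
Proof.
apply: closure_subset; apply: gen_sub; first exact: gen_ideal.
move=> _ ->; have [Pp _] := block_indexP j; have [[[_ pp] _ _] _] := Pp.
by have := gen_mem (sval j) (sval j) Pp; rewrite !pp.
Qed.

Lemma component_lin j (a : R[i]) x y : dual_part T x -> dual_part T y ->
  component j (a *: x + y) = a *: component j x + component j y.
Proof.
move=> dx dy; have [Bx /(_ dx) ax] := componentP j x.
have [By /(_ dy) ay] := componentP j y.
apply: component_uniq; first by case: dual_subspace => _; exact.
  by case: (blk_subspace j) => _; exact.
by rewrite opprD addrACA -scalerBr; case: (ann_subspace j) => _; exact.
Qed.

Lemma componentB j x y : dual_part T x -> dual_part T y ->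
  component j (x - y) = component j x - component j y.
Proof.
move=> dx dy; have h := component_lin j (-1) dy dx.
by move: h; rewrite !scaleN1r addrC [in RHS]addrC.
Qed.

Lemma component_mul j x y : dual_part T x -> dual_part T y ->
  component j (x ** y) = component j x ** component j y.
Proof.
move=> dx dy; have [Bx /(_ dx) ax] := componentP j x.
have [By /(_ dy) ay] := componentP j y.
apply: component_uniq; first exact: (idealMl dual_ideal).
  exact: (idealMl (blk_ideal j)).
have -> : x ** y - component j x ** component j y =
    (x - component j x) ** y + component j x ** (y - component j y).
  by rewrite cmulBl cmulBr; zmod.
apply: (subspaceD (ann_subspace j)); first exact: (idealMr (ann_ideal j)).
exact: (idealMl (ann_ideal j)).
Qed.

Lemma component_star j x : dual_part T x -> component j (star x) = star (component j x).
Proof.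
move=> dx; have [Bx /(_ dx) ax] := componentP j x.
apply: component_uniq; [exact: dual_star|exact: block_star|].
by rewrite -starB; exact: ann_star.
Qed.

Lemma component_le j x : dual_part T x -> nrm (component j x) <= nrm x.
Proof.
move=> dx; have [Bx /(_ dx) ax] := componentP j x.
have -> : nrm x = nrm (component j x + (x - component j x)) by congr nrm; zmod.
apply: orth_norm.
by apply: (@blk_ann_mul j) => //; exact: block_star.
Qed.

Lemma component_blk i j x : blk i x -> component j x = if i == j then x else 0.
Proof.
move=> Bx; have dx := blk_dual Bx.
case: eqVneq => [ij|/eqP ij]; apply: component_uniq => //.
- by rewrite -ij.
- by rewrite subrr; case: (ann_subspace j).
- by case: (blk_subspace j).
- by rewrite subr0; exact: blk_orth Bx.
Qed.

Lemma dual_mul_blk j x y : dual_part T x -> blk j y -> x ** y = component j x ** y.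
Proof.
move=> dx By; have [Bx /(_ dx) ax] := componentP j x.
by apply/eqP; rewrite -subr_eq0 -cmulBl (ann_blk_mul ax By).
Qed.

(** Every unbounded minimal projection lies in some block, so x A p = 0 for all of them; x is then
    in both summands. *)
Lemma dual_faithful x : dual_part T x -> (forall j y, blk j y -> x ** y = 0) -> x = 0.
Proof.
move=> dx h; have bx : bounded_part T x.
  move=> p v Pp; apply: annihilate_sym => w; rewrite -cmulA.
  apply: (h (rep_block_index Pp)); apply: (idealMl (blk_ideal _)) => //.
  by rewrite blk_rep_block_index; apply: subset_closure; exact: gen_self.
by apply: star_mul_eq0; exact: dual_bounded_mul bx dx.
Qed.

(** On a block x acts as its component, so a larger norm would let the top cut of x annihilate every
    block. This bound makes component-wise approximation converge in A. *)
Lemma dual_bound x (m : R) : 0 <= m -> dual_part T x ->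
  (forall j, nrm (component j x) <= m) -> nrm x <= 2 * m.
Proof.
move=> m0 dx h; rewrite leNgt; apply/negP => hx.
have x0 : 0 < nrm x by apply: le_lt_trans hx; rewrite mulr_ge0.
apply: (topcut_neq0 x0); apply: dual_faithful => [|j y By].
  by have [k ->] := topcut_factor x0; apply: (idealMl dual_ideal).
apply: (topcut_kill x0 hx); rewrite (@dual_mul_blk j) //; last first.
  exact: (idealMl (blk_ideal j)).
by apply: le_trans (nrmM _ _) _; rewrite ler_wpM2r ?nrm_ge0.
Qed.

Lemma component_inj x y : dual_part T x -> dual_part T y ->
  (forall j, component j x = component j y) -> x = y.
Proof.
move=> dx dy h; apply/eqP; rewrite -subr_eq0; apply/eqP; apply: nrm_le0.
have dxy := subspaceB dual_subspace dx dy.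
have := dual_bound (lexx 0) dxy; rewrite mulr0; apply => j.
by rewrite componentB // h subrr nrm0.
Qed.

(** Each term u p v lies in a single block and contributes to that component only. *)
Lemma gen_finite_components x : gen P x -> finite_set [set j | component j x <> 0].
Proof.
have Gd y : gen P y -> dual_part T y by move=> ?; exact: subset_closure.
elim=> [|u p v z Pp Gz ih].
  rewrite (_ : [set j | _] = set0) //; apply/seteqP; split=> // j /=; apply.
  have d0 : dual_part T 0 by case: dual_subspace.
  by apply: component_uniq => //; [case: (blk_subspace j)|rewrite subrr; case: (ann_subspace j)].
apply: (@sub_finite_set _ _ ([set rep_block_index Pp] `|` [set j | component j z <> 0])); last first.
  by rewrite finite_setU; split=> //; exact: finite_set1.
move=> j /= hj; have [->|nj] := pselect (j = rep_block_index Pp); [by left|right].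
move=> zj; apply: hj.
have Bp : blk (rep_block_index Pp) (u ** p ** v).
  apply: (idealMr (blk_ideal _)) => //; apply: (idealMl (blk_ideal _)) => //.
  by rewrite blk_rep_block_index; apply: subset_closure; exact: gen_self.
have := component_lin j 1 (blk_dual Bp) (Gd _ Gz).
rewrite !scale1r => ->; rewrite zj addr0 (component_blk j Bp).
by case: eqP => // /esym.
Qed.

End DualPart.

Section DualCStar.
Context {R : realType} {A : cstarAlgType R}.
Variable T : A -> A.
Notation blk j := (block (iproj (T := T) j)).

Lemma component_sum (s : seq (block_index T)) (f : block_index T -> A) : uniq s ->
  (forall j, blk j (f j)) ->
  dual_part T (\sum_(j <- s) f j) /\
  forall i, component i (\sum_(j <- s) f j) = if i \in s then f i else 0.
Proof.
move=> + Bf; have dL := dual_subspace T.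
have d0 : dual_part T 0 by case: dL.
elim: s => [_|j s ih /= /andP[js us]].
  rewrite big_nil; split=> // i; apply: component_uniq => //.
    by case: (blk_subspace i).
  by rewrite subrr; case: (ann_subspace i).
have [ds cs] := ih us; have dj := blk_dual (Bf j).
rewrite big_cons; split; first exact: (subspaceD dL).
move=> i; have := component_lin i 1 dj ds; rewrite !scale1r => ->.
rewrite cs inE (component_blk i (Bf j)) eq_sym.
case: eqVneq => [->|_]; last by rewrite add0r.
by rewrite (negPf js) addr0.
Qed.

Lemma component_onto (f : forall j : block_index T, ialg (block_ideal (iproj j))) :
  c0_sum f -> exists2 x, dual_part T x & forall j, component j x = subval (f j).
Proof.
move=> hf; have Bf j : blk j (subval (f j)) by exact: (subvalS (f j)).
have p2 n : (0 : R) < (2 ^+ n)^-1 by rewrite invr_gt0 exprn_gt0.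
have /choice[s hs] (n : nat) : exists s : seq (block_index T), uniq s /\
    forall j, (j \in s) = ((2 ^+ n)^-1 <= nrm (subval (f j))).
  have e0 : (0 : R[i]) < ((2 ^+ n)^-1 : R)%:C by rewrite ltcR.
  have /finite_seqP[s hs] := hf _ e0.
  exists (undup s); split=> [|j]; first exact: undup_uniq.
  rewrite mem_undup; have := congr1 (fun D : set (block_index T) => D j) hs => /= E.
  apply/idP/idP => h.
    by rewrite -lecR -nrmE -/(sub_norm (f j)); rewrite -[X in is_true X]/(_ <= _) in E *; rewrite E.
  by rewrite -E nrmE lecR.
(* The finitely many entries of norm at least 2^(-n): what is left out is below 2^(-n) in every
   component, and [dual_bound] turns this into a Cauchy estimate. *)
pose z n := \sum_(j <- s n) subval (f j).
have dz n : dual_part T (z n) by case: (component_sum (hs n).1 Bf).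
have cz n j : component j (z n) = if (2 ^+ n)^-1 <= nrm (subval (f j)) then subval (f j) else 0.
  by have [_ ->] := component_sum (hs n).1 Bf; rewrite (hs n).2.
have near n j : nrm (subval (f j) - component j (z n)) <= (2 ^+ n)^-1.
  rewrite cz; case: (leP (2 ^+ n)^-1 (nrm (subval (f j)))) => h.
    by rewrite subrr nrm0 ltW.
  by rewrite subr0 ltW.
pose rho n : R := 6 / 2 ^+ n.
have [|||x hx] := @lim_telescope R A z rho.
- move=> n; have -> : rho n - rho n.+1 = 2 * ((2 ^+ n)^-1 + (2 ^+ n.+1)^-1).
    by rewrite /rho exprS; field; rewrite gt_eqF // exprn_gt0.
  apply: (@dual_bound _ _ T); first by rewrite addr_ge0 ?ltW.
    exact: (subspaceB (dual_subspace T)).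
  move=> j; rewrite componentB //.
  rewrite -(subrKA (subval (f j))); apply: le_trans (ler_nrmD _ _) _.
  by rewrite addrC nrmC lerD // nrmC.
- by move=> n; rewrite divr_ge0 // exprn_ge0.
- by move=> e; exact: inv_pow2_small.
have dx : dual_part T x.
  have [_ /closed_nrmP cd] := dual_closed_ideal T; apply: cd => e e0.
  have [n hn] := inv_pow2_small 6 e0.
  by exists (z n) => //; exact: le_trans (hx n) hn.
exists x => // j; apply/eqP; rewrite -subr_eq0; apply/eqP.
apply: (@nrm_eq0_lin _ _ 2) => e e0; have [n hn] := inv_pow2_small 6 e0.
have -> : component j x - subval (f j) =
    component j (x - z n) - (subval (f j) - component j (z n)).
  by rewrite componentB //; zmod.
apply: le_trans (ler_nrmB _ _) _.
have h1 := component_le j (subspaceB (dual_subspace T) dx (dz n)).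
have h2 := le_trans h1 (le_trans (hx n) hn).
have h3 := near n j; have h4 : (2 ^+ n)^-1 <= e.
  by apply: le_trans hn; rewrite -[X in X <= _]mul1r ler_pM2r // ler1n.
lra.
Qed.

Lemma dual_part_dual : dual_cstar (dual_part T).
Proof.
pose phi x (j : block_index T) : ialg (block_ideal (iproj j)) :=
  mksub (S := block_sub (iproj j)) (componentP j x).1.
exists (block_index T), (fun j => ialg (block_ideal (iproj j))), phi.
split; first by move=> j; exact: block_elementary.
split.
- by move=> a x y j dx dy; apply: subval_inj; exact: component_lin.
- by move=> x y j dx dy; apply: subval_inj; exact: component_mul.
- by move=> x j dx; apply: subval_inj; exact: component_star.
- move=> x y /set_mem dx /set_mem dy xy; apply: component_inj dx dy _ => j.
  by have := congr1 (fun g => subval (g j)) xy.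
apply/seteqP; split=> [_ [x dx <-]|f /component_onto[x dx hx]]; last first.
  by exists x => //; apply: functional_extensionality_dep => j; apply: subval_inj; exact: hx.
move=> e /posC[r r0 ->].
(* Take g in the algebraic ideal within r / 2 of x: where its component vanishes, that of x is at
   most r / 2, and g has only finitely many nonzero components. *)
have r2 : 0 < r / 2 by lra.
have /closure_nrmP/(_ _ r2)[g Gg xg] := dx.
apply: sub_finite_set (gen_finite_components Gg) => j /= hj gj.
have hr : r <= nrm (component j x) by rewrite -lecR -nrmE.
have dg : dual_part T g by exact: subset_closure.
have := component_le j (subspaceB (dual_subspace T) dx dg).
rewrite componentB // gj subr0; lra.
Qed.

End DualCStar.

Theorem theorem4p5 (R : realType) (A : cstarAlgType R) (T : A -> A)
    (hT : left_centralizer (pedersen_ideal [set: A]) T) :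
  exists A0 A1 : set A,
    [/\ direct_sum_decomposition A0 A1, dual_cstar A1 & locally_bounded A0 T].
Proof.
exists (bounded_part T), (dual_part T); split.
- exact: splitting.
- exact: dual_part_dual.
- exact: locally_bounded_part.
Qed.
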